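(* Let $a>0$, and consider the differential equation $$\frac{dY}{dz}=\left(\Lambda(z)+R(z)\right)Y$$ with $$\Lambda(z)=\sum_{k=0}^h\Lambda^{(k)}z^{\sigma_k-1},\quad\Lambda^{(k)}\in\mathfrak h(n,\mathbb C),\quad 1=\sigma_0>\sigma_1>\dots>\sigma_h>0,\ \sigma_k\in\mathbb R,$$ and a perturbation term $R\in\mathscr O(\widetilde{\mathbb C}_a;\mathfrak{gl}(n,\mathbb C))$ satisfying the good decay condition on any open interval. With the notation of the context, let $\boldsymbol k\in\mathbb Z^\mu$ be adequate with respect to $(\sigma^{(\rho)};\tau_\rho)_{\rho=0}^{\mu-1}$, i.e. the open interval $$\Sigma_{\boldsymbol k}:=\bigcap_{\rho=0}^{\mu-1}\left]\tau_\rho+\frac{k_\rho\pi}{\sigma^{(\rho)}}-\pi;\ \tau_\rho+\frac{k_\rho\pi}{\sigma^{(\rho)}}\right[=:\left]a_{\boldsymbol k};b_{\boldsymbol k}\right[$$ is non-empty. Then there exists a unique fundamental matrix solution $Y_{\boldsymbol k}\colon\mathbb H_{I,a}\cap\widetilde{\mathbb C}_a\to GL(n,\mathbb C)$, with $I=\Sigma_{\boldsymbol k}+\frac\pi2$, with behaviour $$Y_{\boldsymbol k}(z)=\left(I_n+o(1)\right)\exp\{Q(z)\}$$ for $z\to\infty$ in $\mathbb H_{J,a}$, for any closed interval $J\subset I$. Equivalently, this behaviour holds for $z\to\infty$ in any closed subsector of $S_{\boldsymbol k}:=\{z\in\widetilde{\mathbb C^*}\mid a_{\boldsymbol k}<\arg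 z<b_{\boldsymbol k}+\pi\}$.
   Context: Notation. $\widetilde{\mathbb C^*}$ is the universal cover of $\mathbb C^*$; its points have modulus $|z|>0$ and argument $\arg z\in\mathbb R$, and $z^s=|z|^se^{\sqrt{-1}s\arg z}$. $\widetilde{\mathbb C}_a:=\{z\in\widetilde{\mathbb C^*}:|z|>a\}$. For $\phi\in\mathbb R$, $\mathbb H_{\phi,b}:=\{z\in\widetilde{\mathbb C^*}:\arg z\in\left]\phi-\frac\pi2;\phi+\frac\pi2\right[,\ |z|\ge\frac{b}{\cos(\phi-\arg z)}\}$, $\ell_{\phi,b}:=\partial\mathbb H_{\phi,b}$, and $\mathbb H_{I,b}:=\bigcup_{\phi\in I}\mathbb H_{\phi,b}$. $\mathfrak h(n,\mathbb C)$ denotes diagonal matrices; $\mathfrak{gl}(n,\mathbb C)$ carries an arbitrary norm; $\mathscr O(D;V)$ is the space of $V$-valued holomorphic functions on $D$. Good decay condition on an open interval $I$: for any closed interval $J\subseteq I$, $R$ is $L^1$-integrable (with respect to arc length) along $\ell_{\phi,b}$ for all $\phi\in J$ and $b>a$, and $\lim_{b\to+\infty}\sup_{\phi\in J}\|R|_{\ell_{\phi,b}}\|_1=0$. Block structure. Up to permutation, $\Lambda(z)=\Lambda_1(z)\oplus\dots\oplus\Lambda_\ell(z)$ with $\Lambda_i(z)=\sum_{k=0}^h\sigma_k\lambda_i^{(k)}z^{\sigma_k-1}I_{s_i}$, $\lambda_i^{(k)}\in\mathbb C$, $s_1+\dots+s_\ell=n$, and $\boldsymbol\lambda_i\ne\boldsymbol\lambda_j$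 for $i\ne j$, where $\boldsymbol\lambda_i:=(\lambda_i^{(0)},\dots,\lambda_i^{(h)})$ (and $\ell\ge2$). Set $Q(z):=q_1(z)I_{s_1}\oplus\dots\oplus q_\ell(z)I_{s_\ell}$, $q_i(z):=\sum_{k=0}^h\lambda_i^{(k)}z^{\sigma_k}$. For $i\ne j$ set $k_{ij}:=\min\{k\mid\lambda_i^{(k)}-\lambda_j^{(k)}\ne0\}$ and $\lambda_{ij}:=\lambda_i^{(k_{ij})}-\lambda_j^{(k_{ij})}$. The data $(\sigma^{(\rho)};\tau_\rho)$. Fix $\eta\in\mathbb R$ with $\eta\ne\arg\lambda_{ij}\bmod\pi$ for all $i\neq j$. For every ordered pair $(i,j)$, $i\ne j$, for which $\lambda_{ij}$ has a determination $\arg\lambda_{ij}\in\left]\eta-\pi;\eta\right[$, set $\tau_{ij}:=\frac1{\sigma_{k_{ij}}}\left(\frac{3\pi}2-\arg\lambda_{ij}\right)$. The distinct couples $(\sigma_{k_{ij}};\tau_{ij})$ so obtained are enumerated as $(\sigma^{(\rho)};\tau_\rho)$, $\rho=0,\dots,\mu-1$, with $\tau_0\le\tau_1\le\dots\le\tau_{\mu-1}$ (pairs with equal $\tau_{ij}$ and equal $\sigma_{k_{ij}}$ get the same label; pairs with equal $\tau_{ij}$ but different $\sigma_{k_{ij}}$ get different consecutive labels, in either order). *)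

(* Defs.v *)
From HB Require Import structures.
From mathcomp Require Import all_boot all_order all_algebra.
From mathcomp Require Import complex ring lra.
From mathcomp Require Import all_classical all_reals all_analysis.

Set Implicit Arguments.
Unset Strict Implicit.
Unset Printing Implicit Defensive.

Import Order.TTheory GRing.Theory Num.Theory.
Import numFieldNormedType.Exports.
Import Normc.

Local Open Scope classical_set_scope.
Local Open Scope ring_scope.
Local Open Scope complex_scope.

Section Complex.
Variable R : realType.

Definition polar (r t : R) : R[i] := (r * cos t) +i* (r * sin t).

Definition expc (w : R[i]) : R[i] := polar (expR (complex.Re w)) (complex.Im w).

Definition is_arg (w : R[i]) (t : R) : Prop := w = polar (normc w) t.

(* The points of the universal cover of C^* are the pairs (|z|, arg z) in R * R
   such that 0 < |z|; its topology is that of the product R * R. *)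
Definition ucover : set (R * R) := [set z | 0 < z.1].

Definition proj (z : R * R) : R[i] := polar z.1 z.2.

Definition zpow (z : R * R) (s : R) : R[i] := polar (z.1 `^ s) (s * z.2).

(* [proj] is a local coordinate on the cover, so d/dz is a limit of difference
   quotients with respect to it. *)
Definition is_cderiv (F : R * R -> R[i]) (z : R * R) (l : R[i]) : Prop :=
  (F w - F z) / (proj w - proj z) @[w --> z^'] --> (l : R[i]^o).

Definition is_mxderiv n (F : R * R -> 'M[R[i]]_n) (z : R * R) (L : 'M[R[i]]_n) :
    Prop :=
  forall p q, is_cderiv (fun w => F w p q) z (L p q).

Definition mx_holomorphic n (D : set (R * R)) (F : R * R -> 'M[R[i]]_n) : Prop :=
  forall z, D z -> exists L, is_mxderiv F z L.

Definition outer (a : R) : set (R * R) := [set z | ucover z /\ a < z.1].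

Definition HH (phi b : R) : set (R * R) :=
  [set z | [/\ ucover z, phi - pi / 2 < z.2 < phi + pi / 2
             & b / cos (phi - z.2) <= z.1]].

Definition HHI (I : set R) (b : R) : set (R * R) := \bigcup_(phi in I) HH phi b.

(* Arc-length parametrization of the boundary of [HH phi b], see [range_ell] and
   [proj_ell] below. *)
Definition ell (phi b t : R) : R * R :=
  (Num.sqrt (b ^+ 2 + t ^+ 2), phi + atan (t / b)).

Definition is_mxnorm n (N : 'M[R[i]]_n -> R) : Prop :=
  [/\ forall A B, N (A + B) <= N A + N B,
      forall (c : R[i]) A, N (c *: A) = normc c * N A
    & forall A, N A = 0 -> A = 0].

Definition is_closed_interval (J : set R) : Prop :=
  exists c d, c <= d /\ J = `[c, d]%classic.

Definition good_decay n (N : 'M[R[i]]_n -> R) (a : R)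
    (F : R * R -> 'M[R[i]]_n) (I : set R) : Prop :=
  forall J, is_closed_interval J -> J `<=` I ->
    (forall phi b, J phi -> a < b ->
       lebesgue_measure.-integrable setT (fun t => (N (F (ell phi b t)))%:E)) /\
    ereal_sup [set (\int[lebesgue_measure]_t (N (F (ell phi b t)))%:E)%E
              | phi in J] @[b --> +oo] --> 0%E.

(* The filter of z -> oo within S. *)
Definition infty_in (S : set (R * R)) : set_system (R * R) :=
  [set A | exists M : R, forall z, S z -> M < z.1 -> A z].

Global Instance infty_in_filter S : Filter (infty_in S).
Proof.
split.
- by exists 0.
- move=> A B [M hA] [M' hB]; exists (Num.max M M') => z Sz.
  by rewrite gt_max => /andP[zM zM']; split; [exact: hA|exact: hB].
- by move=> A B AB [M hA]; exists M => z Sz zM; exact/AB/hA.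
Qed.

(* exp of a diagonal matrix *)
Definition exp_diag n (d : 'rV[R[i]]_n) : 'M[R[i]]_n :=
  diag_mx (map_mx expc d).

(* Y z = (1 + o(1)) exp (diag (q z)) as z -> oo in S. *)
Definition exp_behaviour n (N : 'M[R[i]]_n -> R) (q : R * R -> 'rV[R[i]]_n)
    (Y : R * R -> 'M[R[i]]_n) (S : set (R * R)) : Prop :=
  exists E : R * R -> 'M[R[i]]_n,
    (\forall z \near infty_in S, Y z = (1%:M + E z) *m exp_diag (q z)) /\
    N (E z) @[z --> infty_in S] --> (0 : R).

Definition fundamental_solution n (A : R * R -> 'M[R[i]]_n) (D : set (R * R))
    (Y : R * R -> 'M[R[i]]_n) : Prop :=
  forall z, D z -> Y z \in unitmx /\ is_mxderiv Y z (A z *m Y z).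

Definition sector (c d : R) : set (R * R) := [set z | ucover z /\ c < z.2 < d].

Definition is_closed_subsector (S T : set (R * R)) : Prop :=
  exists c d, [/\ c <= d, T = [set z | ucover z /\ c <= z.2 <= d] & T `<=` S].

End Complex.

Section Data.
Variables (R : realType) (h l : nat).
Variables (sigma : 'I_h.+1 -> R) (lam : 'I_l -> 'I_h.+1 -> R[i]).

(* The value ord0 is irrelevant: it only occurs when lam i = lam j. *)
Definition kmin (i j : 'I_l) : 'I_h.+1 :=
  odflt ord0 [pick k | (lam i k != lam j k) &&
    [forall k' : 'I_h.+1, (k' < k)%N ==> (lam i k' == lam j k')]].

Definition lamd (i j : 'I_l) : R[i] := lam i (kmin i j) - lam j (kmin i j).

Definition generic_dir (eta : R) : Prop :=
  forall i j t (m : int), i != j -> is_arg (lamd i j) t -> eta <> t + m%:~R * pi.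

Definition couples (eta : R) : set (R * R) :=
  [set p | exists i j t, [/\ i != j, is_arg (lamd i j) t, eta - pi < t < eta
     & p = (sigma (kmin i j), (sigma (kmin i j))^-1 * (3 * pi / 2 - t))]].

Definition enumerates_couples (eta : R) (mu : nat) (sr tau : 'I_mu -> R) : Prop :=
  [/\ injective (fun rho => (sr rho, tau rho)),
      range (fun rho => (sr rho, tau rho)) = couples eta
    & forall rho rho' : 'I_mu, (rho <= rho')%N -> tau rho <= tau rho'].

End Data.

Definition Sigma_set (R : realType) (mu : nat) (sr tau : 'I_mu -> R)
    (k : 'I_mu -> int) : set R :=
  \bigcap_(rho : 'I_mu) `]tau rho + (k rho)%:~R * pi / sr rho - pi,
                         tau rho + (k rho)%:~R * pi / sr rho[%classic.

Definition Lambda_of (R : realType) (h n : nat) (sigma : 'I_h.+1 -> R)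
    (Lam : 'I_h.+1 -> 'M[R[i]]_n) (z : R * R) : 'M[R[i]]_n :=
  \sum_k zpow z (sigma k - 1) *: Lam k.

(* The diagonal of Q(z), where blk p is the block of the p-th diagonal entry. *)
Definition qdiag (R : realType) (h l n : nat) (sigma : 'I_h.+1 -> R)
    (lam : 'I_l -> 'I_h.+1 -> R[i]) (blk : 'I_n -> 'I_l) (z : R * R) :
    'rV[R[i]]_n :=
  \row_p \sum_k lam (blk p) k * zpow z (sigma k).

Section Facts.
Variable R : realType.
Implicit Types (phi b t : R).

Lemma kminP (h l : nat) (lam : 'I_l -> 'I_h.+1 -> R[i]) i j :
  lam i <> lam j ->
  lam i (kmin lam i j) != lam j (kmin lam i j) /\
  forall k : 'I_h.+1, (k < kmin lam i j)%N -> lam i k = lam j k.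
Proof.
move=> neq; rewrite /kmin; case: pickP => [k /andP[nk /forallP hk]|none] /=.
  by split=> // k' k'k; exact/eqP/(implyP (hk k')).
exfalso; apply: neq; apply/funext => k; apply/eqP/negPn/negP => nk.
case: (arg_minnP (fun k : 'I_h.+1 => k : nat) (P := fun k => lam i k != lam j k) nk).
move=> k0 nk0 min0; move: (none k0); rewrite nk0 /= => /negP; apply.
apply/forallP => k'; apply/implyP => k'k; apply/negPn/negP => /min0.
by rewrite leqNgt k'k.
Qed.

Lemma ell_trig phi b t : 0 < b ->
  (ell phi b t).1 * cos (atan (t / b)) = b /\
  (ell phi b t).1 * sin (atan (t / b)) = t.
Proof.
move=> b0; have bn0 : b != 0 by rewrite gt_eqF.
have E : (ell phi b t).1 = b * Num.sqrt (1 + (t / b) ^+ 2).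
  rewrite /ell /= -{2}(ger0_norm (ltW b0)) -sqrtr_sqr -sqrtrM ?sqr_ge0//.
  congr Num.sqrt; field; exact: bn0.
have s0 : Num.sqrt (1 + (t / b) ^+ 2) != 0.
  by rewrite gt_eqF// sqrtr_gt0 ltr_pwDl// sqr_ge0.
have C : (ell phi b t).1 * cos (atan (t / b)) = b.
  by rewrite E cos_atan mulfK.
split => //.
have cn0 : cos (atan (t / b)) != 0 by rewrite cos_atan invr_neq0.
have : tan (atan (t / b)) = t / b by rewrite atanK.
rewrite /tan => /(canRL (divfK cn0)) ->.
by rewrite mulrCA C divfK.
Qed.

(* In C, [ell phi b] is the line e^(i phi) (b + i t), which has unit speed. *)
Lemma proj_ell phi b t : 0 < b ->
  proj (ell phi b t) = polar 1 phi * (b +i* t).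
Proof.
move=> /(ell_trig phi t)[C S]; rewrite /proj /polar.
rewrite -[in RHS]C -[X in _ = _ * (_ +i* X)]S !mul1r /= cosD sinD.
by apply/eqP; rewrite eq_complex /=; apply/andP; split; apply/eqP; ring.
Qed.

Lemma HHE phi b : 0 < b -> HH phi b =
  [set z | [/\ 0 <= z.1, phi - pi / 2 <= z.2, z.2 <= phi + pi / 2
             & b <= z.1 * cos (phi - z.2)]].
Proof.
move=> b0; apply/seteqP; split => -[r u] /=.
  move=> [/= r0 /andP[/= l1 l2]]; have c0 : 0 < cos (phi - u).
    by apply: cos_gt0_pihalf; apply/andP; split; lra.
  by rewrite ler_pdivrMr// => h; split => //; exact: ltW.
move=> [/= r0 l1 l2 h].
have c0 : 0 < cos (phi - u).
  rewrite ltNge; apply/negP => c0.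
  by have := le_trans h (mulr_ge0_le0 r0 c0); rewrite leNgt b0.
have r1 : 0 < r.
  by rewrite lt_neqAle r0 andbT; apply: contraTN (h) => /eqP <-; rewrite mul0r -ltNge.
split => //; last by rewrite ler_pdivrMr.
rewrite !lt_neqAle l1 l2 !andbT; apply/andP; split.
  apply/eqP => /= E; move: c0; rewrite /= -E (_ : phi - _ = pi / 2); last by ring.
  by rewrite cos_pihalf ltxx.
apply/eqP => /= E; move: c0; rewrite /= E (_ : phi - _ = - (pi / 2)); last by ring.
by rewrite cosN cos_pihalf ltxx.
Qed.

Lemma continuous_HH phi : continuous (fun z : R * R => z.1 * cos (phi - z.2)).
Proof.
move=> z; apply: cvgM; first exact: cvg_fst.
apply: (@continuous_comp _ _ _ (fun z : R * R => phi - z.2) cos).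
  by apply: cvgB; [exact: cvg_cst|exact: cvg_snd].
exact: continuous_cos.
Qed.

Lemma closed_HH phi b : 0 < b -> closed (HH phi b).
Proof.
move=> b0; rewrite HHE//.
rewrite (_ : mkset _ = [set z : R * R | 0 <= z.1] `&`
  [set z : R * R | phi - pi / 2 <= z.2] `&`
  [set z : R * R | z.2 <= phi + pi / 2] `&`
  [set z : R * R | b <= z.1 * cos (phi - z.2)]); last first.
  by apply/seteqP; split => z /=; [move=> []|move=> [[[]]]].
have c1 : continuous (fst : R * R -> R) by move=> z; exact: cvg_fst.
have c2 : continuous (snd : R * R -> R) by move=> z; exact: cvg_snd.
apply: closedI; [apply: closedI; [apply: closedI|]|].
- exact: (@preimage_closed _ _ fst [set y : R | 0 <= y] (fun z _ => c1 z) (@closed_ge _ _)).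
- exact: (@preimage_closed _ _ snd [set y : R | phi - pi / 2 <= y] (fun z _ => c2 z) (@closed_ge _ _)).
- exact: (@preimage_closed _ _ snd [set y : R | y <= phi + pi / 2] (fun z _ => c2 z) (@closed_le _ _)).
- exact: (@preimage_closed _ _ _ [set y : R | b <= y] (fun z _ => @continuous_HH phi z) (@closed_ge _ _)).
Qed.

Lemma interior_HH phi b : 0 < b -> interior (HH phi b) =
  [set z | [/\ ucover z, phi - pi / 2 < z.2 < phi + pi / 2
             & b / cos (phi - z.2) < z.1]].
Proof.
move=> b0; apply/seteqP; split => -[r u] /=; last first.
  move=> [/= r0 /andP[/= l1 l2]]; have c0 : 0 < cos (phi - u).
    by apply: cos_gt0_pihalf; apply/andP; split; lra.
  rewrite ltr_pdivrMr// => h; rewrite HHE//.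
  have F1 : z.1 @[z --> (r, u)] --> r by exact: cvg_fst.
  have F2 : z.2 @[z --> (r, u)] --> u by exact: cvg_snd.
  have P1 := cvgr_gt _ F1 _ r0.
  have P2 := cvgr_gt _ F2 _ l1.
  have P3 := cvgr_lt _ F2 _ l2.
  have P4 := cvgr_gt _ (@continuous_HH phi (r, u)) _ h.
  near=> z; split; apply: ltW; near: z; [exact: P1|exact: P2|exact: P3|exact: P4].
move=> hn; have [r0 l c] := nbhs_singleton hn; split => //.
rewrite lt_neqAle c andbT; apply/eqP => rE.
case: hn => -[A B] /= [nA nB] sub.
have /nbhs_ballP[e /= e0 eA] := nA.
have Ay : A (r - e / 2).
  by apply: eA; rewrite /ball /= opprB addrCA subrr addr0 gtr0_norm; lra.
have [_ _ /=] := sub (r - e / 2, u) (conj Ay (nbhs_singleton nB)).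
by rewrite rE; lra.
Unshelve. all: by end_near. Qed.

Lemma range_ell phi b : 0 < b ->
  range (ell phi b) = closure (HH phi b) `\` interior (HH phi b).
Proof.
move=> b0; rewrite -(closure_id _).1; last exact: closed_HH.
rewrite interior_HH//; apply/seteqP; split.
  move=> _ [t _ <-]; have [C _] := ell_trig phi t b0.
  have /andP[l1 l2] := (atan_def (t / b)).1.
  have c0 : 0 < cos (phi - (ell phi b t).2).
    by apply: cos_gt0_pihalf => /=; apply/andP; split; lra.
  have E : b / cos (phi - (ell phi b t).2) = (ell phi b t).1.
    apply: (canLR (mulfK _)); first by rewrite gt_eqF.
    by rewrite (_ : phi - _ = - atan (t / b)) ?cosN ?C//=; ring.
  split; last by move=> [_ _]; rewrite E ltxx.
  split; last by rewrite E.
  - by rewrite /ucover; change (0 < (ell phi b t).1); rewrite -E divr_gt0.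
  - by rewrite /=; apply/andP; split; lra.
move=> [r u] [[r0 /= l c] nh].
have rE : r = b / cos (phi - u).
  apply/eqP; rewrite eq_le c andbT leNgt; apply/negP => h; apply: nh; split => //.
have l' : - (pi / 2) < u - phi < pi / 2 by move: l => /andP[? ?]; apply/andP; split; lra.
exists (b * tan (u - phi)) => //.
rewrite /ell mulrAC divff ?gt_eqF// mul1r tanK ?in_itv//= (addrC phi) subrK.
congr pair; rewrite rE -cosN opprB.
have c0 := cos_gt0_pihalf l'.
rewrite exprMn -{1}(mulr1 (b ^+ 2)) -mulrDr -cos2_tan2 ?gt_eqF//.
by rewrite -exprVn -exprMn sqrtr_sqr ger0_norm// ltW// divr_gt0.
Qed.
End Facts.

(* Main.v *)
(** Write [Y = (1 + F) e^Q].  On the boundary line of a half-plane of direction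
    [phi] in [I], every [Re (q_i - q_j)] is monotone as soon as the line is far
    enough from the origin, because [phi - pi/2] lies in [Sigma]: the leading
    term changes sign exactly once on the line, at the Stokes direction
    [tau' = tau_rho + k_rho pi / sigma], and the lower order terms are dominated.
    Hence the variation-of-constants formula for [F], entry [(p, j)] being
    integrated from the end of the line at which [e^(q_p - q_j)] is large, is a
    contraction for the sup norm once the [L^1] norm of the perturbation on the
    lines is at most [1/2].  Cauchy's theorem, together with the integrability on
    all parallel lines, makes the fixed point holomorphic on the half-plane, with
    [|F|] bounded on each line by twice the [L^1] norm, which tends to [0]; the
    linear equation extends the solution to the whole half-plane.

    Two such solutions differ by a constant matrix [C] such that
    [e^Q C e^(- Q) -> 1] along rays.  The directions common to two half-planes
    contain every [tau'], hence rays on which [Re (q_i - q_j)] has the sign that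
    forces [C = 1].  This gives uniqueness, and it glues the solutions on the
    half-planes, which cover the domain. *)

Require Import Defs.
From HB Require Import structures.
From mathcomp Require Import all_boot all_order all_algebra.
From mathcomp Require Import complex ring lra.
From mathcomp Require Import all_classical all_reals all_analysis.
From mathcomp Require Import measurable_realfun.

Set Implicit Arguments.
Unset Strict Implicit.
Unset Printing Implicit Defensive.

Import Order.TTheory GRing.Theory Num.Theory.
Import numFieldNormedType.Exports.
Import Normc.

Local Open Scope classical_set_scope.
Local Open Scope ring_scope.
Local Open Scope complex_scope.

(** * Differentiation *)

(** No complex integral is ever formed: an integral is the increment of a primitive, and it is
    bounded by comparing that primitive with a real [rho] whose derivative dominates the integrand.
    Primitives on a half-plane come from Goursat's theorem, but the integration has to start at
    infinity, on each vertical line separately. The obstacle is that the limit of the primitive at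
    that end could depend on the line; showing that it does not is the core of [decaying_primitive].

    The half-planes live on the universal cover, where [chart phi] gives them a complex coordinate
    in which [ell phi b] is the vertical line of abscissa [b].

    A point of [HHI J a] can go to infinity while staying at bounded distance from the boundary of
    every half-plane with direction in [J] that contains it, and then the norms on the lines give no
    estimate. Hence [J] is enlarged inside the open interval [I]: each far point lies deep in a
    half-plane of some direction of the larger interval, and the estimates are made uniform over
    that interval, which the decay condition on closed intervals allows. *)

Section Modulus.
Variable R : realType.
Implicit Types (x y z : R[i]) (r s : R).

Lemma normc_ge0 z : 0 <= normc z.
Proof. by case: z => u v; exact: sqrtr_ge0. Qed.

Lemma normc_real r : normc r%:C = `|r|.
Proof. by rewrite /normc /= expr0n addr0 sqrtr_sqr. Qed.

Lemma normc_eq0 z : (normc z == 0) = (z == 0).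
Proof. by apply/eqP/eqP => [/eq0_normc//|->]; rewrite normc0. Qed.

Lemma normc_gt0 z : (0 < normc z) = (z != 0).
Proof. by rewrite lt0r normc_eq0 normc_ge0 andbT. Qed.

Lemma le_normcB x y : normc (x - y) <= normc x + normc y.
Proof. by rewrite (le_trans (le_normcD _ _))// normcN. Qed.

Lemma normc_distC x y : normc (x - y) = normc (y - x).
Proof. by rewrite -normcN opprB. Qed.

Lemma normc_dist_triangle y x z : normc (x - z) <= normc (x - y) + normc (y - z).
Proof. by rewrite (le_trans _ (le_normcD _ _))// addrA subrK. Qed.

Lemma ler_normc_sub x y : `|normc x - normc y| <= normc (x - y).
Proof.
rewrite ler_norml; apply/andP; split.
  have := le_normcD x (y - x); rewrite addrC subrK (normc_distC y); lra.
have := le_normcD y (x - y); rewrite addrC subrK; lra.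
Qed.

Lemma normc_conj z : normc z^*%C = normc z.
Proof. by case: z => u v /=; rewrite sqrrN. Qed.

Lemma normc_Re z : `|complex.Re z| <= normc z.
Proof.
case: z => u v /=; rewrite -sqrtr_sqr ler_sqrt ?addr_ge0 ?sqr_ge0//.
by rewrite lerDl sqr_ge0.
Qed.

Lemma normc_Im z : `|complex.Im z| <= normc z.
Proof.
case: z => u v /=; rewrite -sqrtr_sqr ler_sqrt ?addr_ge0 ?sqr_ge0//.
by rewrite lerDr sqr_ge0.
Qed.

Lemma normc_le_ReIm z : normc z <= `|complex.Re z| + `|complex.Im z|.
Proof.
apply: le_trans (_ : normc ((complex.Re z)%:C + (complex.Im z)%:C * 'i%C) <= _).
  by rewrite mulrC -complexE.
apply: le_trans (le_normcD _ _) _; rewrite normcM !normc_real.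
by rewrite [normc 'i%C]/normc /= expr0n expr1n add0r sqrtr1 mulr1.
Qed.

Lemma cReD x y : complex.Re (x + y) = complex.Re x + complex.Re y.
Proof. by case: x; case: y. Qed.

Lemma cReN x : complex.Re (- x) = - complex.Re x.
Proof. by case: x. Qed.

Lemma cReM x y : complex.Re (x * y) =
  complex.Re x * complex.Re y - complex.Im x * complex.Im y.
Proof. by case: x; case: y. Qed.

Lemma cImD x y : complex.Im (x + y) = complex.Im x + complex.Im y.
Proof. by case: x; case: y. Qed.

Lemma cImN x : complex.Im (- x) = - complex.Im x.
Proof. by case: x. Qed.

Lemma cImM x y : complex.Im (x * y) =
  complex.Re x * complex.Im y + complex.Im x * complex.Re y.
Proof. by case: x; case: y. Qed.

Lemma normc_sum (I : Type) (s : seq I) (P : pred I) (F : I -> R[i]) :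
  normc (\sum_(i <- s | P i) F i) <= \sum_(i <- s | P i) normc (F i).
Proof.
elim/big_ind2 : _ => [|u v u' v' h h'|//]; first by rewrite normc0.
exact: le_trans (le_normcD _ _) (lerD h h').
Qed.

(* The conjugate of [z / |z|], or [1] when [z = 0]. *)
Lemma normc_rotate z : exists2 c, normc c = 1 & complex.Re (c * z) = normc z.
Proof.
have [->|z0] := eqVneq z 0; first by exists 1; rewrite ?mulr0 ?normc1// normc0.
have m0 : normc z != 0 by rewrite normc_eq0.
exists ((normc z)^-1%:C * z^*%C).
  rewrite normcM normc_real ger0_norm ?invr_ge0 ?normc_ge0//.
  by case: z {z0} m0 => u v /=; rewrite sqrrN => /mulVf.
case: z {z0} m0 => u v m0 /=; rewrite !(mul0r, subr0, addr0, add0r).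
set m := Num.sqrt _ in m0 *.
have e : m * m = u * u + v * v.
  by rewrite -expr2 /m sqr_sqrtr ?addr_ge0 ?sqr_ge0// !expr2.
transitivity (m^-1 * (u * u + v * v)); first by ring.
by rewrite -e mulKf.
Qed.

End Modulus.

(** * Derivatives and mean value inequalities *)

Section Derivative.
Variable R : realType.
Local Notation C := R[i].

(* The remainder [E] is negligible against the increment of [j] at [x]. *)
Definition lo (X : Type) (j : X -> C) (x : X) (E : X -> C) : Prop :=
  forall e : R, 0 < e -> exists2 d : R, 0 < d &
    forall y, normc (j y - j x) < d -> normc (E y) <= e * normc (j y - j x).

(* [dF/dj = l] at [x]; this covers complex derivatives ([j] the identity), real
   ones ([j] the inclusion of R in C) and derivatives along a chart. *)
Definition der (X : Type) (j : X -> C) (F : X -> C) (x : X) (l : C) : Prop :=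
  lo j x (fun y => F y - F x - l * (j y - j x)).

Definition cder (f : C -> C) (z l : C) := der id f z l.
Definition rder (F : R -> C) (s : R) (l : C) := der (real_complex R) F s l.

Section Rules.
Variables (X : Type) (j : X -> C) (x : X).
Implicit Types (F G : X -> C) (l m c : C).

Lemma loD E E' : lo j x E -> lo j x E' -> lo j x (fun y => E y + E' y).
Proof.
move=> h h' e e0; have e2 : 0 < e / 2 by rewrite divr_gt0.
have [d d0 H] := h _ e2; have [d' d'0 H'] := h' _ e2.
exists (Num.min d d'); first by rewrite lt_min d0.
move=> y; rewrite lt_min => /andP[/H{}H /H'{}H'].
apply: le_trans (le_normcD _ _) _; lra.
Qed.

Lemma loM E B (K : R) : lo j x E ->
  (exists2 d : R, 0 < d & forall y, normc (j y - j x) < d -> normc (B y) <= K) ->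
  lo j x (fun y => B y * E y).
Proof.
move=> h [d d0 hB] e e0.
have K1 : 0 < `|K| + 1 by rewrite ltr_wpDl.
have [d' d'0 H] := h (e / (`|K| + 1)) (divr_gt0 e0 K1).
exists (Num.min d d'); first by rewrite lt_min d0.
move=> y; rewrite lt_min => /andP[/hB{}hB /H{}H].
rewrite normcM.
have hB' : normc (B y) <= `|K| + 1 by rewrite (le_trans hB)// (le_trans (ler_norm _))// lerDl.
apply: le_trans (ler_pM (normc_ge0 _) (normc_ge0 _) hB' H) _.
by rewrite mulrA mulrCA divff ?mulr1// gt_eqF.
Qed.

Lemma der_lip F l : der j F x l -> exists2 d : R, 0 < d &
  forall y, normc (j y - j x) < d ->
    normc (F y - F x) <= (normc l + 1) * normc (j y - j x).
Proof.
move=> h; have [d d0 H] := h 1 ltr01; exists d => // y /H{}H.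
rewrite -(subrK (l * (j y - j x)) (F y - F x)).
apply: le_trans (le_normcD _ _) _; rewrite normcM.
lra.
Qed.

Lemma der_cont F l : der j F x l -> forall e : R, 0 < e -> exists2 d : R, 0 < d &
  forall y, normc (j y - j x) < d -> normc (F y - F x) <= e.
Proof.
move=> /der_lip[d d0 H] e e0.
have l1 : 0 < normc l + 1 by rewrite ltr_wpDl ?normc_ge0.
exists (Num.min d (e / (normc l + 1))); first by rewrite lt_min d0 divr_gt0.
move=> y; rewrite lt_min => /andP[/H{}H]; rewrite ltr_pdivlMr// => h.
by rewrite (le_trans H)// mulrC ltW.
Qed.

Lemma der_bounded F l : der j F x l -> exists2 d : R, 0 < d &
  forall y, normc (j y - j x) < d -> normc (F y) <= normc (F x) + 1.
Proof.
move=> /der_cont /(_ 1 ltr01)[d d0 H]; exists d => // y /H{}H.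
rewrite -(subrK (F x) (F y)) addrC (le_trans (le_normcD _ _))//; lra.
Qed.

Lemma der_cst c : der j (fun=> c) x 0.
Proof.
move=> e e0; exists 1 => // y _.
by rewrite subrr mul0r subr0 normc0 mulr_ge0 ?normc_ge0// ltW.
Qed.

Lemma der_id : der j j x 1.
Proof.
move=> e e0; exists 1 => // y _.
by rewrite mul1r subrr normc0 mulr_ge0 ?normc_ge0// ltW.
Qed.

Lemma derD F G l m : der j F x l -> der j G x m ->
  der j (fun y => F y + G y) x (l + m).
Proof.
move=> h h'; have := loD h h'; congr lo; apply/funext => y; ring.
Qed.

Lemma derMc F l c : der j F x l -> der j (fun y => c * F y) x (c * l).
Proof.
move=> h; have := @loM _ (fun=> c) (normc c) h; rewrite /der => H.
have {}H := H (ex_intro2 _ _ 1 ltr01 (fun _ _ => lexx _)).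
move: H; congr lo; apply/funext => y; ring.
Qed.

Lemma derB F G l m : der j F x l -> der j G x m ->
  der j (fun y => F y - G y) x (l - m).
Proof.
move=> h h'; have := derD h (derMc (-1) h').
rewrite mulN1r; congr der; apply/funext => y; ring.
Qed.

Lemma derM F G l m : der j F x l -> der j G x m ->
  der j (fun y => F y * G y) x (l * G x + F x * m).
Proof.
move=> h h'.
have A := loM h (der_bounded h').
have B := @loM _ (fun=> F x) (normc (F x)) h' (ex_intro2 _ _ 1 ltr01 (fun _ _ => lexx _)).
have D : lo j x (fun y => l * (j y - j x) * (G y - G x)).
  move=> e e0; have l1 : 0 < normc l + 1 by rewrite ltr_wpDl ?normc_ge0.
  have [d d0 H] := der_cont h' (divr_gt0 e0 l1).
  exists d => // y /H{}H; rewrite !normcM mulrC mulrA ler_wpM2r ?normc_ge0//.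
  move: H; rewrite ler_pdivlMr// => H; apply: le_trans H.
  by rewrite ler_wpM2l ?normc_ge0// lerDl.
have := loD (loD A B) D; congr lo; apply/funext => y; ring.
Qed.

Lemma der_sum (I : Type) (s : seq I) (F : I -> X -> C) (L : I -> C) :
  (forall i, der j (F i) x (L i)) ->
  der j (fun y => \sum_(i <- s) F i y) x (\sum_(i <- s) L i).
Proof.
move=> h; elim: s => [|i s IH].
  by rewrite big_nil; under eq_fun do rewrite big_nil; exact: der_cst.
by rewrite big_cons; under eq_fun do rewrite big_cons; exact: derD.
Qed.

(** The intermediate variable lives in a second set with its own chart [k]: one rule covers complex
    composition, reparametrization of a real variable and curves in the plane. *)
Lemma der_chain (Y : Type) (k : Y -> C) (g : X -> Y) (f : Y -> C) l m :
  der j (fun y => k (g y)) x l -> der k f (g x) m ->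
  der j (fun y => f (g y)) x (m * l).
Proof.
move=> hg hf e e0.
have l1 : 0 < normc l + 1 by rewrite ltr_wpDl ?normc_ge0.
have m1 : 0 < normc m + 1 by rewrite ltr_wpDl ?normc_ge0.
have e2 : 0 < e / 2 by rewrite divr_gt0.
have [d d0 H] := hf _ (divr_gt0 e2 l1).
have [d1 d10 H1] := hg _ (divr_gt0 e2 m1).
have [d2 d20 H2] := der_lip hg.
have dd : 0 < d / (normc l + 1) by rewrite divr_gt0.
exists (Num.min (Num.min d1 d2) (d / (normc l + 1))); first by rewrite !lt_min d10 d20.
move=> y; rewrite !lt_min => /andP[/andP[/H1{}H1 /H2{}H2]].
rewrite ltr_pdivlMr// mulrC => /(le_lt_trans H2)/H{}H.
have -> : f (g y) - f (g x) - m * l * (j y - j x) =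
  (f (g y) - f (g x) - m * (k (g y) - k (g x))) +
  m * (k (g y) - k (g x) - l * (j y - j x)) by ring.
apply: le_trans (le_normcD _ _) _; rewrite normcM.
set D := normc (j y - j x) in H1 H2 *.
have A : e / 2 / (normc l + 1) * normc (k (g y) - k (g x)) <= e / 2 * D.
  by rewrite mulrAC ler_pdivrMr// -[leRHS]mulrA ler_pM2l// mulrC.
have B : normc m * normc (k (g y) - k (g x) - l * (j y - j x)) <= e / 2 * D.
  apply: (@le_trans _ _ ((normc m + 1) * (e / 2 / (normc m + 1) * D))).
    by rewrite ler_pM ?normc_ge0// lerDl.
  by rewrite mulrA mulrCA divff ?mulr1// gt_eqF.
by rewrite [e]splitr mulrDl lerD// (le_trans H A).
Qed.

Lemma der_comp (g : X -> C) (f : C -> C) l m : der j g x l -> cder f (g x) m ->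
  der j (fun y => f (g y)) x (m * l).
Proof. exact: der_chain. Qed.

Lemma der_eq F G l m : (forall y, F y = G y) -> l = m -> der j F x l -> der j G x m.
Proof. by move=> /funext -> ->. Qed.

Lemma der_local F G l (d : R) : 0 < d ->
  (forall y, normc (j y - j x) < d -> F y = G y) -> der j F x l -> der j G x l.
Proof.
move=> d0 FG h e e0; have [d' d'0 H] := h e e0.
exists (Num.min d d'); first by rewrite lt_min d0.
move=> y; rewrite lt_min => /andP[hd /H]; rewrite FG// (FG x)//.
by rewrite subrr normc0.
Qed.

End Rules.

(** Reflection in the real axis reverses the vertical lines; through it, decay at the upper end of a
    line reduces to decay at the lower end. *)
Lemma cder_conj (f : C -> C) z l : cder f (z^*%C) l ->
  cder (fun w => (f w^*%C)^*%C) z l^*%C.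
Proof.
move=> h e e0; have [d d0 H] := h e e0; exists d => // y.
move=> yz; have := H y^*%C; rewrite -rmorphB normc_conj => /(_ yz).
by rewrite -[X in _ -> X <= _]normc_conj; rewrite !rmorphB rmorphM !rmorphB /= !conjcK.
Qed.

Lemma rder_is_derive (F : R -> C) s l : rder F s l ->
  is_derive s 1 (fun t => complex.Re (F t)) (complex.Re l).
Proof.
move=> h.
have H : (fun k : R => k^-1 *: (((fun t => complex.Re (F t)) \o shift s) (k *: 1) -
    complex.Re (F s))) @ 0^' --> complex.Re l.
  apply/cvgrPdist_le => e e0; have [d d0 H] := h e e0.
  near=> k.
  have k0 : k != 0 by near: k; exact: nbhs_dnbhs_neq.
  have kd : `|k| < d by near: k; apply: dnbhs0_lt.
  have := H (k + s); rewrite -rmorphB addrK normc_real => /(_ kd) {}H.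
  rewrite /= [k *: 1]mulr1 distrC /GRing.scale /=.
  set A := complex.Re (F (k + s)) - complex.Re (F s).
  have -> : k^-1 * A - complex.Re l = k^-1 * (A - complex.Re l * k).
    by rewrite [RHS]mulrBr [k^-1 * (_ * _)]mulrCA mulVf// mulr1.
  rewrite normrM normrV ?unitfE// ler_pdivrMl ?normr_gt0// [leRHS]mulrC.
  apply: le_trans (H); apply: le_trans (normc_Re _).
  by rewrite !(cReD, cReN, cReM) /= mulr0 subr0 /A.
by apply: DeriveDef; [apply/cvg_ex; exists (complex.Re l)|exact: cvg_lim].
Unshelve. all: by end_near. Qed.

Lemma is_derive_rder (f : R -> R) (s l : R) : is_derive s 1 f l ->
  rder (fun t => (f t)%:C) s l%:C.
Proof.
move=> [df dl] e e0.
have : (fun k : R => k^-1 *: ((f \o shift s) (k *: 1) - f s)) @ 0^' --> l.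
  by rewrite -dl.
move=> /cvgrPdist_le /(_ e e0); rewrite /dnbhs /within /= => /nbhs_ballP[d /= d0 H].
exists d => // y.
suff : `|y - s| < d -> `|f y - f s - l * (y - s)| <= e * `|y - s|.
  by rewrite -!normc_real !(rmorphB, rmorphM).
move=> yd.
have [->|ys] := eqVneq y s; first by rewrite !subrr mulr0 subrr normr0 mulr0.
have ys0 : y - s != 0 by rewrite subr_eq0.
have := H (y - s); rewrite /ball /= sub0r normrN => /(_ yd ys0).
rewrite [_ *: 1]mulr1 subrK /GRing.scale /= => {}H.
have -> : f y - f s - l * (y - s) = (y - s) * ((y - s)^-1 * (f y - f s) - l).
  by rewrite [RHS]mulrBr mulVKf// (mulrC l).
by rewrite normrM mulrC ler_pM2r ?normr_gt0// distrC.
Qed.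

Definition rderR (f : R -> R) s l := rder (fun t => (f t)%:C) s l%:C.

Lemma rderR_homo (f f' : R -> R) (a b : R) : a <= b ->
  (forall s, a <= s <= b -> rderR f s (f' s)) ->
  (forall s, a <= s <= b -> 0 <= f' s) -> f a <= f b.
Proof.
move=> ab hf f0.
have D s : a <= s <= b -> is_derive s 1 f (f' s) by move=> /hf /rder_is_derive.
have [||c cab E] := @MVT_segment _ f f' a b ab.
- by move=> s; rewrite in_itv /= => /andP[h1 h2]; apply: D; rewrite !ltW.
- apply: derivable_within_continuous => s; rewrite in_itv /= => /D h.
  exact: ex_derive.
rewrite -subr_ge0 E mulr_ge0 ?subr_ge0//; apply: f0.
by move: cab; rewrite in_itv.
Qed.

(** A unit [c] turns the increment of [F] into a nonnegative real, and [rho - Re (c F)] is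
    nondecreasing because its derivative is [r - Re (c F')]. With [rho] a primitive of an integrable
    density, this stands for the bound of an integral by the integral of the modulus. *)
Lemma rder_mvt (F F' : R -> C) (rho r : R -> R) (a b : R) : a <= b ->
  (forall s, a <= s <= b -> rder F s (F' s)) ->
  (forall s, a <= s <= b -> rderR rho s (r s)) ->
  (forall s, a <= s <= b -> normc (F' s) <= r s) ->
  normc (F b - F a) <= rho b - rho a.
Proof.
move=> ab hF hr le.
have [c c1 cE] := normc_rotate (F b - F a).
rewrite -cE.
suff : rho a - complex.Re (c * F a) <= rho b - complex.Re (c * F b).
  rewrite mulrBr cReD cReN; lra.
apply: (@rderR_homo (fun s => rho s - complex.Re (c * F s))
  (fun s => r s - complex.Re (c * F' s))) => // s sab.
  have := rder_is_derive (derMc c (hF s sab)) => /is_derive_rder h.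
  have := derB (hr s sab) h; rewrite /rderR /rder rmorphB.
  by congr der; apply/funext => y; rewrite rmorphB.
rewrite subr_ge0; apply: le_trans (le s sab).
by rewrite -[leRHS]mul1r -c1 -normcM (le_trans (ler_norm _))// normc_Re.
Qed.

Lemma rder_mvt_cst (F F' : R -> C) (K a b : R) : a <= b ->
  (forall s, a <= s <= b -> rder F s (F' s)) ->
  (forall s, a <= s <= b -> normc (F' s) <= K) ->
  normc (F b - F a) <= K * (b - a).
Proof.
move=> ab hF le; rewrite mulrBr.
apply: (@rder_mvt F F' (fun s => K * s) (fun=> K)) => // s _.
rewrite /rderR; have := derMc K%:C (@der_id _ (real_complex R) s).
by rewrite mulr1; congr der; apply/funext => y; rewrite rmorphM.
Qed.

Lemma rder_const (F : R -> C) (a b : R) : a <= b ->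
  (forall s, a <= s <= b -> rder F s 0) -> F b = F a.
Proof.
move=> ab h; apply/eqP; rewrite -subr_eq0 -normc_eq0 eq_le normc_ge0 andbT.
rewrite -[leRHS](mul0r (b - a)); apply: (@rder_mvt_cst _ (fun=> 0)) => // s _.
by rewrite normc0.
Qed.

Definition seg (z w : C) (s : R) : C := z + s%:C * (w - z).

Lemma seg0 z w : seg z w 0 = z. Proof. by rewrite /seg mul0r addr0. Qed.
Lemma seg1 z w : seg z w 1 = w.
Proof. by rewrite /seg mul1r addrC subrK. Qed.

Lemma rder_seg z w s : rder (seg z w) s (w - z).
Proof.
have := derD (der_cst (real_complex R) s z)
  (derMc (w - z) (@der_id _ (real_complex R) s)).
by rewrite add0r mulr1; congr der; apply/funext => y; rewrite /seg (mulrC y%:C).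
Qed.

Lemma cder_seg (f : C -> C) z w s l : cder f (seg z w s) l ->
  rder (fun s => f (seg z w s)) s (l * (w - z)).
Proof. exact: der_comp (rder_seg z w s). Qed.

Lemma cder_mvt (f f' : C -> C) z w (K : R) :
  (forall s, 0 <= s <= 1 -> cder f (seg z w s) (f' (seg z w s))) ->
  (forall s, 0 <= s <= 1 -> normc (f' (seg z w s)) <= K) ->
  normc (f w - f z) <= K * normc (w - z).
Proof.
move=> hf hK; rewrite -{1}(seg1 z w) -{2}(seg0 z w).
have := @rder_mvt_cst (fun s => f (seg z w s))
  (fun s => f' (seg z w s) * (w - z)) (K * normc (w - z)) 0 1 ler01.
rewrite subr0 mulr1; apply => s hs; first exact: cder_seg (hf s hs).
by rewrite normcM ler_wpM2r ?normc_ge0// hK.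
Qed.

(** The domain of the complex analysis below: it is convex, so that segments are the only paths
    needed. *)
Definition hp (a : R) (z : C) : Prop := a < complex.Re z.

Lemma hp_seg a z w s : hp a z -> hp a w -> 0 <= s <= 1 -> hp a (seg z w s).
Proof.
rewrite /hp /seg => hz hw /andP[s0 s1].
rewrite cReD cReM /= mul0r subr0 cReD cReN.
have h1 : 0 <= (1 - s) * (complex.Re z - a) by rewrite mulr_ge0//; lra.
have [->|sn] := eqVneq s 0; first by rewrite mul0r addr0.
have h2 : 0 < s * (complex.Re w - a) by rewrite mulr_gt0// ?subr_gt0// lt0r sn.
lra.
Qed.

Lemma hp_open a z : hp a z -> exists2 d : R, 0 < d &
  forall w, normc (w - z) < d -> hp a w.
Proof.
rewrite /hp => h; exists (complex.Re z - a); first by rewrite subr_gt0.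
move=> w wz; have := le_lt_trans (normc_Re _) wz.
rewrite cReD cReN ltr_norml => /andP[]; lra.
Qed.

Lemma ball_seg (z0 z w : C) (d s : R) : normc (z - z0) < d -> normc (w - z0) < d ->
  0 <= s <= 1 -> normc (seg z w s - z0) < d.
Proof.
move=> hz hw /andP[s0 s1].
have -> : seg z w s - z0 = (1 - s)%:C * (z - z0) + s%:C * (w - z0).
  by rewrite /seg rmorphB /=; ring.
apply: le_lt_trans (le_normcD _ _) _.
rewrite !normcM !normc_real !ger0_norm ?subr_ge0//.
have h1 : 0 <= (1 - s) * (d - normc (z - z0)) by rewrite mulr_ge0//; lra.
have [->|sn] := eqVneq s 0; first by lra.
have h2 : 0 < s * (d - normc (w - z0)) by rewrite mulr_gt0// ?subr_gt0// lt0r sn.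
lra.
Qed.

Lemma cder_const (f : C -> C) z w :
  (forall s, 0 <= s <= 1 -> cder f (seg z w s) 0) -> f w = f z.
Proof.
move=> h; apply/eqP; rewrite -subr_eq0 -normc_eq0 eq_le normc_ge0 andbT.
rewrite -[leRHS](mul0r (normc (w - z))).
by apply: (@cder_mvt _ (fun=> 0)) => // s _; rewrite normc0.
Qed.

End Derivative.

(** * Cauchy-Goursat theorem and primitives *)

Lemma normc_half (R : realType) (u v : R[i]) : u + u = v -> normc u = normc v / 2.
Proof. by move=> <-; rewrite -mulr2n normcMn mulr2n; lra. Qed.

Section Limits.
Variable R : realType.
Local Notation C := R[i].
Implicit Types u v : nat -> C.

Definition ccvg u (l : C) : Prop :=
  forall e : R, 0 < e -> exists N, forall n, (N <= n)%N -> normc (u n - l) <= e.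

Lemma real_cauchy (u : nat -> R) :
  (forall e : R, 0 < e -> exists N, forall m n, (N <= m)%N -> (N <= n)%N ->
    `|u m - u n| <= e) -> cvgn u.
Proof.
move=> h; apply: cauchy_cvg; apply: cauchy_exP => e e0.
have [N H] := h (e / 2) (divr_gt0 e0 (ltr0Sn _ _)).
exists (u N); exists N => // n /= Nn; rewrite /ball /=.
by apply: le_lt_trans (H _ _ (leqnn N) Nn) _; lra.
Qed.

Lemma ccauchy u :
  (forall e : R, 0 < e -> exists N, forall m n, (N <= m)%N -> (N <= n)%N ->
    normc (u m - u n) <= e) -> exists l, ccvg u l.
Proof.
move=> h.
have cR : cvgn (fun n => complex.Re (u n)).
  apply: real_cauchy => e /h[N H]; exists N => m n Nm Nn.
  by apply: le_trans (H m n Nm Nn); rewrite -cReN -cReD normc_Re.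
have cI : cvgn (fun n => complex.Im (u n)).
  apply: real_cauchy => e /h[N H]; exists N => m n Nm Nn.
  by apply: le_trans (H m n Nm Nn); rewrite -cImN -cImD normc_Im.
exists (limn (fun n => complex.Re (u n)) +i* limn (fun n => complex.Im (u n))).
move=> e e0; have e2 := divr_gt0 e0 (ltr0Sn R 1).
have /cvgrPdist_le/(_ _ e2)[N _ HN] := cR.
have /cvgrPdist_le/(_ _ e2)[M _ HM] := cI.
exists (maxn N M) => n; rewrite geq_max => /andP[/HN /= A /HM /= B].
apply: le_trans (normc_le_ReIm _) _.
rewrite cReD cReN cImD cImN /= distrC [`|complex.Im _ - _|]distrC.
by rewrite [e]splitr lerD.
Qed.

Lemma ccvg_unique u l m : ccvg u l -> ccvg u m -> l = m.
Proof.
move=> h h'; apply/eqP; rewrite -subr_eq0 -normc_eq0 eq_le normc_ge0 andbT.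
apply/ler_addgt0Pr => e e0; rewrite add0r.
have [N H] := h _ (divr_gt0 e0 (ltr0Sn R 1)).
have [M H'] := h' _ (divr_gt0 e0 (ltr0Sn R 1)).
apply: le_trans (normc_dist_triangle (u (maxn N M)) _ _) _.
rewrite [e]splitr lerD//; first by rewrite normc_distC H// leq_maxl.
by rewrite H'// leq_maxr.
Qed.

Lemma ccvg_le u l z (K : R) :
  ccvg u l -> (exists N, forall n, (N <= n)%N -> normc (u n - z) <= K) ->
  normc (l - z) <= K.
Proof.
move=> h [M HM]; apply/ler_addgt0Pr => e e0; have [N H] := h e e0.
apply: le_trans (normc_dist_triangle (u (maxn N M)) _ _) _.
by rewrite addrC lerD// ?HM ?leq_maxr// normc_distC H// leq_maxl.
Qed.

End Limits.

Section Goursat.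
Variable R : realType.
Local Notation C := R[i].

Lemma continuous_antiderivative (g : R -> R) : continuous g ->
  exists G : R -> R, forall s, 0 <= s <= 1 -> rderR G s (g s).
Proof.
(* The base point -1, with 2 on the other side, makes [[0, 1]] interior, so that the derivative is
   two-sided at both of its ends. *)
move=> cg; exists (fun x => (\int[lebesgue_measure]_(t in `[(-1)%R, x]) g t)%R).
move=> s /andP[s0 s1].
have [||||dG dE] := @continuous_FTC1_closed R g (-1) s 2.
- by lra.
- apply: continuous_compact_integrable; first exact: segment_compact.
  exact: continuous_subspaceT.
- by lra.
- exact: cg.
rewrite derive1E in dE; apply: is_derive_rder; exact: (DeriveDef dG dE).
Qed.

Lemma rder_scale (F : R -> C) (al be s : R) l : rder F (al * s + be) l ->
  rder (fun t => F (al * t + be)) s (l * al%:C).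
Proof.
apply: (der_chain (k := real_complex R) (g := fun t => al * t + be) (f := F)).
have := derD (derMc al%:C (@der_id R _ (real_complex R) s)) (der_cst (real_complex R) s be%:C).
by rewrite mulr1 addr0; congr der; apply/funext => y; rewrite !(rmorphD, rmorphM).
Qed.

Lemma eps_continuous (g : R -> R) :
  (forall s e, 0 < e -> exists2 d, 0 < d & forall y, `|y - s| < d -> `|g y - g s| <= e) ->
  continuous g.
Proof.
move=> h s; apply/cvgrPdist_le => e e0; have [d d0 H] := h s e e0.
apply/nbhs_ballP; exists d => // y; rewrite /ball /= distrC => /H.
by rewrite distrC.
Qed.

(** A 1-Lipschitz retraction onto an interval: it extends a function from a segment to the whole
    line, and in the gluing it selects the direction of a closed interval nearest to a given
    argument. *)
Definition clamp (x y s : R) : R := Num.max x (Num.min s y).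

Lemma clamp_itv x y s : x <= y -> x <= clamp x y s <= y.
Proof. by move=> xy; rewrite le_max lexx/= ge_max xy ge_min lexx orbT. Qed.

Lemma clamp_id x y s : x <= s <= y -> clamp x y s = s.
Proof.
by rewrite /clamp => /andP[xs sy]; rewrite min_l// max_r.
Qed.

Lemma clamp_lip x y s t : `|clamp x y s - clamp x y t| <= `|s - t|.
Proof.
apply: (@le_trans _ _ `|Num.min s y - Num.min t y|).
  set u := Num.min s y; set v := Num.min t y; rewrite /clamp -/u -/v.
  rewrite ler_norml; have := ler_norm (u - v); have := ler_norm (v - u).
  rewrite (distrC v); set w := `|_|.
  by case: (leP x u) => ?; case: (leP x v) => ? ? ?; apply/andP; split; lra.
rewrite ler_norml; have := ler_norm (s - t); have := ler_norm (t - s).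
rewrite (distrC t); set w := `|_|.
by case: (leP s y) => ?; case: (leP t y) => ? ? ?; apply/andP; split; lra.
Qed.

Definition seg_primitive (f : C -> C) z w : set (R -> C) :=
  [set F | forall s, 0 <= s <= 1 -> rder F s (f (seg z w s) * (w - z))].

Lemma seg_primitive_ex (f : C -> C) z w :
  (forall s, 0 <= s <= 1 -> exists l, cder f (seg z w s) l) ->
  exists F, seg_primitive f z w F.
Proof.
move=> hf; pose g s := f (seg z w (clamp 0 1 s)) * (w - z).
have cg s e : 0 < e ->
    exists2 d, 0 < d & forall y, `|y - s| < d -> normc (g y - g s) <= e.
  move=> e0; have [l /cder_seg hl] := hf _ (clamp_itv s ler01).
  have [d d0 H] := der_cont (derMc (w - z) hl) e0; exists d => // y ys.
  have := H (clamp 0 1 y); rewrite -rmorphB normc_real.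
  move=> /(_ (le_lt_trans (clamp_lip _ _ _ _) ys)).
  by rewrite /g ![_ * (w - z)]mulrC.
have [F1 h1] : exists G, forall s, 0 <= s <= 1 -> rderR G s (complex.Re (g s)).
  apply: continuous_antiderivative; apply: eps_continuous => s e e0.
  have [d d0 H] := cg s e e0; exists d => // y /H; apply: le_trans.
  by rewrite -cReN -cReD normc_Re.
have [F2 h2] : exists G, forall s, 0 <= s <= 1 -> rderR G s (complex.Im (g s)).
  apply: continuous_antiderivative; apply: eps_continuous => s e e0.
  have [d d0 H] := cg s e e0; exists d => // y /H; apply: le_trans.
  by rewrite -cImN -cImD normc_Im.
exists (fun s => (F1 s)%:C + 'i%C * (F2 s)%:C) => s s01.
have := derD (h1 s s01) (derMc 'i%C (h2 s s01)).
by rewrite -complexE /g clamp_id.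
Qed.

(** The integral of [f] over a segment, as the increment of a chosen primitive along it; two
    primitives differ by a constant, so the choice is immaterial. The value is 0 when there is no
    primitive. *)
Definition pint (f : C -> C) z w : C :=
  let F := xget (fun=> 0) (seg_primitive f z w) in F 1 - F 0.

Lemma pintE f z w F : seg_primitive f z w F -> pint f z w = F 1 - F 0.
Proof.
move=> hF; rewrite /pint; case: xgetP => [G _ hG|/(_ F)//].
have := @rder_const R (fun s => G s - F s) 0 1 ler01.
have H s : 0 <= s <= 1 -> rder (fun s => G s - F s) s 0.
  by move=> s01; have := derB (hG s s01) (hF s s01); rewrite subrr.
by move=> /(_ H) E; rewrite -[G 1](subrK (F 1)) E; ring.
Qed.

Variables (a : R) (f : C -> C).
Hypothesis hf : forall z, hp a z -> exists l, cder f z l.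

Lemma hp_primitive_ex z w : hp a z -> hp a w -> exists F, seg_primitive f z w F.
Proof.
by move=> hz hw; apply: seg_primitive_ex => s s01; apply: hf; exact: hp_seg.
Qed.

Lemma pint_rev z w : hp a z -> hp a w -> pint f w z = - pint f z w.
Proof.
move=> hz hw; have [F hF] := hp_primitive_ex hz hw.
rewrite (pintE hF) (@pintE _ _ _ (fun s => F (-1 * s + 1))).
  by rewrite mulr1 mulr0 add0r addNr opprB.
move=> s /andP[s0 s1]; have /hF : 0 <= -1 * s + 1 <= 1 by lra.
move=> /rder_scale; congr rder.
have -> : seg z w (-1 * s + 1) = seg w z s by rewrite /seg rmorphD rmorphM rmorphN1 rmorph1 /=; ring.
by rewrite rmorphN1; ring.
Qed.

Definition mid (z w : C) : C := (z + w) / 2.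

Lemma mid_seg z w : mid z w = seg z w 2^-1.
Proof.
by rewrite /mid /seg fmorphV rmorph_nat; field.
Qed.

Lemma hp_mid z w : hp a z -> hp a w -> hp a (mid z w).
Proof. by move=> hz hw; rewrite mid_seg; apply: hp_seg => //; lra. Qed.

Lemma pint_mid z w : hp a z -> hp a w ->
  pint f z w = pint f z (mid z w) + pint f (mid z w) w.
Proof.
move=> hz hw; have [F hF] := hp_primitive_ex hz hw.
have h2C : (2^-1)%:C = 2^-1 :> C by rewrite fmorphV rmorph_nat.
rewrite (pintE hF) (@pintE _ z _ (fun s => F (2^-1 * s + 0))); last first.
  move=> s /andP[s0 s1]; have /hF : 0 <= 2^-1 * s + 0 <= 1 by lra.
  move=> /rder_scale; congr rder; rewrite -mulrA; congr (f _ * _).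
    by rewrite /seg /mid rmorphD rmorphM rmorph0 /= h2C; field.
  by rewrite h2C /mid; field.
rewrite (@pintE _ _ w (fun s => F (2^-1 * s + 2^-1))); last first.
  move=> s /andP[s0 s1]; have /hF : 0 <= 2^-1 * s + 2^-1 <= 1 by lra.
  move=> /rder_scale; congr rder; rewrite -mulrA; congr (f _ * _).
    by rewrite /seg /mid rmorphD rmorphM /= h2C; field.
  by rewrite h2C /mid; field.
rewrite !mulr1 !mulr0 !addr0 add0r.
by rewrite (_ : 2^-1 + 2^-1 = 1 :> R); [ring|field].
Qed.

(** The subtracted expression is the increment of a primitive [G] of the affine function, so the
    claim is the mean value inequality for [F - G]. A derivative as slope serves Goursat's theorem;
    slope 0 serves the existence of primitives. *)
Lemma pint_approx z w p al be (e : R) : hp a z -> hp a w ->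
  (forall s, 0 <= s <= 1 ->
    normc (f (seg z w s) - (al + be * (seg z w s - p))) <= e) ->
  normc (pint f z w - (al * (w - z) + be / 2 * ((w - p) ^+ 2 - (z - p) ^+ 2)))
    <= e * normc (w - z).
Proof.
move=> hz hw H; have [F hF] := hp_primitive_ex hz hw; rewrite (pintE hF).
pose G x := al * x + be / 2 * ((x - p) * (x - p)).
have dG x : cder G x (al + be * (x - p)).
  have h := derB (@der_id R _ id x) (der_cst id x p).
  have := derD (derMc al (@der_id R _ id x)) (derMc (be / 2) (derM h h)).
  by congr der; field.
have := @rder_mvt_cst _ (fun s => F s - G (seg z w s))
  (fun s => (f (seg z w s) - (al + be * (seg z w s - p))) * (w - z))
  (e * normc (w - z)) 0 1 ler01.
rewrite seg0 seg1 subr0 mulr1 => h.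
have -> : F 1 - F 0 - (al * (w - z) + be / 2 * ((w - p) ^+ 2 - (z - p) ^+ 2)) =
  F 1 - G w - (F 0 - G z) by rewrite /G; ring.
apply: h => s s01.
  rewrite mulrBl; apply: derB; first exact: hF.
  by have := cder_seg (dG (seg z w s)).
by rewrite normcM ler_wpM2r ?normc_ge0// H.
Qed.

Definition tri (t : C * C * C) : C :=
  pint f t.1.1 t.1.2 + pint f t.1.2 t.2 + pint f t.2 t.1.1.

Definition perim (t : C * C * C) : R :=
  normc (t.1.1 - t.1.2) + normc (t.1.2 - t.2) + normc (t.2 - t.1.1).

(** A closed condition, used with [a < b]: it passes to the limit of the nested triangles and keeps
    that limit in the open half-plane. *)
Definition above (b : R) (t : C * C * C) : Prop :=
  [/\ b <= complex.Re t.1.1, b <= complex.Re t.1.2 & b <= complex.Re t.2].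

Lemma Re_mid z w : complex.Re (mid z w) = (complex.Re z + complex.Re w) / 2.
Proof. by rewrite mid_seg /seg cReD cReM /= cReD cReN; field. Qed.

Lemma perim_half (x y z x' y' z' : C) :
  x - y + (x - y) = x' - y' -> y - z + (y - z) = y' - z' ->
  z - x + (z - x) = z' - x' -> perim (x, y, z) = perim (x', y', z') / 2.
Proof. by rewrite /perim => /normc_half /= -> /normc_half -> /normc_half ->; field. Qed.

(** The midpoints cut the triangle into four, the inner sides cancel, and one of the four integrals
    is at least a quarter of the whole in modulus. The bound on the displacement of the first vertex
    makes these vertices a Cauchy sequence. *)
Lemma tri_subdivide (b : R) t : a < b -> above b t ->
  exists t', [/\ above b t', perim t' = perim t / 2,
    normc (tri t) <= 4 * normc (tri t') & normc (t'.1.1 - t.1.1) <= perim t].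
Proof.
case: t => -[x y] z ab [/= bx byy bz].
have [hx hy hz] : [/\ hp a x, hp a y & hp a z] by split; exact: lt_le_trans ab _.
have := hp_mid hx hy; have := hp_mid hy hz; have := hp_mid hz hx.
set m3 := mid z x; set m2 := mid y z; set m1 := mid x y => h3 h2 h1.
have E : tri (x, y, z) = tri (x, m1, m3) + tri (m1, y, m2) + tri (m3, m2, z)
    + tri (m2, m3, m1).
  rewrite /tri /= (pint_mid hx hy) (pint_mid hy hz) (pint_mid hz hx) -/m1 -/m2 -/m3.
  by rewrite (pint_rev h1 h3) (pint_rev h2 h1) (pint_rev h2 h3); ring.
have p0 : 0 <= perim (x, y, z) by rewrite !addr_ge0 ?normc_ge0.
have [n12 n31] : normc (x - y) <= perim (x, y, z) /\ normc (z - x) <= perim (x, y, z).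
  by rewrite /perim /=; have := (normc_ge0 (x - y), normc_ge0 (y - z), normc_ge0 (z - x)) => -[[]]; lra.
have n1 : normc (m1 - x) <= perim (x, y, z).
  have /normc_half -> : m1 - x + (m1 - x) = - (x - y) by rewrite /m1 /mid; field.
  by rewrite normcN; have := normc_ge0 (x - y); lra.
have n3 : normc (m3 - x) <= perim (x, y, z).
  have /normc_half -> : m3 - x + (m3 - x) = z - x by rewrite /m3 /mid; field.
  by have := normc_ge0 (z - x); lra.
have n2 : normc (m2 - x) <= perim (x, y, z).
  have /normc_half -> : m2 - x + (m2 - x) = (z - x) - (x - y) by rewrite /m2 /mid; field.
  have := le_normcB (z - x) (x - y); lra.
have [r1 r2 r3] : [/\ b <= complex.Re m1, b <= complex.Re m2 & b <= complex.Re m3].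
  by split; rewrite Re_mid; lra.
pose big t' := normc (tri (x, y, z)) <= 4 * normc (tri t').
have : [\/ big (x, m1, m3), big (m1, y, m2), big (m3, m2, z) | big (m2, m3, m1)].
  have := le_normcD (tri (x, m1, m3) + tri (m1, y, m2) + tri (m3, m2, z)) (tri (m2, m3, m1)).
  have := le_normcD (tri (x, m1, m3) + tri (m1, y, m2)) (tri (m3, m2, z)).
  have := le_normcD (tri (x, m1, m3)) (tri (m1, y, m2)).
  rewrite -E /big => A B D.
  have [?|?] := lerP (normc (tri (x, y, z))) (4 * normc (tri (x, m1, m3))); first by constructor.
  have [?|?] := lerP (normc (tri (x, y, z))) (4 * normc (tri (m1, y, m2))); first by constructor.
  have [?|?] := lerP (normc (tri (x, y, z))) (4 * normc (tri (m3, m2, z))); first by constructor.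
  by constructor 4; lra.
case=> H; [exists (x, m1, m3)|exists (m1, y, m2)|exists (m3, m2, z)|exists (m2, m3, m1)];
  split => //; try (by apply: perim_half; rewrite /m1 /m2 /m3 /mid; field).
- by rewrite subrr normc0.
- rewrite /perim /=.
  have /normc_half -> : m2 - m3 + (m2 - m3) = - (x - y) by rewrite /m2 /m3 /mid; field.
  have /normc_half -> : m3 - m1 + (m3 - m1) = - (y - z) by rewrite /m1 /m3 /mid; field.
  have /normc_half -> : m1 - m2 + (m1 - m2) = - (z - x) by rewrite /m1 /m2 /mid; field.
  by rewrite !normcN; field.
Qed.

Theorem goursat z w v : hp a z -> hp a w -> hp a v ->
  pint f z w + pint f w v + pint f v z = 0.
Proof.
move=> hz hw hv.
pose b := Num.min (complex.Re z) (Num.min (complex.Re w) (complex.Re v)).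
have ab : a < b by rewrite !lt_min hz hw.
pose t0 := (z, w, v).
have gt0 : above b t0 by split; rewrite /b !ge_min lexx ?orbT.
have /choice[st hst] : forall t, exists t', above b t ->
    [/\ above b t', perim t' = perim t / 2,
    normc (tri t) <= 4 * normc (tri t') & normc (t'.1.1 - t.1.1) <= perim t].
  move=> t; have [ht|ht] := pselect (above b t); last by exists t.
  by have [t' H] := tri_subdivide ab ht; exists t'.
pose T n := iter n st t0; pose d := perim t0.
have d0 : 0 <= d by rewrite !addr_ge0 ?normc_ge0.
have aT n : above b (T n) by elim: n => //= n /hst[].
have pT n : perim (T n) = d * 2^-1 ^+ n.
  elim: n => [|n IH]; first by rewrite mulr1.
  by have [_ -> _ _] := hst _ (aT n); rewrite IH exprSr mulrA.
have tT n : normc (tri t0) <= 4 ^+ n * normc (tri (T n)).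
  elim: n => [|n IH]; first by rewrite mul1r.
  have [_ _ h _] := hst _ (aT n); apply: le_trans IH _.
  by rewrite exprSr -mulrA ler_wpM2l// exprn_ge0.
have h0 n : 0 <= 2^-1 ^+ n :> R by rewrite exprn_ge0// invr_ge0.
have cT m n : normc ((T (m + n)%N).1.1 - (T m).1.1) <= 2 * d * 2^-1 ^+ m.
  (* The factor [1 - 2^-1 ^+ n] is the exact geometric sum: the induction needs it, the conclusion
     drops it. *)
  suff H : normc ((T (m + n)%N).1.1 - (T m).1.1) <= 2 * d * 2^-1 ^+ m * (1 - 2^-1 ^+ n).
    by rewrite (le_trans H)// ler_piMr ?mulr_ge0// lerBlDr lerDl.
  elim: n => [|n IH]; first by rewrite addn0 subrr normc0 expr0 subrr mulr0.
  apply: le_trans (normc_dist_triangle (T (m + n)%N).1.1 _ _) _.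
  have [_ _ _] := hst _ (aT (m + n)%N); rewrite addnS pT exprD => h.
  apply: le_trans (lerD h IH) _; rewrite exprS le_eqVlt; apply/orP; left; apply/eqP.
  by field.
have small e : 0 < e -> exists N, forall n, (N <= n)%N -> d * 2^-1 ^+ n <= e.
  move=> e0; have d1 : 0 < d + 1 by rewrite ltr_wpDl.
  have : (fun n => 2^-1 ^+ n : R) @ \oo --> (0 : R) by apply: cvg_expr; rewrite ger0_norm ?invr_ge0//; lra.
  move=> /cvgrPdist_le /(_ (e / (d + 1)) (divr_gt0 e0 d1))[N _ H]; exists N => n /H.
  rewrite /= sub0r normrN ger0_norm// ler_pdivlMr// => h; rewrite (le_trans _ h)//.
  by rewrite mulrC ler_wpM2l// lerDl.
have [p hp_] : exists p, ccvg (fun n => (T n).1.1) p.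
  apply: ccauchy => e e0; have e4 : 0 < e / 4 by lra.
  have [N H] := small _ e4; exists N => m n Nm Nn.
  apply: le_trans (normc_dist_triangle (T N).1.1 _ _) _.
  have := cT N (m - N)%N; have := cT N (n - N)%N; rewrite !subnKC//.
  rewrite (normc_distC (T N).1.1); have := H _ (leqnn N); lra.
have pn n : normc (p - (T n).1.1) <= 2 * d * 2^-1 ^+ n.
  by apply: ccvg_le hp_ _; exists n => m nm; rewrite -(subnKC nm).
have hpp : hp a p.
  apply: lt_le_trans ab _; apply/ler_addgt0Pr => e e0; have [N H] := hp_ e e0.
  have [h _ _] := aT N; apply: le_trans h _.
  have := le_trans (normc_Re _) (H N (leqnn N)); rewrite cReD cReN ler_norml.
  by move=> /andP[_]; lra.
have [l hl] := hf hpp.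
apply/eqP; rewrite -normc_eq0 eq_le normc_ge0 andbT.
have -> : pint f z w + pint f w v + pint f v z = tri t0 by [].
apply/ler_addgt0Pr => e e0; rewrite add0r.
(* The sides of the [n]-th triangle lie within [3 (d / 2^n)] of [p], so its integral is at most this
   constant times [3 (d / 2^n)^2]; multiplied by [4^n], this is [e d^2 / (d + 1)^2 <= e]. The
   [d + 1] avoids a division by zero when the triangle is a point. *)
have e1 : 0 < e / (3 * (d + 1) ^+ 2) by rewrite divr_gt0// mulr_gt0// exprn_gt0// ltr_wpDl.
have [de de0 H] := hl _ e1.
have de3 : 0 < de / 4 by lra.
have [n /(_ n (leqnn n)) dn] := small _ de3.
have pTn := pT n; have pnn := pn n; have tTn := tT n; have [A B D] := aT n.
case: (T n) pTn pnn tTn A B D => -[x y] u /= pE px tn bx by_ bu.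
have [hx hy hu] : [/\ hp a x, hp a y & hp a u] by split; exact: lt_le_trans ab _.
pose e' := e / (3 * (d + 1) ^+ 2) * (3 * (d * 2^-1 ^+ n)).
have key v1 v2 : hp a v1 -> hp a v2 -> normc (v1 - x) <= perim (x, y, u) ->
   normc (v2 - x) <= perim (x, y, u) ->
   normc (pint f v1 v2 - (f p * (v2 - v1) + l / 2 * ((v2 - p) ^+ 2 - (v1 - p) ^+ 2)))
     <= e' * normc (v2 - v1).
  move=> hv1 hv2 n1 n2; apply: pint_approx => // s s01.
  have hs : normc (seg v1 v2 s - p) <= 3 * (d * 2^-1 ^+ n).
    apply/ler_addgt0Pr => r r0; apply: ltW.
    have E q : normc (q - x) <= perim (x, y, u) -> normc (q - p) < 3 * (d * 2^-1 ^+ n) + r.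
      move=> hq; apply: le_lt_trans (normc_dist_triangle x _ _) _.
      by rewrite (normc_distC x); move: hq; rewrite pE; lra.
    by apply: ball_seg => //; exact: E.
  have := H (seg v1 v2 s); rewrite /= opprD addrA.
  move=> /(_ _)/le_trans; apply; first by apply: le_lt_trans hs _; lra.
  by rewrite /e' ler_wpM2l// ltW.
have [P1 P2] : normc (y - x) <= perim (x, y, u) /\ normc (u - x) <= perim (x, y, u).
  rewrite (normc_distC y) /perim /=.
  by have := (normc_ge0 (x - y), normc_ge0 (y - u), normc_ge0 (u - x)) => -[[]]; lra.
have P0 : normc (x - x) <= perim (x, y, u).
  by rewrite subrr normc0 (le_trans _ P1)// normc_ge0.
have K1 := key x y hx hy P0 P1; have K2 := key y u hy hu P1 P2; have K3 := key u x hu hx P2 P0.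
have ht : normc (tri (x, y, u)) <= e' * perim (x, y, u).
  have -> : tri (x, y, u) =
    (pint f x y - (f p * (y - x) + l / 2 * ((y - p) ^+ 2 - (x - p) ^+ 2))) +
    (pint f y u - (f p * (u - y) + l / 2 * ((u - p) ^+ 2 - (y - p) ^+ 2))) +
    (pint f u x - (f p * (x - u) + l / 2 * ((x - p) ^+ 2 - (u - p) ^+ 2))).
    by rewrite /tri /=; ring.
  apply: le_trans (le_normcD _ _) _; apply: le_trans (lerD (le_normcD _ _) (lexx _)) _.
  apply: le_trans (lerD (lerD K1 K2) K3) _.
  by rewrite /perim /= -!mulrDr (normc_distC y) (normc_distC u y) (normc_distC x u).
apply: le_trans tn _.
apply: le_trans (ler_wpM2l _ ht) _; first by rewrite exprn_ge0.
rewrite pE /e'.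
have -> : 4 ^+ n * (e / (3 * (d + 1) ^+ 2) * (3 * (d * 2^-1 ^+ n)) * (d * 2^-1 ^+ n)) =
  e * (d ^+ 2 / (d + 1) ^+ 2) * (4 ^+ n * (2^-1 ^+ n * 2^-1 ^+ n)).
  by field; rewrite gt_eqF// ltr_wpDl.
have -> : 4 ^+ n * (2^-1 ^+ n * 2^-1 ^+ n) = 1 :> R.
  by rewrite -!exprMn (_ : 4 * _ = 1) ?expr1n//; field.
rewrite mulr1 ler_piMr ?(ltW e0)// ler_pdivrMr ?exprn_gt0 ?ltr_wpDl// mul1r.
have : 0 <= d * d by rewrite mulr_ge0.
by rewrite !expr2; lra.
Qed.

(** By Goursat's theorem the increment of [pint f z1] between [z] and [w] is [pint f z w], which is
    compared with the constant [f z] on a small segment. *)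
Theorem primitive z1 : hp a z1 ->
  exists P : C -> C, P z1 = 0 /\ forall z, hp a z -> cder P z (f z).
Proof.
move=> h1; exists (fun z => pint f z1 z - pint f z1 z1); split; first by rewrite subrr.
move=> z hz e e0; have [l hl] := hf hz.
have [d d0 H] := der_cont hl e0; have [d' d'0 H'] := hp_open hz.
exists (Num.min d d'); first by rewrite lt_min d0.
move=> w; rewrite lt_min => /andP[wd /H' hw].
have -> : pint f z1 w - pint f z1 z1 - (pint f z1 z - pint f z1 z1) - f z * (w - z) =
   pint f z w - (f z * (w - z) + 0 / 2 * ((w - 0) ^+ 2 - (z - 0) ^+ 2)).
  have := goursat h1 hz hw; rewrite (pint_rev h1 hw) => /eqP.
  by rewrite subr_eq0 => /eqP <-; ring.
apply: pint_approx => // s s01; rewrite mul0r addr0; apply: H => /=.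
apply: ball_seg => //; by rewrite subrr normc0.
Qed.

End Goursat.

(** * Exponential and series *)

Section Exponential.
Variable R : realType.
Local Notation C := R[i].

Lemma normc_polar (r t : R) : normc (polar r t) = `|r|.
Proof.
rewrite /polar /normc !exprMn -mulrDr cos2Dsin2 mulr1.
exact: sqrtr_sqr.
Qed.

Lemma polarM (r s t u : R) : polar r t * polar s u = polar (r * s) (t + u).
Proof.
by rewrite /polar cosD sinD; apply/eqP; rewrite eq_complex /=; apply/andP; split;
  apply/eqP; ring.
Qed.

Lemma normc_expc (w : C) : normc (expc w) = expR (complex.Re w).
Proof. by rewrite normc_polar ger0_norm// expR_ge0. Qed.

Lemma expcD (w z : C) : expc (w + z) = expc w * expc z.
Proof. by rewrite /expc polarM cReD cImD expRD. Qed.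

Lemma expc0 : expc (0 : C) = 1.
Proof. by rewrite /expc /polar /= expR0 cos0 sin0 mul1r mulr0. Qed.

Lemma expcNK (w : C) : expc w * expc (- w) = 1.
Proof. by rewrite -expcD subrr expc0. Qed.

Lemma rder_lip (f : R -> R) s l : rderR f s l -> forall e : R, 0 < e ->
  exists2 d : R, 0 < d & forall x, `|x| < d -> `|f (s + x) - f s - l * x| <= e * `|x|.
Proof.
move=> h e e0; have [d d0 H] := h e e0; exists d => // x.
have := H (s + x); rewrite -!rmorphB addrC addKr -rmorphM -rmorphB !normc_real.
by rewrite addrC.
Qed.

(** Multiplicativity reduces the claim to the point 0, where the expansions of [expR], [cos] and
    [sin] are combined. *)
Lemma cder_expc (w : C) : cder (@expc R) w (expc w).
Proof.
suff H : forall e : R, 0 < e -> exists2 d : R, 0 < d &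
    forall h : C, normc h < d -> normc (expc h - 1 - h) <= e * normc h.
  move=> e e0.
  have [d d0 {}H] := H _ (divr_gt0 e0 (expR_gt0 (complex.Re w))).
  exists d => // y /H {}H; rewrite (_ : _ - _ = expc w * (expc (y - w) - 1 - (y - w))).
    rewrite normcM normc_expc (le_trans (ler_wpM2l (expR_ge0 _) H))//.
    by rewrite mulrA mulrCA divff ?mulr1// gt_eqF// expR_gt0.
  have -> : expc y = expc w * expc (y - w) by rewrite -expcD addrC subrK.
  by rewrite /=; ring.
have dE : rderR (@expR R) 0 1.
  by apply: is_derive_rder; have := is_derive_expR (0 : R); rewrite expR0.
have dC : rderR (@cos R) 0 0.
  by apply: is_derive_rder; have := is_derive_cos (0 : R); rewrite sin0 oppr0.
have dS : rderR (@sin R) 0 1.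
  by apply: is_derive_rder; have := is_derive_sin (0 : R); rewrite cos0.
(* Relative to [normc h], the real part contributes an error of at most [4 e'] and the imaginary
   part at most [5 e']: in all at most [9 e / 12]. *)
move=> e e0; have [e' [e'0 e'1 e'e]] : exists e' : R, [/\ 0 < e', e' <= 1 & e' <= e / 12].
  exists (Num.min 1 (e / 12)); rewrite lt_min ltr01 divr_gt0// !ge_min !lexx orbT.
  by split.
have [d1 d10 H1] := rder_lip dE e'0.
have [d2 d20 H2] := rder_lip dC e'0.
have [d3 d30 H3] := rder_lip dS e'0.
exists (Num.min e' (Num.min d1 (Num.min d2 d3))); first by rewrite !lt_min e'0 d10 d20.
move=> h; rewrite !lt_min => /and4P[he h1 h2 h3].
have hx := normc_Re h; have hy := normc_Im h; have hp := normc_ge0 h.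
case: h he h1 h2 h3 hx hy hp => x y; set m := normc _ => he h1 h2 h3 hx hy hp.
rewrite /= in hx hy.
have := H1 x (le_lt_trans hx h1); have := H2 y (le_lt_trans hy h2).
have := H3 y (le_lt_trans hy h3).
rewrite !add0r expR0 cos0 sin0 !mul1r mul0r !subr0 => S3 S2 S1.
have ex : expR x <= 3.
  have := le_trans (ler_norm _) S1; have := ler_norm x; have := normr_ge0 x.
  have : e' * `|x| <= `|x| by rewrite ler_piMl.
  lra.
apply: le_trans (normc_le_ReIm _) _.
rewrite !cReD !cImD !cReN !cImN /=.
have A1 : `|expR x * cos y - 1 - x| <= e / 3 * m.
  have -> : expR x * cos y - 1 - x = (expR x - 1 - x) + expR x * (cos y - 1) by ring.
  apply: le_trans (ler_normD _ _) _; rewrite normrM (ger0_norm (expR_ge0 _)).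
  have B : expR x * `|cos y - 1| <= 3 * (e' * m).
    by rewrite ler_pM ?expR_ge0// (le_trans S2)// ler_pM2l.
  have B' : `|expR x - 1 - x| <= e' * m by rewrite (le_trans S1)// ler_pM2l.
  have : e' * m <= e / 12 * m by rewrite ler_wpM2r.
  lra.
have A2 : `|expR x * sin y - 0 - y| <= 5 * e / 12 * m.
  have -> : expR x * sin y - 0 - y = (sin y - y) + (expR x - 1) * sin y by ring.
  apply: le_trans (ler_normD _ _) _; rewrite normrM.
  have B1 : `|expR x - 1| <= 2 * m.
    have := ler_normD (expR x - 1 - x) x; rewrite subrK => /le_trans; apply.
    have : e' * `|x| <= `|x| by rewrite ler_piMl.
    lra.
  have B2 : `|sin y| <= 2 * m.
    have := ler_normD (sin y - y) y; rewrite subrK => /le_trans; apply.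
    have : e' * `|y| <= `|y| by rewrite ler_piMl.
    lra.
  have B3 : `|expR x - 1| * `|sin y| <= (2 * m) * (2 * e').
    by rewrite ler_pM// (le_trans B2)// ler_pM2l// ltW.
  have B' : `|sin y - y| <= e' * m by rewrite (le_trans S3)// ler_pM2l.
  have : e' * m <= e / 12 * m by rewrite ler_wpM2r.
  lra.
have em : 0 <= e * m by rewrite mulr_ge0// ltW.
move: A1 A2; rewrite oppr0 !addr0 => A1 A2; lra.
Qed.

End Exponential.

(** * Term-by-term differentiation of series *)

Section Series.
Variable R : realType.
Local Notation C := R[i].

Definition psum (x : nat -> C) n : C := \sum_(m < n) x m.

Lemma psumS (x : nat -> C) n : psum x n.+1 = psum x n + x n.
Proof. exact: big_ord_recr. Qed.

Lemma psum_tail (x : nat -> C) (K : R) n k :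
  (forall m, normc (x m) <= K * 2^-1 ^+ m) ->
  normc (psum x (n + k) - psum x n) <= 2 * K * 2^-1 ^+ n.
Proof.
move=> h.
have K0 : 0 <= K by have := h 0; rewrite expr0 mulr1; exact/le_trans/normc_ge0.
have h0 m : 0 <= 2^-1 ^+ m :> R by rewrite exprn_ge0// invr_ge0.
suff : normc (psum x (n + k) - psum x n) <= 2 * K * 2^-1 ^+ n * (1 - 2^-1 ^+ k).
  by move=> H; rewrite (le_trans H)// ler_piMr ?mulr_ge0// lerBlDr lerDl.
elim: k => [|k IH]; first by rewrite addn0 subrr normc0 expr0 subrr mulr0.
rewrite addnS psumS addrAC.
apply: le_trans (le_normcD _ _) _; apply: le_trans (lerD IH (h _)) _.
by rewrite exprD exprS le_eqVlt; apply/orP; left; apply/eqP; field.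
Qed.

Lemma small_geometric (K e : R) : 0 < e -> exists N, forall n, (N <= n)%N ->
  K * 2^-1 ^+ n <= e.
Proof.
move=> e0; have K1 : 0 < `|K| + 1 by rewrite ltr_wpDl.
have h0 n : 0 <= 2^-1 ^+ n :> R by rewrite exprn_ge0// invr_ge0.
have : (fun n => 2^-1 ^+ n : R) @ \oo --> (0 : R).
  by apply: cvg_expr; rewrite ger0_norm ?invr_ge0//; lra.
move=> /cvgrPdist_le /(_ (e / (`|K| + 1)) (divr_gt0 e0 K1))[N _ H]; exists N => n /H.
rewrite /= sub0r normrN ger0_norm// ler_pdivlMr// => h; rewrite (le_trans _ h)//.
by rewrite mulrC ler_wpM2l// (le_trans (ler_norm _))// lerDl.
Qed.

Lemma psum_cvg (x : nat -> C) (K : R) :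
  (forall m, normc (x m) <= K * 2^-1 ^+ m) -> exists l, ccvg (psum x) l.
Proof.
move=> h; apply: ccauchy => e e0; have [N H] := small_geometric (4 * K) e0.
exists N => m n Nm Nn.
apply: le_trans (normc_dist_triangle (psum x N) _ _) _; rewrite (normc_distC (psum x N)).
have := psum_tail N (m - N) h; have := psum_tail N (n - N) h; rewrite !subnKC//.
have := H N (leqnn N); lra.
Qed.

Lemma psum_limit (x : nat -> C) (K : R) l n :
  (forall m, normc (x m) <= K * 2^-1 ^+ m) -> ccvg (psum x) l ->
  normc (l - psum x n) <= 2 * K * 2^-1 ^+ n.
Proof.
move=> h hl; apply: ccvg_le hl _; exists n => m nm.
by rewrite -(subnKC nm); exact: psum_tail.
Qed.

(** Through the mean value inequality, the increment of a tail of the series is bounded by a tail of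
    the derived series times the increment of the argument. Hence one partial sum, of a fixed index
    [n], carries the differentiability, with three errors of relative size [e / 3]. *)
Lemma series_cder (U : set C) (u u' : nat -> C -> C) :
  (forall z, U z -> exists d K : R, 0 < d /\ forall w, normc (w - z) < d ->
     forall m, [/\ cder (u m) w (u' m w), normc (u m w) <= K * 2^-1 ^+ m
                 & normc (u' m w) <= K * 2^-1 ^+ m]) ->
  exists f f', forall z, U z -> [/\ ccvg (psum (u ^~ z)) (f z),
     ccvg (psum (u' ^~ z)) (f' z) & cder f z (f' z)].
Proof.
move=> h.
pose f z := xget 0 [set l | ccvg (psum (u ^~ z)) l].
pose f' z := xget 0 [set l | ccvg (psum (u' ^~ z)) l].
have fP z : (exists l, ccvg (psum (u ^~ z)) l) -> ccvg (psum (u ^~ z)) (f z).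
  by move=> [l hl]; rewrite /f; case: xgetP => [y _//|/(_ l)].
have f'P z : (exists l, ccvg (psum (u' ^~ z)) l) -> ccvg (psum (u' ^~ z)) (f' z).
  by move=> [l hl]; rewrite /f'; case: xgetP => [y _//|/(_ l)].
exists f, f' => z /h[d [K [d0 H]]].
have zz : normc (z - z) < d by rewrite subrr normc0.
have cf w : normc (w - z) < d -> ccvg (psum (u ^~ w)) (f w).
  by move=> /H hw; apply: fP; apply: (@psum_cvg _ K) => m; case: (hw m).
have cf' : ccvg (psum (u' ^~ z)) (f' z).
  by apply: f'P; apply: (@psum_cvg _ K) => m; case: (H z zz m).
split=> //; first exact: cf.
move=> e e0; have e3 : 0 < e / 3 by lra.
have [n /(_ n (leqnn n)) hn] := small_geometric (2 * K) e3.
have dS w : normc (w - z) < d -> forall m, cder (fun y => psum (u ^~ y) m) w (psum (u' ^~ w) m).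
  by move=> /H hw m; apply: der_sum => i; case: (hw i).
have [d' d'0 H'] := dS z zz n _ e3.
exists (Num.min d d'); first by rewrite lt_min d0.
move=> w; rewrite lt_min => /andP[wd /H' /= A].
have B : normc ((f w - psum (u ^~ w) n) - (f z - psum (u ^~ z) n)) <= e / 3 * normc (w - z).
  have -> : f w - psum (u^~ w) n - (f z - psum (u^~ z) n) =
    (f w - f z) - (psum (u^~ w) n - psum (u^~ z) n) by ring.
  apply: (@ccvg_le _ (fun m => psum (u ^~ w) m - psum (u ^~ z) m)).
    move=> r r0; have [N1 h1] := cf w wd _ (divr_gt0 r0 (ltr0Sn R 1)).
    have [N2 h2] := cf z zz _ (divr_gt0 r0 (ltr0Sn R 1)).
    exists (maxn N1 N2) => m; rewrite geq_max => /andP[/h1{}h1 /h2{}h2].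
    rewrite (_ : _ - _ = (psum (u^~ w) m - f w) - (psum (u^~ z) m - f z)); last by ring.
    by rewrite (le_trans (le_normcB _ _))// [r]splitr lerD.
  exists n => m nm.
  have -> : psum (u^~ w) m - psum (u^~ z) m - (psum (u^~ w) n - psum (u^~ z) n) =
    (psum (u ^~ w) m - psum (u ^~ w) n) - (psum (u ^~ z) m - psum (u ^~ z) n) by ring.
  have bs s : 0 <= s <= 1 -> normc (seg z w s - z) < d by exact: ball_seg.
  apply: (@cder_mvt _ (fun y => psum (u ^~ y) m - psum (u ^~ y) n)
    (fun y => psum (u' ^~ y) m - psum (u' ^~ y) n)).
    by move=> s /bs hs; apply: derB; exact: dS.
  move=> s /bs hs; apply: le_trans hn; rewrite -(subnKC nm); apply: psum_tail => i.
  by case: (H _ hs i).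
have D : normc (psum (u' ^~ z) n - f' z) <= e / 3.
  rewrite normc_distC (le_trans _ hn)//; apply: psum_limit cf' => i.
  by case: (H z zz i).
have -> : f w - f z - f' z * (w - z) =
  (psum (u ^~ w) n - psum (u ^~ z) n - psum (u' ^~ z) n * (w - z)) +
  ((f w - psum (u ^~ w) n) - (f z - psum (u ^~ z) n)) +
  (psum (u' ^~ z) n - f' z) * (w - z) by ring.
apply: le_trans (le_normcD _ _) _; rewrite normcM.
apply: le_trans (lerD (le_normcD _ _) (ler_wpM2r (normc_ge0 _) D)) _.
move: A B; set W := normc (w - z); lra.
Qed.

End Series.

(** * Primitives decaying at one end of vertical lines *)

Section Decaying.
Variable R : realType.
Local Notation C := R[i].

(** [rho] is nondecreasing up to [t0] and bounded below, so its increments, hence those of [F], are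
    small near minus infinity. The limit is taken along [- n]. *)
Lemma line_limit (F : R -> C) (rho : R -> R) (t0 : R) :
  (forall t, 0 <= rho t) ->
  (forall s t, s <= t -> t <= t0 -> normc (F t - F s) <= rho t - rho s) ->
  exists p, forall e : R, 0 < e -> exists T, forall t, t <= T -> normc (F t - p) <= e.
Proof.
move=> r0 hF.
pose A : set R := [set rho t | t in [set t | t <= t0]].
have hA : has_inf A.
  by split; [exists (rho t0); exists t0 => //=|exists 0 => _ [t _ <-]].
have cau e : 0 < e -> exists2 T, T <= t0 & forall s t, s <= T -> t <= T ->
    normc (F t - F s) <= e.
  move=> e0; have [_ [T /= T0 <-] hT] := inf_adherent e0 hA.
  have mono s t : s <= t -> t <= t0 -> rho s <= rho t.
    by move=> st /(hF _ _ st) /(le_trans (normc_ge0 _)); rewrite subr_ge0.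
  have lb s : s <= t0 -> inf A <= rho s.
    by move=> st; apply: ge_inf; [case: hA|exists s].
  exists T => // s t sT tT.
  have m1 := mono _ _ sT T0; have m2 := mono _ _ tT T0.
  have l1 := lb _ (le_trans sT T0); have l2 := lb _ (le_trans tT T0).
  have [st|/ltW ts] := leP s t.
    by apply: le_trans (hF _ _ st (le_trans tT T0)) _; lra.
  by rewrite normc_distC; apply: le_trans (hF _ _ ts (le_trans sT T0)) _; lra.
have arch (T : R) : exists N, forall n, (N <= n)%N -> - n%:R <= T.
  exists (Num.bound `|T|) => n Nn; have := archi_boundP (normr_ge0 T).
  have : (Num.bound `|T|)%:R <= n%:R :> R by rewrite ler_nat.
  have := ler_norm (- T); rewrite normrN; lra.
have [p hp] : exists p, ccvg (fun n => F (- n%:R)) p.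
  apply: ccauchy => e /cau[T _ H]; have [N hN] := arch T.
  by exists N => m n Nm Nn; apply: H; exact: hN.
exists p => e /cau[T _ H]; exists T => t tT; rewrite normc_distC.
apply: ccvg_le hp _; have [N hN] := arch T.
by exists N => n Nn; apply: H => //; exact: hN.
Qed.

Lemma rder_vert (b t : R) : rder (fun t => b +i* t) t 'i%C.
Proof.
have := derD (der_cst (real_complex R) t b%:C)
  (derMc 'i%C (@der_id R _ (real_complex R) t)).
rewrite add0r mulr1; congr der; apply/funext => s.
by rewrite [RHS]complexE.
Qed.

Lemma rder_horiz (c b : R) : rder (fun b => b +i* c) b 1.
Proof.
have := derD (@der_id R _ (real_complex R) b) (der_cst (real_complex R) b ('i%C * c%:C)).
rewrite addr0; congr der; apply/funext => s.
by rewrite [RHS]complexE.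
Qed.

(** Variation of constants: [f = e^kap (P - p)], with [P] a primitive of [e^(- kap) g] and [p] its
    limit at the lower end of the lines. The sign of [Re (i kap')] says that [Re kap] does not
    increase upwards, so below a point the modulus of [e^(- kap)] is at most its value at that
    point, and the factor [e^kap] cancels it. The global [K] serves to show that [p] exists and is
    the same on all lines; the final bound accepts any [K'] valid on one line, and this lets the
    iteration gain a factor at each step. *)
Lemma decaying_primitive (b0 E K : R) (kap kap' g : C -> C) (r rho : R -> R -> R)
    (eps : R -> R) :
  (forall z, hp b0 z -> cder kap z (kap' z)) ->
  (forall z, hp b0 z -> complex.Re ('i%C * kap' z) <= 0) ->
  (forall z, hp b0 z -> exists l, cder g z l) ->
  (forall b t, b0 < b -> 0 <= r b t) ->
  (forall b t, b0 < b -> rderR (rho b) t (r b t)) ->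
  (forall b t, b0 < b -> 0 <= rho b t <= eps b) ->
  (forall b, b0 < b -> eps b <= E) -> 0 <= K ->
  (forall b t, b0 < b -> normc (g (b +i* t)) <= K * r b t) ->
  exists f, (forall z, hp b0 z -> cder f z (kap' z * f z + g z)) /\
    forall b K', b0 < b -> 0 <= K' ->
      (forall t, normc (g (b +i* t)) <= K' * r b t) ->
      forall t, normc (f (b +i* t)) <= K' * eps b.
Proof.
move=> dkap kneg dg r0 drho brho hE K0 hg.
have hpb b t : b0 < b -> hp b0 (b +i* t) by [].
pose z1 : C := (b0 + 1) +i* 0.
have hz1 : hp b0 z1 by rewrite /hp /= ltrDl.
pose H z := expc (- kap z) * g z.
have dH z : hp b0 z -> exists l, cder H z l.
  move=> hz; have [l hl] := dg z hz.
  have h := derMc (-1) (dkap z hz).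
  have h' := derM (der_comp h (cder_expc _)) hl.
  eexists; move: h'; congr der; apply/funext => y; by rewrite /H mulN1r.
have [P [_ dP]] := primitive dH hz1.
have [PP [_ dPP]] : exists PP, PP z1 = 0 /\ forall z, hp b0 z -> cder PP z (P z).
  by apply: (primitive (a := b0)) => // z hz; eexists; exact: dP.
have kmono b s t : b0 < b -> s <= t ->
    - complex.Re (kap (b +i* s)) <= - complex.Re (kap (b +i* t)).
  move=> hb st.
  apply: (@rderR_homo _ (fun u => - complex.Re (kap (b +i* u)))
    (fun u => - complex.Re ('i%C * kap' (b +i* u)))) => // u _.
    have := der_comp (rder_vert b u) (dkap (b +i* u) (hpb b u hb)).
    move=> /(derMc (-1)) /rder_is_derive /is_derive_rder.
    by apply: der_eq => [v|]; rewrite ?mulN1r cReN// mulrC.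
  by rewrite oppr_ge0; exact: kneg.
have Pbd b K' t0 s t : b0 < b -> 0 <= K' -> (forall t, normc (g (b +i* t)) <= K' * r b t) ->
    s <= t -> t <= t0 ->
    normc (P (b +i* t) - P (b +i* s)) <=
      expR (- complex.Re (kap (b +i* t0))) * K' * rho b t -
      expR (- complex.Re (kap (b +i* t0))) * K' * rho b s.
  move=> hb K'0 hK' st tt0; set c := expR _ * K'.
  have c0 : 0 <= c by rewrite mulr_ge0// expR_ge0.
  apply: (@rder_mvt R (fun u => P (b +i* u)) (fun u => H (b +i* u) * 'i%C)
     (fun u => c * rho b u) (fun u => c * r b u)) => // u /andP[su ut].
  - exact: der_comp (rder_vert b u) (dP (b +i* u) (hpb b u hb)).
  - by apply: der_eq (derMc c%:C (drho b u hb)) => [v|]; rewrite [RHS]rmorphM.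
  - rewrite normcM [normc 'i%C]/normc /= expr0n expr1n add0r sqrtr1 mulr1.
    rewrite /H normcM normc_expc cReN /c -mulrA ler_pM ?expR_ge0 ?normc_ge0//.
    by rewrite ler_expR; apply: kmono => //; exact: le_trans tt0.
have Plim b : exists p, b0 < b -> forall e : R, 0 < e ->
    exists T, forall t, t <= T -> normc (P (b +i* t) - p) <= e.
  have [hb|hb] := boolP (b0 < b); last by exists 0.
  have [p hp] := @line_limit (fun t => P (b +i* t))
    (fun t => expR (- complex.Re (kap (b +i* 0))) * K * rho b t) 0
    (fun t => mulr_ge0 (mulr_ge0 (expR_ge0 _) K0) (andP (brho b t hb)).1)
    (fun s t => Pbd b K 0 s t hb K0 (fun t => hg b t hb)).
  by exists p.
have {Plim}[p hp] := choice Plim.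
have pb b K' t : b0 < b -> 0 <= K' -> (forall t, normc (g (b +i* t)) <= K' * r b t) ->
    normc (P (b +i* t) - p b) <= expR (- complex.Re (kap (b +i* t))) * (K' * eps b).
  move=> hb K'0 hK'; apply/ler_addgt0Pr => e e0.
  have [T hT] := hp b hb e e0.
  apply: le_trans (normc_dist_triangle (P (b +i* Num.min T t)) _ _) _.
  apply: lerD; last by apply: hT; rewrite ge_min lexx.
  apply: le_trans (Pbd b K' t _ t hb K'0 hK' _ (lexx _)) _; first by rewrite ge_min lexx orbT.
  rewrite -mulrBr -mulrA ler_wpM2l ?expR_ge0// ler_wpM2l//.
  have /andP[h1 h2] := brho b t hb; have /andP[h3 h4] := brho b (Num.min T t) hb; lra.
(* [T] times the limit at the lower end is, up to [o(T)], a difference of values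
   of a second primitive [PP], whose derivative in [b] is bounded uniformly in
   [T]: divided by [T], the dependence on [b] disappears as [T] grows. *)
have plocal b : b0 < b -> exists2 d, 0 < d & forall b', `|b' - b| < d -> p b' = p b.
  move=> hb.
  have [d d0 Hd] := der_cont (dkap (b +i* 0) (hpb b 0 hb)) ltr01.
  exists (Num.min d (b - b0)); first by rewrite lt_min d0 subr_gt0.
  move=> b'; rewrite lt_min => /andP[bd bb0].
  (* On abscissae as close to [b] as [b'] is, the modulus of [e^(- kap)] at height 0 is at most [c];
     the 1 is the variation of [kap] allowed by the choice of [d]. *)
  pose c := expR (- complex.Re (kap (b +i* 0)) + 1).
  have near x : `|x - b| <= `|b' - b| -> b0 < x /\ expR (- complex.Re (kap (x +i* 0))) <= c.
    move=> xb; split; first by have := le_lt_trans xb bb0; rewrite ltr_norml => /andP[]; lra.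
    rewrite ler_expR.
    have /Hd : normc ((x +i* 0) - (b +i* 0)) < d.
      rewrite (_ : _ - _ = (x - b)%:C) ?normc_real; first exact: le_lt_trans bd.
      by apply/eqP; rewrite eq_complex /= subrr !eqxx.
    move=> /(le_trans (normc_Re _)); rewrite cReD cReN ler_norml => /andP[]; lra.
  have [hb' _] := near b' (lexx _).
  have c0 : 0 <= c by exact: expR_ge0.
  (* This is [i] times the integral of [P] between heights [- 2 T] and [- T]. The interval recedes
     to the lower end and has length [T], so [W T x] is [p x] times [i T] up to [o(T)]. *)
  pose W T x := PP (x +i* - T) - PP (x +i* - (2 * T)).
  have WT x e : b0 < x -> 0 < e -> exists T0, forall T, T0 <= T -> 0 <= T ->
      normc (W T x - p x * (T *i)) <= e * T.
    move=> hx e0; have [T1 hT1] := hp x hx e e0.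
    exists (- T1) => T T1T T0.
    have := @rder_mvt_cst R (fun u => PP (x +i* u) - p x * 'i%C * u%:C)
      (fun u => P (x +i* u) * 'i%C - p x * 'i%C) e (- (2 * T)) (- T).
    have -> : PP (x +i* - T) - p x * 'i%C * (- T)%:C -
      (PP (x +i* - (2 * T)) - p x * 'i%C * (- (2 * T))%:C) = W T x - p x * (T *i).
      have -> : T *i = 'i%C * T%:C.
        by rewrite [LHS]complexE; cbn [complex.Re complex.Im]; rewrite rmorph0 add0r.
      by rewrite /W !rmorphN rmorphM rmorph_nat /=; ring.
    have -> : e * (- T - - (2 * T)) = e * T by ring.
    apply; first by lra.
      move=> s _; have := derB (der_comp (rder_vert x s) (dPP (x +i* s) (hpb x s hx)))
        (derMc (p x * 'i%C) (@der_id R _ (real_complex R) s)).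
      by rewrite mulr1.
    move=> s /andP[_ sT]; rewrite -mulrBl normcM.
    rewrite [normc 'i%C]/normc /= expr0n expr1n add0r sqrtr1 mulr1.
    by apply: hT1; lra.
  (* The derivative of [W T] in the abscissa is a difference of two values of [P] on one vertical
     line, bounded independently of [T]. *)
  have WW T : 0 <= T -> normc (W T b' - W T b) <= c * K * E * `|b' - b|.
    move=> T0.
    have aux x y : x <= y -> (forall s, x <= s <= y -> `|s - b| <= `|b' - b|) ->
        normc (W T y - W T x) <= c * K * E * (y - x).
      move=> xy hs; apply: (@rder_mvt_cst R _
        (fun s => P (s +i* - T) * 1 - P (s +i* - (2 * T)) * 1)) => // s /hs /near[hs0 hc].
        by apply: derB; exact: der_comp (rder_horiz _ s) (dPP _ (hpb _ _ hs0)).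
      rewrite !mulr1.
      have := Pbd s K 0 (- (2 * T)) (- T) hs0 K0 (fun t => hg s t hs0).
      move=> /(_ _ _)/le_trans; apply; [lra|lra|].
      have /andP[h1 h2] := brho s (- T) hs0; have /andP[h3 h4] := brho s (- (2 * T)) hs0.
      have h5 := hE s hs0.
      have k0 : 0 <= K * (rho s (- T) - rho s (- (2 * T))).
        rewrite mulr_ge0// subr_ge0.
        apply: (@rderR_homo _ (rho s) (r s)) => [|u _|u _]; [lra|exact: drho|exact: r0].
      have k1 : K * (rho s (- T) - rho s (- (2 * T))) <= K * E by rewrite ler_wpM2l//; lra.
      have := ler_pM (expR_ge0 _) k0 hc k1; rewrite !mulrA => /(le_trans _); apply.
      by rewrite -!mulrA -!mulrBr.
    have [bb|/ltW bb] := leP b b'.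
      rewrite ger0_norm ?subr_ge0//; apply: aux => // s /andP[? ?].
      by rewrite !ger0_norm ?subr_ge0//; lra.
    rewrite normc_distC distrC ger0_norm ?subr_ge0//; apply: aux => // s /andP[? ?].
    by rewrite distrC (distrC b') !ger0_norm ?subr_ge0//; lra.
  apply/eqP; rewrite -subr_eq0 -normc_eq0 eq_le normc_ge0 andbT.
  apply/ler_addgt0Pr => e e0; rewrite add0r.
  have e3 : 0 < e / 3 by lra.
  have [T1 h1] := WT b _ hb e3; have [T2 h2] := WT b' _ hb' e3.
  pose M := c * K * E * `|b' - b|.
  (* Past both thresholds, and large enough for [M <= (e / 3) T]. *)
  pose T := 1 + `|T1| + `|T2| + `|M| / (e / 3).
  have Me : 0 <= `|M| / (e / 3) by rewrite divr_ge0// ltW.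
  have T0 : 0 < T by rewrite /T; have := normr_ge0 T1; have := normr_ge0 T2; lra.
  have {}h1 : normc (W T b - p b * (T *i)) <= e / 3 * T.
    by apply: h1; [rewrite /T; have := ler_norm T1; have := normr_ge0 T2; lra|exact: ltW].
  have {}h2 : normc (W T b' - p b' * (T *i)) <= e / 3 * T.
    by apply: h2; [rewrite /T; have := ler_norm T2; have := normr_ge0 T1; lra|exact: ltW].
  have h3 := WW T (ltW T0).
  have h4 : M <= e / 3 * T.
    apply: le_trans (ler_norm _) _; rewrite mulrC -ler_pdivrMr// /T.
    have := normr_ge0 T1; have := normr_ge0 T2; lra.
  rewrite -(ler_pM2r T0).
  have nT : normc (T *i) = T by rewrite /normc expr0n add0r sqrtr_sqr ger0_norm ?ltW.
  rewrite -{1}nT -normcM.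
  have -> : (p b' - p b) * (T *i) = (W T b - p b * (T *i)) + ((W T b' - W T b) -
     (W T b' - p b' * (T *i))) by ring.
  apply: le_trans (le_normcD _ _) _; apply: le_trans (lerD h1 (le_normcB _ _)) _.
  by move: h2 h3 h4; rewrite /M; lra.
have pcst b b' : b0 < b -> b <= b' -> p b' = p b.
  move=> hb bb'; apply: rder_const => // s /andP[bs _] e e0.
  have [d d0 Hd] := plocal s (lt_le_trans hb bs).
  exists d => // y; rewrite -rmorphB normc_real => /Hd ->.
  by rewrite mul0r subr0 subrr normc0 mulr_ge0// ltW.
have pE b : b0 < b -> p b = p (b0 + 1).
  move=> hb; have h1 : b0 < b0 + 1 by rewrite ltrDl.
  by have [le|/ltW le] := leP b (b0 + 1); [rewrite (pcst _ _ hb le)|rewrite (pcst _ _ h1 le)].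
exists (fun z => expc (kap z) * (P z - p (b0 + 1))); split.
  move=> z hz.
  have := derM (der_comp (dkap z hz) (cder_expc (kap z))) (derB (dP z hz) (der_cst id z (p (b0 + 1)))).
  rewrite subr0; congr der; rewrite /H [X in _ + X]mulrA expcNK mul1r; ring.
move=> b K' hb K'0 hK' t; rewrite normcM normc_expc -(pE b hb).
rewrite -[leRHS]mul1r -(expRxMexpNx_1 (complex.Re (kap (b +i* t)))) -mulrA.
by rewrite ler_wpM2l ?expR_ge0//; exact: pb.
Qed.

End Decaying.

(** * Linear systems *)

Section Systems.
Variable R : realType.
Local Notation C := R[i].

(** When [Re kap] does not decrease upwards, conjugation exchanges the ends of the lines. The
    density [r b (- t)] then has the primitive [eps b - rho b (- t)], which again takes its values
    between 0 and [eps b]. *)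
Lemma bidecaying_primitive (b0 E K : R) (kap kap' g : C -> C) (r rho : R -> R -> R)
    (eps : R -> R) :
  (forall z, hp b0 z -> cder kap z (kap' z)) ->
  (forall z, hp b0 z -> complex.Re ('i%C * kap' z) <= 0) \/
  (forall z, hp b0 z -> 0 <= complex.Re ('i%C * kap' z)) ->
  (forall z, hp b0 z -> exists l, cder g z l) ->
  (forall b t, b0 < b -> 0 <= r b t) ->
  (forall b t, b0 < b -> rderR (rho b) t (r b t)) ->
  (forall b t, b0 < b -> 0 <= rho b t <= eps b) ->
  (forall b, b0 < b -> eps b <= E) -> 0 <= K ->
  (forall b t, b0 < b -> normc (g (b +i* t)) <= K * r b t) ->
  exists f, (forall z, hp b0 z -> cder f z (kap' z * f z + g z)) /\
    forall b K', b0 < b -> 0 <= K' ->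
      (forall t, normc (g (b +i* t)) <= K' * r b t) ->
      forall t, normc (f (b +i* t)) <= K' * eps b.
Proof.
move=> dkap [kneg|kpos] dg r0 drho brho hE K0 hg.
  exact: (decaying_primitive dkap kneg dg r0 drho brho hE K0 hg).
have hpJ z : hp b0 z -> hp b0 z^*%C by case: z.
have [|||||||||f [df bf]] := @decaying_primitive R b0 E K
  (fun z => (kap z^*%C)^*%C) (fun z => (kap' z^*%C)^*%C) (fun z => (g z^*%C)^*%C)
  (fun b t => r b (- t)) (fun b t => eps b - rho b (- t)) eps => //.
- by move=> z hz; apply: cder_conj; apply: dkap; exact: hpJ.
- move=> z /hpJ /kpos; case: (kap' _) => x y /=; lra.
- by move=> z /hpJ /dg[l hl]; exists l^*%C; exact: cder_conj.
- by move=> b t hb; exact: r0.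
- move=> b t hb.
  have /(@rder_scale R (fun u => (rho b u)%:C)) : rder (fun u => (rho b u)%:C) (-1 * t + 0) (r b (- t))%:C.
    by rewrite addr0 mulN1r; exact: drho.
  move=> /(derB (der_cst (real_complex R) t (eps b)%:C)).
  apply: der_eq => [s|]; first by rewrite mulN1r addr0 rmorphB.
  by rewrite rmorphN1; ring.
- by move=> b t hb; have /andP[] := brho b (- t) hb; lra.
- by move=> b t hb; rewrite normc_conj; exact: hg.
exists (fun z => (f z^*%C)^*%C); split.
  move=> z hz; have := cder_conj (df _ (hpJ z hz)).
  by apply: der_eq => //; rewrite rmorphD rmorphM /= !conjcK.
move=> b K' hb K'0 hK' t; rewrite normc_conj; apply: bf => // s.
by rewrite normc_conj; exact: hK'.
Qed.

Lemma local_sum_bound (I : Type) (s : seq I) (F : I -> C -> C) (z : C) :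
  (forall i, exists l, cder (F i) z l) ->
  exists d K : R, [/\ 0 < d, 0 <= K & forall w, normc (w - z) < d -> \sum_(i <- s) normc (F i w) <= K].
Proof.
move=> h; elim: s => [|i s [d [K [d0 K0 H]]]].
  by exists 1, 0; split => // w _; rewrite big_nil.
have [l hl] := h i; have [d' d'0 H'] := der_bounded hl.
exists (Num.min d d'), (normc (F i z) + 1 + K); split; first by rewrite lt_min d0.
  by rewrite !addr_ge0 ?normc_ge0.
by move=> w; rewrite lt_min big_cons => /andP[/H ? /H' ?]; exact: lerD.
Qed.

Lemma ccvgD (u v : nat -> C) l m : ccvg u l -> ccvg v m ->
  ccvg (fun n => u n + v n) (l + m).
Proof.
move=> h h' e e0; have e2 : 0 < e / 2 by lra.
have [N H] := h _ e2; have [M H'] := h' _ e2; exists (maxn N M) => n.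
rewrite geq_max => /andP[/H{}H /H'{}H']; rewrite opprD addrACA.
by apply: le_trans (le_normcD _ _) _; lra.
Qed.

Lemma ccvgM (c : C) (u : nat -> C) l : ccvg u l -> ccvg (fun n => c * u n) (c * l).
Proof.
move=> h e e0; have c1 : 0 < normc c + 1 by rewrite ltr_wpDl ?normc_ge0.
have [N H] := h _ (divr_gt0 e0 c1); exists N => n /H; rewrite ler_pdivlMr// => {}H.
rewrite -mulrBr normcM; apply: le_trans H; rewrite mulrC ler_wpM2l ?normc_ge0//.
by rewrite lerDl.
Qed.

Lemma ccvg_cst (c : C) : ccvg (fun=> c) c.
Proof. by move=> e e0; exists 0%N => n _; rewrite subrr normc0 ltW. Qed.

Lemma ccvg_sum (I : Type) (s : seq I) (u : I -> nat -> C) (l : I -> C) :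
  (forall i, ccvg (u i) (l i)) -> ccvg (fun n => \sum_(i <- s) u i n) (\sum_(i <- s) l i).
Proof.
move=> h; elim: s => [|i s IH].
  by rewrite big_nil; under eq_fun do rewrite big_nil; exact: ccvg_cst.
by rewrite big_cons; under eq_fun do rewrite big_cons; exact: ccvgD.
Qed.

Lemma ccvg_shift (u : nat -> C) l : ccvg u l -> ccvg (fun n => u n.+1) l.
Proof. by move=> h e /h[N H]; exists N => n Nn; apply: H; exact: leqW. Qed.

Variable n : nat.
Implicit Types (A : 'I_n -> 'I_n -> C -> C).

(* Summation of a Picard iteration for [y' = kap' y + h + A y], [h] being absorbed
   in the first term. *)
Lemma picard_sum (U : set C) A (kap' h : 'I_n -> C -> C) (D : nat -> 'I_n -> C -> C) :
  (forall z, U z -> exists2 d : R, 0 < d & forall w, normc (w - z) < d -> U w) ->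
  (forall p q z, U z -> exists l, cder (A p q) z l) ->
  (forall p z, U z -> exists l, cder (kap' p) z l) ->
  (forall p z, U z -> exists l, cder (h p) z l) ->
  (forall p z, U z -> cder (D 0%N p) z (kap' p z * D 0%N p z + h p z)) ->
  (forall m p z, U z ->
     cder (D m.+1 p) z (kap' p z * D m.+1 p z + \sum_q A p q z * D m q z)) ->
  (forall z, U z -> exists d K : R, [/\ 0 < d, 0 <= K & forall w, normc (w - z) < d ->
     forall m p, normc (D m p w) <= K * 2^-1 ^+ m]) ->
  exists f : 'I_n -> C -> C, forall p z, U z -> ccvg (psum (fun m => D m p z)) (f p z) /\
    cder (f p) z (kap' p z * f p z + h p z + \sum_q A p q z * f q z).
Proof.
move=> oU dA dk dh d0 dS bd.
pose D' m p z := kap' p z * D m p z +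
  if m is m'.+1 then \sum_q A p q z * D m' q z else h p z.
have dD m p z : U z -> cder (D m p) z (D' m p z).
  by case: m => [|m] hz; [exact: d0|exact: dS].
have /choice[ff hff] : forall p, exists ff : (C -> C) * (C -> C), forall z, U z ->
    [/\ ccvg (psum (fun m => D m p z)) (ff.1 z),
        ccvg (psum (fun m => D' m p z)) (ff.2 z) & cder ff.1 z (ff.2 z)].
  move=> p; have [|f [f' H]] := @series_cder R U (fun m => D m p) (fun m => D' m p); last first.
    by exists (f, f').
  move=> z hz; have [d1 d10 h1] := oU z hz.
  have [d2 [K2 [d20 K20 h2]]] := bd z hz.
  have [d3 [K3 [d30 K30 h3]]] := @local_sum_bound _ (enum 'I_n) (fun q => A p q) z
    (fun q => dA p q z hz).
  have [l4 hl4] := dk p z hz; have [d4 d40 h4] := der_bounded hl4.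
  have [l5 hl5] := dh p z hz; have [d5 d50 h5] := der_bounded hl5.
  pose K4 := normc (kap' p z) + 1; pose K5 := normc (h p z) + 1.
  have K40 : 0 <= K4 by rewrite addr_ge0 ?normc_ge0.
  have K50 : 0 <= K5 by rewrite addr_ge0 ?normc_ge0.
  exists (Num.min d1 (Num.min d2 (Num.min d3 (Num.min d4 d5)))),
    (K2 + K4 * K2 + 2 * (K3 * K2) + K5); split; first by rewrite !lt_min d10 d20 d30 d40.
  move=> w; rewrite !lt_min => /and5P[/h1 hw /h2{}h2 /h3{}h3 /h4{}h4 /h5{}h5] m.
  have h0 k : 0 <= 2^-1 ^+ k :> R by rewrite exprn_ge0// invr_ge0.
  have h01 := h0 m.
  have [P1 P2 P3] : [/\ 0 <= K4 * K2, 0 <= K3 * K2 & 0 <= K2 * 2^-1 ^+ m].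
    by split; rewrite mulr_ge0.
  have P4 : 0 <= (K4 * K2) * 2^-1 ^+ m by rewrite mulr_ge0.
  have P5 : 0 <= (K3 * K2) * 2^-1 ^+ m by rewrite mulr_ge0.
  have P6 : 0 <= K5 * 2^-1 ^+ m by rewrite mulr_ge0.
  split; [exact: dD|by apply: le_trans (h2 m p) _; lra|].
  apply: le_trans (le_normcD _ _) _; rewrite normcM.
  have B1 : normc (kap' p w) * normc (D m p w) <= K4 * (K2 * 2^-1 ^+ m).
    by rewrite ler_pM ?normc_ge0.
  (* The factor 2 pays for the shift of index: the derivative of term [m + 1] involves term [m]. *)
  have B2 : normc (if m is m'.+1 then \sum_q A p q w * D m' q w else h p w) <=
      2 * (K3 * K2) * 2^-1 ^+ m + K5 * 2^-1 ^+ m.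
    case: m {B1} h01 P3 P4 P5 P6 => [|m] h01 P3 P4 P5 P6.
      by rewrite expr0 !mulr1 in P5 *; apply: le_trans h5 _; rewrite /K5; lra.
    apply: le_trans (normc_sum _ _ _) _.
    have : \sum_q normc (A p q w * D m q w) <= K3 * (K2 * 2^-1 ^+ m).
      apply: le_trans (_ : \sum_q normc (A p q w) * (K2 * 2^-1 ^+ m) <= _).
        by apply: ler_sum => q _; rewrite normcM ler_wpM2l ?normc_ge0.
      rewrite -mulr_suml ler_wpM2r ?mulr_ge0//; move: h3; rewrite big_enum; exact.
    move: P6; rewrite exprS; set x := 2^-1 ^+ m; lra.
  lra.
exists (fun p => (ff p).1) => p z hz; have [c1 c2 c3] := hff p z hz; split => //.
(* The derivative of the sum is identified as a limit of partial sums of the derived series, shifted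
   by one: the recursion expresses them by partial sums of the terms themselves. *)
move: c3; apply: der_eq => //; apply: ccvg_unique (ccvg_shift c2) _.
have -> : (fun m => psum (fun m0 => D' m0 p z) m.+1) =
   (fun m => kap' p z * psum (fun m0 => D m0 p z) m.+1 + h p z +
     \sum_q A p q z * psum (fun m0 => D m0 q z) m).
  apply/funext; elim => [|m IH].
    rewrite /psum !big_ord1 /D' big1 ?addr0// => q _; by rewrite big_ord0 mulr0.
  rewrite psumS IH (psumS _ m.+1) mulrDr /D'.
  under [in RHS]eq_bigr do rewrite psumS mulrDr.
  by rewrite big_split /=; ring.
apply: ccvgD; first by apply: ccvgD; [exact/ccvgM/ccvg_shift|exact: ccvg_cst].
by apply: ccvg_sum => q; apply: ccvgM; case: (hff q z hz).
Qed.

(** In the application [f] is column [j] of [F], where [1 + F] is the factor in front of [e^Q], and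
    [kap p = q_p - q_j]. The first term of the iteration has the source [A p j] and is at most
    [eps b] on each line. Every later step multiplies the bound by [eps b <= 1/2], and the geometric
    series gives [2 eps b]. *)
Lemma integral_system (b0 : R) A (kap kap' : 'I_n -> C -> C) (r rho : R -> R -> R)
    (eps : R -> R) (j : 'I_n) :
  (forall p z, hp b0 z -> cder (kap p) z (kap' p z)) ->
  (forall p z, hp b0 z -> exists l, cder (kap' p) z l) ->
  (forall p, (forall z, hp b0 z -> complex.Re ('i%C * kap' p z) <= 0) \/
     (forall z, hp b0 z -> 0 <= complex.Re ('i%C * kap' p z))) ->
  (forall p q z, hp b0 z -> exists l, cder (A p q) z l) ->
  (forall b t p, b0 < b -> \sum_q normc (A p q (b +i* t)) <= r b t) ->
  (forall b t, b0 < b -> rderR (rho b) t (r b t)) ->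
  (forall b t, b0 < b -> 0 <= rho b t <= eps b) ->
  (forall b, b0 < b -> eps b <= 2^-1) ->
  exists f : 'I_n -> C -> C, forall p,
    (forall z, hp b0 z -> cder (f p) z
       (kap' p z * f p z + \sum_q A p q z * ((q == j)%:R + f q z))) /\
    (forall b t, b0 < b -> normc (f p (b +i* t)) <= 2 * eps b).
Proof.
move=> dk dk' sg dA hr drho brho he.
have r0 b t : b0 < b -> 0 <= r b t.
  by move=> hb; apply: le_trans (hr b t j hb); apply: sumr_ge0 => q _; exact: normc_ge0.
have e0 b : b0 < b -> 0 <= eps b.
  by move=> hb; have /andP[h1 h2] := brho b 0 hb; exact: le_trans h2.
have h0 k : 0 <= 2^-1 ^+ k :> R by rewrite exprn_ge0// invr_ge0.
have h1 k : 2^-1 ^+ k <= 1 :> R by rewrite exprn_ile1// ?invr_ge0//; lra.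
have solve p g : (forall z, hp b0 z -> exists l, cder g z l) ->
    (forall b t, b0 < b -> normc (g (b +i* t)) <= 1 * r b t) ->
    exists f, (forall z, hp b0 z -> cder f z (kap' p z * f z + g z)) /\
    forall b K', b0 < b -> 0 <= K' ->
      (forall t, normc (g (b +i* t)) <= K' * r b t) ->
      forall t, normc (f (b +i* t)) <= K' * eps b.
  by move=> dg hg; exact: (bidecaying_primitive (dk p) (sg p) dg r0 drho brho he ler01 hg).
pose good m (D : 'I_n -> C -> C) := forall p, (forall z, hp b0 z -> exists l, cder (D p) z l) /\
  forall b t, b0 < b -> normc (D p (b +i* t)) <= eps b * 2^-1 ^+ m.
have /choice[D0 hD0] : forall p, exists f, (forall z, hp b0 z -> cder f z (kap' p z * f z + A p j z)) /\
    (forall b t, b0 < b -> normc (f (b +i* t)) <= eps b).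
  move=> p; have hA b t : b0 < b -> normc (A p j (b +i* t)) <= 1 * r b t.
    move=> hb; rewrite mul1r; apply: le_trans (hr b t p hb).
    by rewrite (bigD1 j)//= lerDl sumr_ge0// => q _; exact: normc_ge0.
  have [f [df bf]] := solve p _ (dA p j) hA; exists f; split => // b t hb.
  by rewrite -(mul1r (eps b)); apply: bf => // s; exact: hA.
(* Stated for every [D], under the hypothesis [good m D], so that a step function can be chosen
   before the sequence is built. *)
have step m D : exists D', good m D -> good m.+1 D' /\ forall p z, hp b0 z ->
    cder (D' p) z (kap' p z * D' p z + \sum_q A p q z * D q z).
  have [gD|?] := pselect (good m D); last by exists D.
  suff /choice[D' hD'] : forall p, exists f, (forall z, hp b0 z ->
      cder f z (kap' p z * f z + \sum_q A p q z * D q z)) /\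
      (forall b t, b0 < b -> normc (f (b +i* t)) <= eps b * 2^-1 ^+ m.+1).
    exists D' => _; split; last by move=> p; exact: (hD' p).1.
    by move=> p; have [df bf] := hD' p; split => // z /df; eexists; eassumption.
  move=> p.
  have hg b t : b0 < b -> normc (\sum_q A p q (b +i* t) * D q (b +i* t)) <=
      (eps b * 2^-1 ^+ m) * r b t.
    move=> hb; apply: le_trans (normc_sum _ _ _) _.
    apply: le_trans (_ : \sum_q normc (A p q (b +i* t)) * (eps b * 2^-1 ^+ m) <= _).
      by apply: ler_sum => q _; rewrite normcM ler_wpM2l ?normc_ge0//; exact: (gD q).2.
    by rewrite -mulr_suml mulrC ler_wpM2l ?mulr_ge0 ?e0// hr.
  have [||f [df bf]] := solve p (fun z => \sum_q A p q z * D q z).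
  - move=> z hz.
    have /choice[L hL] : forall q, exists l, cder (fun z => A p q z * D q z) z l.
      move=> q; have [l hl] := dA p q z hz; have [m' hm] := (gD q).1 z hz.
      by eexists; exact: derM hl hm.
    by eexists; apply: der_sum; exact: hL.
  - move=> b t hb; apply: le_trans (hg b t hb) _; rewrite ler_wpM2r ?r0//.
    have := ler_pM (e0 b hb) (h0 m) (he b hb) (h1 m); lra.
  exists f; split => // b t hb.
  have := bf b (eps b * 2^-1 ^+ m) hb (mulr_ge0 (e0 b hb) (h0 m)) (fun t => hg b t hb) t.
  move=> /le_trans; apply; rewrite exprS.
  have := ler_wpM2l (mulr_ge0 (e0 b hb) (h0 m)) (he b hb); lra.
have /choice[st hst] : forall mD : nat * ('I_n -> C -> C), exists D', good mD.1 mD.2 -> good mD.1.+1 D' /\ forall p z, hp b0 z ->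
    cder (D' p) z (kap' p z * D' p z + \sum_q A p q z * mD.2 q z).
  by move=> [m D] /=; exact: step.
pose D := fix D m := if m is m'.+1 then st (m', D m') else D0.
have gD m : good m (D m).
  elim: m => [|m IH]; last by have [] := hst (m, D m) IH.
  move=> p; have [df bf] := hD0 p; split; first by move=> z /df; eexists; eassumption.
  by move=> b t hb; rewrite expr0 mulr1; exact: bf.
have [|||||f hf] := @picard_sum (hp b0) A kap' (fun p => A p j) D _ dA dk'.
- by move=> z; exact: hp_open.
- by move=> p z; exact: dA.
- by move=> p z; exact: (hD0 p).1.
- by move=> m p z; exact: (hst (m, D m) (gD m)).2.
- move=> z /hp_open[d d0 H]; exists d, 1; split => // w /H hw m p.
  case: w hw => b t hb; apply: le_trans ((gD m p).2 b t hb) _.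
  by rewrite ler_wpM2r// (le_trans (he b hb))//; lra.
exists f => p; split.
  move=> z hz; have := (hf p z hz).2; apply: der_eq => //.
  rewrite -addrA; congr (_ + _); under [RHS]eq_bigr do rewrite mulrDr.
  rewrite big_split /=; congr (_ + _); rewrite (bigD1 j)//= eqxx mulr1 big1 ?addr0//.
  by move=> q /negbTE->; rewrite mulr0.
move=> b t hb; have := (hf p (b +i* t) hb).1.
move=> /(@psum_limit _ _ (eps b) _ 0) -/(_ (fun m => (gD m p).2 b t hb)).
by rewrite /psum big_ord0 subr0 expr0 mulr1.
Qed.

(** Compactness: near each point of the rectangle the sum is at most [K] for all large [K], and a
    covering argument makes one [K] serve all points. *)
Lemma rectangle_bound (I : Type) (s : seq I) (F : I -> C -> C) (a x0 x1 y0 y1 : R) : a < x0 ->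
  (forall i z, hp a z -> exists l, cder (F i) z l) ->
  exists2 K : R, 0 <= K & forall z, x0 <= complex.Re z <= x1 -> y0 <= complex.Im z <= y1 ->
    \sum_(i <- s) normc (F i z) <= K.
Proof.
move=> ax dF.
have cpt : compact ((`[x0, x1] : set R) `*` (`[y0, y1] : set R)).
  by apply: compact_setX; exact: segment_compact.
move/compact_near_coveringP : cpt => /(_ R (pinfty_nbhs R) (fun K (z : R * R) => \sum_(i <- s) normc (F i (z.1 +i* z.2)) <= K) _).
case.
  move=> [x y] [/= hx hy].
  have hz : hp a (x +i* y) by move: hx; rewrite in_itv /= /hp /= => /andP[h _]; exact: lt_le_trans h.
  have [d [K [d0 K0 H]]] := @local_sum_bound _ s F _ (fun i => dF i _ hz).
  have d2 : 0 < d / 2 by lra.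
  exists (ball (x, y) (d / 2), [set K' | K < K']) => /=.
    by split; [exact: nbhsx_ballx|exists K; split; [exact: num_real|]].
  move=> [[x' y'] K'] /= [[hx' hy'] KK']; apply: le_trans (ltW KK'); apply: H.
  apply: le_lt_trans (normc_le_ReIm _) _ => /=.
  by move: hx' hy'; rewrite /ball /= distrC (distrC y); lra.
move=> M [_ HM].
exists (Num.max 0 (M + 1)); first by rewrite le_max lexx.
move=> [x y] hx hy; apply: le_trans (_ : M + 1 <= _); last by rewrite le_max lexx orbT.
by apply: (HM (M + 1) _ (x, y)); [rewrite ltrDl|split => /=; rewrite in_itv].
Qed.

(** Picard iteration with primitives vanishing at [z1]. As [A] need not be small, the terms are
    estimated on a rectangle containing [z1] and a neighbourhood of [z]: it is convex, and [A] is
    bounded on it. *)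
Lemma linear_ode (a : R) A (z1 : C) (v : 'I_n -> C) : hp a z1 ->
  (forall p q z, hp a z -> exists l, cder (A p q) z l) ->
  exists y : 'I_n -> C -> C, (forall p, y p z1 = v p) /\
    forall p z, hp a z -> cder (y p) z (\sum_q A p q z * y q z).
Proof.
move=> hz1 dA.
pose good (D : 'I_n -> C -> C) := forall p z, hp a z -> exists l, cder (D p) z l.
have step D : exists D' : 'I_n -> C -> C, good D -> forall p, D' p z1 = 0 /\
    forall z, hp a z -> cder (D' p) z (\sum_q A p q z * D q z).
  have [gD|?] := pselect (good D); last by exists D.
  suff /choice[D' hD'] : forall p, exists f, f z1 = 0 /\
      forall z, hp a z -> cder f z (\sum_q A p q z * D q z) by exists D'.
  move=> p; apply: primitive => // z hz.
  have /choice[L hL] : forall q, exists l, cder (fun z => A p q z * D q z) z l.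
    move=> q; have [l hl] := dA p q z hz; have [m' hm] := gD q z hz.
    by eexists; exact: derM hl hm.
  by eexists; apply: der_sum; exact: hL.
have {step}/choice[st hst] := step.
pose D := fix D m : 'I_n -> C -> C := if m is m'.+1 then st (D m') else fun p _ => v p.
have gD m : good (D m).
  elim: m => [|m IH] p z hz; first by eexists; exact: der_cst.
  by eexists; exact: (hst (D m) IH p).2.
have [||||||y hy] := @picard_sum (hp a) A (fun _ _ => 0) (fun _ _ => 0) D _ dA.
- by move=> z; exact: hp_open.
- by move=> p z _; eexists; exact: der_cst.
- by move=> p z _; eexists; exact: der_cst.
- by move=> p z _; rewrite mul0r addr0; exact: der_cst.
- by move=> m p z hz; rewrite mul0r add0r; exact: (hst (D m) (gD m) p).2.
- move=> z hz; have hz' := hz; rewrite /hp in hz' hz1.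
  pose x0 := Num.min (complex.Re z1) ((a + complex.Re z) / 2).
  have ax0 : a < x0 by rewrite lt_min hz1 /=; lra.
  have [d' d'0 d'z] : exists2 d', 0 < d' & d' <= (complex.Re z - a) / 2 by exists ((complex.Re z - a) / 2); lra.
  pose x1 := Num.max (complex.Re z1) (complex.Re z + d').
  pose y0 := Num.min (complex.Im z1) (complex.Im z - d').
  pose y1 := Num.max (complex.Im z1) (complex.Im z + d').
  pose rect w := x0 <= complex.Re w <= x1 /\ y0 <= complex.Im w <= y1.
  have rz1 : rect z1 by rewrite /rect /x0 /x1 /y0 /y1 !ge_min !le_max !lexx.
  have rw w : normc (w - z) < d' -> rect w.
    move=> hw; have := le_lt_trans (normc_Re _) hw; have := le_lt_trans (normc_Im _) hw.
    rewrite cReD cReN cImD cImN !ltr_norml => /andP[A1 A2] /andP[A3 A4].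
    rewrite /rect /x0 /x1 /y0 /y1 !ge_min !le_max.
    by split; apply/andP; split; apply/orP; right; lra.
  have hrect w : rect w -> hp a w by move=> [/andP[h _] _]; exact: lt_le_trans h.
  have rseg w s : rect w -> 0 <= s <= 1 -> rect (seg z1 w s).
    move=> [/andP[B1 B2] /andP[B3 B4]] /andP[s0 s1].
    have [/andP[C1 C2] /andP[C3 C4]] := rz1.
    rewrite /rect /seg cReD cImD cReM cImM /= !mul0r subr0 addr0 !(cReD, cImD, cReN, cImN).
    have cv (u v' m' : R) : m' <= u -> m' <= v' -> m' <= u + s * (v' - u).
      move=> hu hv; have e1 : 0 <= (1 - s) * (u - m') by rewrite mulr_ge0// subr_ge0.
      have e2 : 0 <= s * (v' - m') by rewrite mulr_ge0// subr_ge0.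
      lra.
    have cv' (u v' m' : R) : u <= m' -> v' <= m' -> u + s * (v' - u) <= m'.
      by move=> hu hv; have := cv (- u) (- v') (- m'); rewrite !lerN2 => /(_ hu hv); lra.
    by split; apply/andP; split; [exact: cv|exact: cv'|exact: cv|exact: cv'].
  have [K K0 HK] := @rectangle_bound _ (enum {: 'I_n * 'I_n}) (fun pq => A pq.1 pq.2) a x0 x1 y0 y1 ax0
    (fun pq => dA pq.1 pq.2).
  have {}HK w p : rect w -> \sum_q normc (A p q w) <= K.
    move=> [r1 r2]; apply: le_trans (HK w r1 r2); rewrite big_enum /=.
    rewrite -(pair_bigA _ (fun p q => normc (A p q w)))/= [leRHS](bigD1 p)//= lerDl.
    by do 2!(apply: sumr_ge0 => ? _); exact: normc_ge0.
  (* With the weight [exp (2 K |w - z1|)] each step of the iteration gains a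
     factor [1/2], however large [K] is. *)
  pose V := \sum_p normc (v p).
  have V0 : 0 <= V by apply: sumr_ge0 => ? _; exact: normc_ge0.
  have h0 k : 0 <= 2^-1 ^+ k :> R by rewrite exprn_ge0// invr_ge0.
  have bD m p w : rect w -> normc (D m p w) <= V * 2^-1 ^+ m * expR (2 * K * normc (w - z1)).
    elim: m p w => [|m IH] p w rwh.
      rewrite expr0 mulr1 -[leLHS]mulr1 ler_pM ?normc_ge0//.
        by rewrite /V (bigD1 p)//= lerDl sumr_ge0// => ? _; exact: normc_ge0.
      by rewrite -expR0 ler_expR !mulr_ge0// normc_ge0.
    have [D1 D2] := hst (D m) (gD m) p.
    set c := normc (w - z1); have c0 : 0 <= c by exact: normc_ge0.
    pose M := V * 2^-1 ^+ m.+1.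
    have M0 : 0 <= M by rewrite mulr_ge0.
    have /= := @rder_mvt R (fun s => D m.+1 p (seg z1 w s))
      (fun s => (\sum_q A p q (seg z1 w s) * D m q (seg z1 w s)) * (w - z1))
      (fun s => M * expR (2 * K * c * s)) (fun s => M * (expR (2 * K * c * s) * (2 * K * c))) 0 1 ler01.
    rewrite seg1 seg0 D1 subr0 mulr1 => H'.
    apply: le_trans (H' _ _ _) _; last by rewrite lerBlDr lerDl mulr_ge0// expR_ge0.
    + by move=> s s01; apply: cder_seg; apply: D2; apply: hrect; exact: rseg.
    + move=> s _; have de := cder_expc (2 * K * c * s)%:C.
      have dl : rder (fun s => (2 * K * c * s)%:C) s (2 * K * c)%:C.
        have := derMc (2 * K * c)%:C (@der_id R _ (real_complex R) s).
        by rewrite mulr1; apply: der_eq => // y; rewrite [RHS]rmorphM.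
      have eE x : expc x%:C = (expR x)%:C :> C.
        by rewrite /expc /polar /= cos0 sin0 mulr1 mulr0.
      have := derMc M%:C (der_comp dl de).
      by apply: der_eq => [y'|]; rewrite ?eE -!rmorphM.
    + move=> s s01; rewrite normcM -/c.
      have rs := rseg w s rwh s01.
      have E : normc (seg z1 w s - z1) = c * s.
        have -> : seg z1 w s - z1 = s%:C * (w - z1) by rewrite /seg; ring.
        by rewrite normcM normc_real ger0_norm ?(andP s01).1// mulrC.
      have B : normc (\sum_q A p q (seg z1 w s) * D m q (seg z1 w s)) <=
          K * (V * 2^-1 ^+ m * expR (2 * K * c * s)).
        apply: le_trans (normc_sum _ _ _) _.
        apply: le_trans (_ : \sum_q normc (A p q (seg z1 w s)) *
            (V * 2^-1 ^+ m * expR (2 * K * c * s)) <= _).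
          apply: ler_sum => q _; rewrite normcM ler_wpM2l ?normc_ge0//.
          by have := IH q _ rs; rewrite E mulrA.
        by rewrite -mulr_suml ler_wpM2r ?mulr_ge0 ?expR_ge0// HK.
      apply: le_trans (ler_wpM2r c0 B) _; rewrite /M exprS le_eqVlt; apply/orP; left; apply/eqP.
      by field.
  have [L L0 HL] : exists2 L, 0 <= L & forall w, normc (w - z) < d' -> normc (w - z1) <= L.
    exists (d' + normc (z - z1)); first by rewrite addr_ge0 ?normc_ge0 ?ltW.
    by move=> w hw; apply: le_trans (normc_dist_triangle z _ _) _; rewrite lerD2r ltW.
  exists d', (V * expR (2 * K * L)); split => //; first by rewrite mulr_ge0 ?expR_ge0.
  move=> w hw m p; apply: le_trans (bD m p w (rw w hw)) _.
  rewrite mulrAC ler_wpM2r// ler_wpM2l// ler_expR ler_wpM2l ?mulr_ge0//; exact: HL.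
exists y; split; last first.
  move=> p z hz; have := (hy p z hz).2; apply: der_eq => //; by rewrite mul0r !add0r.
(* All terms but the first vanish at [z1]. *)
move=> p; apply: ccvg_unique (ccvg_shift (hy p z1 hz1).1) _.
have -> : (fun m => psum (fun m0 => D m0 p z1) m.+1) = (fun=> v p).
  apply/funext => m; rewrite /psum big_ord_recl big1 ?addr0// => i _ /=.
  exact: (hst (D i) (gD i) p).1.
exact: ccvg_cst.
Qed.

End Systems.

(** * Charts of the universal cover *)

Section Charts.
Variable R : realType.
Local Notation C := R[i].
Local Notation proj := Defs.proj.
Implicit Types (phi : R) (z w : R * R) (x y : C).

(** A complex coordinate on the points of the cover with argument within [pi / 2] of [phi]: it lifts
    [x |-> e^(i phi) x] from the right half-plane and sends vertical lines to the curves
    [ell phi b]. *)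
Definition chart phi x : R * R := ell phi (complex.Re x) (complex.Im x).

(** Defined everywhere, but inverse to [chart phi] only on points of the cover with argument within
    [pi / 2] of [phi]. *)
Definition unchart phi z : C := polar z.1 (z.2 - phi).

Lemma chart1 phi x : (chart phi x).1 = normc x.
Proof. by case: x. Qed.

Lemma hp0_gt0 x : hp 0 x -> 0 < normc x.
Proof. by move=> hx; apply: lt_le_trans (normc_Re x); rewrite normr_gt0 gt_eqF. Qed.

Lemma ucover_chart phi x : hp 0 x -> ucover (chart phi x).
Proof.
by move=> hx; change (is_true (0 < (chart phi x).1)); rewrite chart1 hp0_gt0.
Qed.

Lemma proj_chart phi x : hp 0 x -> proj (chart phi x) = polar 1 phi * x.
Proof. by case: x => b t; exact: proj_ell. Qed.

Lemma polar1N phi : polar 1 phi * polar 1 (- phi) = 1 :> C.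
Proof. by rewrite polarM mulr1 subrr /polar cos0 sin0 mulr1 mulr0. Qed.

Lemma chartK phi x : hp 0 x -> unchart phi (chart phi x) = x.
Proof.
move=> hx; have := proj_chart phi hx; rewrite /unchart /proj.
move=> /(congr1 (fun y => y * polar 1 (- phi))).
by rewrite polarM mulr1 => ->; rewrite mulrAC polar1N mul1r.
Qed.

Lemma Re_unchart phi z : complex.Re (unchart phi z) = z.1 * cos (z.2 - phi).
Proof. by []. Qed.

Lemma hp_unchart phi z : ucover z -> phi - pi / 2 < z.2 < phi + pi / 2 ->
  hp 0 (unchart phi z).
Proof.
move=> z0 /andP[h1 h2]; rewrite /hp Re_unchart mulr_gt0// cos_gt0_pihalf//.
by apply/andP; split; lra.
Qed.

Lemma unchartK phi z : ucover z -> phi - pi / 2 < z.2 < phi + pi / 2 ->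
  chart phi (unchart phi z) = z.
Proof.
case: z => r u /= r0 hu; rewrite /chart /ell /unchart /polar /=.
have h : - (pi / 2) < u - phi < pi / 2 by move: hu => /andP[? ?]; apply/andP; split; lra.
have c0 := cos_gt0_pihalf h.
rewrite /ucover /= in r0.
congr pair.
  by rewrite !exprMn -mulrDr cos2Dsin2 mulr1 sqrtr_sqr ger0_norm// ltW.
have -> : r * sin (u - phi) / (r * cos (u - phi)) = tan (u - phi).
  by rewrite /tan; field; rewrite !gt_eqF.
by rewrite tanK ?in_itv//= addrC subrK.
Qed.

Lemma chart_arg phi x : hp 0 x -> phi - pi / 2 < (chart phi x).2 < phi + pi / 2.
Proof.
by move=> _ /=; have /andP[h1 h2] := (atan_def (complex.Im x / complex.Re x)).1; apply/andP; split; lra.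
Qed.

Lemma chart_continuous phi x (e : R) : hp 0 x -> 0 < e -> exists2 d : R, 0 < d &
  forall y, normc (y - x) < d -> hp 0 y /\ ball (chart phi x) e (chart phi y).
Proof.
case: x => b t hx e0; rewrite /hp /= in hx.
have ct : {for ((b, t) : R * R), continuous (fun p : R * R => phi + atan (p.2 / p.1))}.
  apply: cvgD; first exact: cvg_cst.
  apply: (@continuous_comp _ _ _ (fun p : R * R => p.2 / p.1) (@atan R)); last exact: continuous_atan.
  apply: cvgM; first exact: cvg_snd.
  by apply: cvgV; [rewrite /= gt_eqF|exact: cvg_fst].
have /cvgrPdist_lt /(_ e e0) /nbhs_ballP[d /= d0 H] := ct.
exists (Num.min b (Num.min d e)); first by rewrite !lt_min hx d0.
case=> b' t'; rewrite !lt_min => /and3P[hb hd he].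
have h1 := normc_Re ((b' +i* t') - (b +i* t)); have h2 := normc_Im ((b' +i* t') - (b +i* t)).
rewrite /= in h1 h2.
split; first by have := le_lt_trans h1 hb; rewrite /hp /= ltr_norml => /andP[]; lra.
split => /=.
  apply: le_lt_trans he; rewrite distrC.
  exact: (ler_normc_sub (b' +i* t') (b +i* t)).
apply: (H (b', t')); split => /=; rewrite /ball /= distrC.
  exact: le_lt_trans h1 hd.
exact: le_lt_trans h2 hd.
Qed.

Lemma unchart_continuous phi z (e : R) : 0 < e -> exists2 d : R, 0 < d &
  forall w, ball z d w -> normc (unchart phi w - unchart phi z) <= e.
Proof.
move=> e0; have e2 : 0 < e / 2 by lra.
have c2 : {for z, continuous (fun p : R * R => p.2 - phi)}.
  by apply: cvgB; [exact: cvg_snd|exact: cvg_cst].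
have cc : {for z, continuous (fun p : R * R => p.1 * cos (p.2 - phi))}.
  apply: cvgM; first exact: cvg_fst.
  by apply: (@continuous_comp _ _ _ (fun p : R * R => p.2 - phi) (@cos R)) => //; exact: continuous_cos.
have cs : {for z, continuous (fun p : R * R => p.1 * sin (p.2 - phi))}.
  apply: cvgM; first exact: cvg_fst.
  by apply: (@continuous_comp _ _ _ (fun p : R * R => p.2 - phi) (@sin R)) => //; exact: continuous_sin.
have /cvgrPdist_le /(_ _ e2) /nbhs_ballP[d /= d0 H] := cc.
have /cvgrPdist_le /(_ _ e2) /nbhs_ballP[d' /= d'0 H'] := cs.
exists (Num.min d d'); first by rewrite lt_min d0.
move=> w hw; change (is_true (normc (unchart phi w - unchart phi z) <= e)).
apply: le_trans (normc_le_ReIm _) _.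
rewrite cReD cReN cImD cImN /= distrC [`|w.1 * sin _ - _|]distrC.
rewrite [e]splitr lerD//.
  by apply: H; apply: le_ball hw; rewrite ge_min lexx.
by apply: H'; apply: le_ball hw; rewrite ge_min lexx orbT.
Qed.

(** On the chart the increment of [proj] is [polar 1 phi] times that of the coordinate, whence the
    factor in the derivative. *)
Lemma cder_chart phi x (F : R * R -> C) l : hp 0 x -> is_cderiv F (chart phi x) l ->
  cder (fun y => F (chart phi y)) x (l * polar 1 phi).
Proof.
move=> hx; rewrite /is_cderiv => /(@cvgrPdist_le R[i] R[i]^o _ _ _ _ l) h e e0.
have p1 : normc (polar 1 phi : C) = 1 by rewrite normc_polar normr1.
have e0C : (0 : C) < e%:C by rewrite ltcR.
have := h _ e0C; rewrite /dnbhs /within /= => /nbhs_ballP[d /= d0 H].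
have [d' d'0 H'] := chart_continuous phi hx d0.
exists d' => // y /H'[hy /H]; have [->|yx] := eqVneq y x.
  by move=> _; rewrite !subrr mulr0 subrr normc0 mulr0.
have cyx : chart phi y != chart phi x.
  by apply: contra yx => /eqP E; rewrite -(chartK phi hx) -E chartK.
move=> /(_ cyx); rewrite !proj_chart// -mulrBr.
set q := polar 1 phi * (y - x).
have nq : normc q = normc (y - x) by rewrite normcM p1 mul1r.
have q0 : q != 0 by rewrite -normc_eq0 nq normc_eq0 subr_eq0.
change (`|l - (F (chart phi y) - F (chart phi x)) / q| <= e%:C ->
  normc (F (chart phi y) - F (chart phi x) - l * polar 1 phi * (y - x)) <= e * normc (y - x)).
rewrite -mulrA -/q -nq => H1.
have {}H1 : normc (l - (F (chart phi y) - F (chart phi x)) / q) <= e by rewrite -lecR.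
have -> : F (chart phi y) - F (chart phi x) - l * q =
  - ((l - (F (chart phi y) - F (chart phi x)) / q) * q) by field.
by rewrite normcN normcM ler_wpM2r ?normc_ge0.
Qed.

Lemma chart_cder phi x (F : R * R -> C) l : hp 0 x ->
  cder (fun y => F (chart phi y)) x (l * polar 1 phi) -> is_cderiv F (chart phi x) l.
Proof.
move=> hx h; rewrite /is_cderiv; apply/(@cvgrPdist_le R[i] R[i]^o _ _ _ _ l) => e e0C.
have p1 : normc (polar 1 phi : C) = 1 by rewrite normc_polar normr1.
have [e' e'0 eE] : exists2 e', 0 < e' & e = e'%:C.
  move: e0C; rewrite ltcE /= => /andP[/eqP h1 h2]; exists (complex.Re e) => //.
  by case: e h1 {h2} => ? ? /= ->.
have [d d0 H] := h _ e'0; have d2 : 0 < d / 2 by lra.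
have [d1 d10 H1] := unchart_continuous phi (chart phi x) d2.
have /andP[a1 a2] := chart_arg phi hx.
have u0 := ucover_chart phi hx.
rewrite /dnbhs /within /=; apply/nbhs_ballP.
(* Within this radius the modulus stays positive and the argument stays within [pi / 2] of [phi], so
   that every such point has a coordinate. *)
exists (Num.min d1 (Num.min (normc x) (Num.min ((chart phi x).2 - (phi - pi / 2)) (phi + pi / 2 - (chart phi x).2)))) => /=.
  by rewrite !lt_min d10 hp0_gt0// !subr_gt0 a1.
move=> w hw wx.
have hw1 : ball (chart phi x) d1 w by apply: le_ball hw; rewrite ge_min lexx.
have [uw aw] : ucover w /\ phi - pi / 2 < w.2 < phi + pi / 2.
  case: hw; rewrite /ball /= -/(chart phi x).1 -/(chart phi x).2 !lt_min.
  move=> /and4P[_ b1 _ _] /and4P[_ _ b2 b3]; split.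
    move: b1; rewrite -(chart1 phi x) ltr_norml /ucover /= => /andP[]; lra.
  by move: b2 b3; rewrite !ltr_norml => /andP[? ?] /andP[? ?]; apply/andP; split; lra.
have hy := hp_unchart uw aw; have wE := unchartK uw aw.
set y := unchart phi w in hy wE; rewrite -wE !proj_chart// -mulrBr.
have yx : normc (y - x) < d.
  by have := H1 w hw1; rewrite chartK// -/y; lra.
have := H y yx; set q := polar 1 phi * (y - x).
have nq : normc q = normc (y - x) by rewrite normcM p1 mul1r.
have q0 : q != 0.
  rewrite -normc_eq0 nq normc_eq0 subr_eq0; apply: contra wx => /eqP E.
  by rewrite -wE E.
rewrite -mulrA -/q -nq => {}H.
have : normc (l - (F (chart phi y) - F (chart phi x)) / q) <= e'.
  rewrite -(@ler_pM2r _ (normc q)) ?normc_gt0// -normcM; apply: le_trans H.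
  rewrite -normcN le_eqVlt; apply/orP; left; apply/eqP; congr normc.
  by rewrite /=; field.
by rewrite eE -lecR.
Qed.

(** Continuity of a branch of the logarithm is enough: with [k = L y - L x] one has [e^k = y / x],
    and [e^k - 1 - k] is negligible against [k]. *)
Lemma cder_log (L : C -> C) (c x : C) : x != 0 -> c != 0 ->
  (forall e : R, 0 < e -> exists2 d : R, 0 < d & forall y, normc (y - x) < d ->
     expc (L y) = c * y /\ normc (L y - L x) <= e) ->
  cder L x x^-1.
Proof.
move=> x0 c0 hL e e0.
have nx : 0 < normc x by rewrite normc_gt0.
(* The bound 1/2 gives [|k| <= 2 |y - x| / |x|]; the other one brings [2 e' / |x|] below [e]. *)
pose e' := Num.min 2^-1 (e * normc x / 2).
have e'0 : 0 < e' by rewrite lt_min invr_gt0 ltr0Sn /= divr_gt0// mulr_gt0.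
have [d1 d10 H1] := cder_expc 0 e'0; have d12 : 0 < d1 / 2 by lra.
have [d d0 H] := hL _ d12; exists d; first exact: d0.
move=> y /H[Ey hd].
have [d2 d20 /(_ x)] := hL 1 ltr01; rewrite subrr normc0 => /(_ d20)[Ex _].
set k := L y - L x in hd *.
have Ek : expc k = y / x.
  have : expc (L y) = expc (L x) * expc k by rewrite -expcD /k addrC subrK.
  by rewrite Ey Ex => E; apply: (mulfI (mulf_neq0 c0 x0)); rewrite -E; field.
have := H1 k; rewrite /= subr0 => /(_ _); rewrite expc0 mul1r Ek.
have kd : normc k < d1 by lra.
move=> /(_ kd).
have -> : y / x - 1 - k = - (k - x^-1 * (y - x)) by field.
rewrite normcN; set q := k - _ => hq.
have e1 : e' <= 2^-1 by rewrite ge_min lexx.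
have e2 : e' <= e * normc x / 2 by rewrite ge_min lexx orbT.
have hk : normc k <= 2 * normc (x^-1 * (y - x)).
  have := le_normcD q (x^-1 * (y - x)); rewrite subrK.
  have := ler_wpM2r (normc_ge0 k) e1; lra.
change (is_true (normc q <= e * normc (y - x))).
apply: le_trans hq _; apply: le_trans (ler_wpM2l (ltW e'0) hk) _.
rewrite normcM normcV.
have B : 0 <= 2 * ((normc x)^-1 * normc (y - x)).
  by rewrite mulr_ge0// mulr_ge0 ?invr_ge0 ?normc_ge0.
apply: le_trans (ler_wpM2r B e2) _; rewrite le_eqVlt; apply/orP; left; apply/eqP.
by field; rewrite gt_eqF.
Qed.

(** A logarithm of [polar 1 phi * x], single-valued because the argument is a coordinate of the
    cover. *)
Definition clog phi x : C := ln (chart phi x).1 +i* (chart phi x).2.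

Lemma expc_clog phi x : hp 0 x -> expc (clog phi x) = polar 1 phi * x.
Proof.
move=> hx; rewrite -proj_chart// /expc /clog /proj /= -/(chart phi x) lnK//.
by rewrite posrE; exact: ucover_chart.
Qed.

Lemma cder_clog phi x : hp 0 x -> cder (clog phi) x x^-1.
Proof.
move=> hx; have nx := hp0_gt0 hx.
apply: (@cder_log _ (polar 1 phi)).
- by rewrite -normc_gt0.
- by rewrite -normc_gt0 normc_polar normr1.
move=> e e0; have e2 : 0 < e / 2 by lra.
have cl := continuous_ln nx.
have /cvgrPdist_le /(_ _ e2) /nbhs_ballP[d /= d0 H] := cl.
have de : 0 < Num.min d (e / 2) by rewrite lt_min d0.
have [d' d'0 H'] := chart_continuous phi hx de.
exists d' => // y /H'[hy [b1 b2]]; split; first exact: expc_clog.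
change (is_true (normc (clog phi y - clog phi x) <= e)).
apply: le_trans (normc_le_ReIm _) _; rewrite cReD cReN cImD cImN.
rewrite [e]splitr lerD//.
  rewrite distrC [complex.Re _]/= [complex.Re (clog phi y)]/=.
  rewrite -![Num.sqrt _]/((chart phi _).1).
  have := b1; rewrite !chart1 => h.
  have := H (normc y); rewrite /= => {}H.
  have hb : ball (normc x) d (normc y) by apply: le_ball h; rewrite ge_min lexx.
  have := H hb; case: (x) (y) => [? ?] [? ?]; exact.
by rewrite distrC ltW//; apply: lt_le_trans b2 _; rewrite ge_min lexx orbT.
Qed.

Lemma zpow_chart phi x s : hp 0 x -> zpow (chart phi x) s = expc (s%:C * clog phi x).
Proof.
move=> hx; rewrite /zpow /expc /clog cReM cImM /= !mul0r subr0 addr0.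
by rewrite /powR -/(chart phi x).1 gt_eqF//; exact: ucover_chart.
Qed.

Lemma cder_zpow phi x s : hp 0 x -> cder (fun y => zpow (chart phi y) s) x
  (s%:C * zpow (chart phi x) (s - 1) * polar 1 phi).
Proof.
move=> hx.
have := der_comp (derMc s%:C (cder_clog phi hx)) (cder_expc (s%:C * clog phi x)).
have [d d0 H] := hp_open hx.
move=> /(der_local d0) h; have {}h := h _ (fun y hy => esym (zpow_chart phi s (H y hy))).
apply: der_eq h => //; rewrite !zpow_chart//.
have -> : expc (s%:C * clog phi x) = expc ((s - 1)%:C * clog phi x) * (polar 1 phi * x).
  by rewrite -expc_clog// -expcD; congr expc; rewrite rmorphB rmorph1; ring.
have x0 : x != 0 by rewrite -normc_gt0 hp0_gt0.
by field.
Qed.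

End Charts.

(** * Norms and fundamental matrices *)

Section FiniteDimension.
Variables (R : realType) (V : lmodType R[i]) (N : V -> R).
Local Notation C := R[i].
Hypothesis ND : forall u v, N (u + v) <= N u + N v.
Hypothesis NZ : forall (c : C) u, N (c *: u) = normc c * N u.
Hypothesis N_eq0 : forall u, N u = 0 -> u = 0.

Lemma seminorm0 : N 0 = 0.
Proof. by rewrite -(scale0r 0) NZ normc0 mul0r. Qed.

Lemma seminormN u : N (- u) = N u.
Proof. by rewrite -scaleN1r NZ normcN normc1 mul1r. Qed.

Lemma seminorm_ge0 u : 0 <= N u.
Proof. by have := ND u (- u); rewrite subrr seminorm0 seminormN; lra. Qed.

Lemma seminorm_sum (I : Type) (s : seq I) (x : I -> C) (e : I -> V) :
  N (\sum_(i <- s) x i *: e i) <= \sum_(i <- s) normc (x i) * N (e i).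
Proof.
elim/big_ind2 : _ => [|u v u' v' h h'|i _]; first by rewrite seminorm0.
  exact: le_trans (ND _ _) (lerD h h').
by rewrite NZ.
Qed.

(** Induction on the free family. The point is that [- e j] is at a positive distance from the span
    of the others: combinations approaching it would have Cauchy coordinates by induction, and their
    limits would give a linear relation. Dividing by [x j] bounds that coordinate, and subtracting
    [x j *: e j] leaves the others to the induction hypothesis. *)
Lemma norm_coord_bound (I : eqType) (s : seq I) (e : I -> V) : uniq s ->
  (forall x : I -> C, \sum_(i <- s) x i *: e i = 0 -> forall i, i \in s -> x i = 0) ->
  exists2 c : R, 0 <= c & forall (x : I -> C) i, i \in s ->
    normc (x i) <= c * N (\sum_(i <- s) x i *: e i).
Proof.
elim: s => [_ _|j s IH]; first by exists 0.
rewrite /= => /andP[js us] free.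
have neqj i : i \in s -> i == j = false.
  by move=> si; apply: contraNF js => /eqP <-.
have [|c' c'0 hc'] := IH us.
  move=> x x0 i si; pose y k := if k == j then 0 else x k.
  have <- : y i = x i by rewrite /y neqj.
  apply: (free y); last by rewrite inE si orbT.
  rewrite big_cons /y eqxx scale0r add0r -[RHS]x0.
  by apply: eq_big_seq => k ks; rewrite neqj.
pose B := \sum_(i <- s) N (e i).
have B0 : 0 <= B by apply: sumr_ge0 => *; exact: seminorm_ge0.
pose w (x : I -> C) := e j + \sum_(i <- s) x i *: e i.
have [d d0 hd] : exists2 d, 0 < d & forall x, d <= N (w x).
  apply: contrapT => /forall2NP H.
  have /choice[x hx] : forall k : nat, exists x, N (w x) <= k.+1%:R^-1.
    move=> k; have [/negP|] := H k.+1%:R^-1; first by rewrite invr_gt0 ltr0Sn.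
    by move=> /existsNP[x /negP]; rewrite -ltNge => /ltW ?; exists x.
  have small (r : R) : 0 < r -> exists K, forall k, (K <= k)%N -> k.+1%:R^-1 <= r.
    move=> r0; exists (Num.bound r^-1) => k hk.
    rewrite -(invrK r) lef_pV2 ?posrE ?invr_gt0 ?ltr0Sn//.
    apply/ltW; apply: lt_le_trans (archi_boundP _) _; first by rewrite invr_ge0 ltW.
    by rewrite ler_nat ltnW.
  have /choice[y hy] : forall i, exists y, i \in s -> ccvg (fun k => x k i) y.
    move=> i; have [si|] := boolP (i \in s); last by exists 0.
    suff [y hy] : exists y, ccvg (fun k => x k i) y by exists y.
    apply: ccauchy => r r0.
    have c1 : 0 < 2 * (c' + 1) by rewrite mulr_gt0// ltr_wpDl.
    have [K hK] := small _ (divr_gt0 r0 c1); exists K => m k hm hk.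
    apply: le_trans (hc' (fun i => x m i - x k i) i si) _.
    have -> : \sum_(i <- s) (x m i - x k i) *: e i = w (x m) - w (x k).
      rewrite /w opprD addrACA subrr add0r -sumrB.
      by apply: eq_bigr => *; rewrite scalerBl.
    have := ND (w (x m)) (- w (x k)); rewrite seminormN => h.
    have h1 := le_trans (hx m) (hK m hm); have h2 := le_trans (hx k) (hK k hk).
    have h3 : N (w (x m) - w (x k)) <= 2 * (r / (2 * (c' + 1))) by lra.
    apply: le_trans (ler_wpM2l c'0 h3) _.
    have -> : c' * (2 * (r / (2 * (c' + 1)))) = r * (c' / (c' + 1)).
      by field; rewrite gt_eqF// ltr_wpDl.
    by rewrite ler_piMr ?(ltW r0)// ler_pdivrMr ?ltr_wpDl// mul1r lerDl.
  have N0 : N (w y) = 0.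
    apply/eqP; rewrite eq_le seminorm_ge0 andbT; apply/ler_addgt0Pr => r r0; rewrite add0r.
    have B1 : 0 < 2 * (B + 1) by rewrite mulr_gt0// ltr_wpDl.
    have /choice[K hK] : forall i, exists K, i \in s -> forall k, (K <= k)%N ->
        normc (x k i - y i) <= r / (2 * (B + 1)).
      move=> i; have [si|] := boolP (i \in s); last by exists 0%N.
      by have [K hK] := hy i si _ (divr_gt0 r0 B1); exists K.
    have r2 : 0 < r / 2 by rewrite divr_gt0.
    have [K' hK'] := small _ r2.
    (* An index beyond [K'] and the finitely many thresholds [K i]. *)
    pose k := (K' + \sum_(i <- s) K i)%N.
    have -> : w y = w (x k) + \sum_(i <- s) (y i - x k i) *: e i.
      by rewrite /w -addrA -big_split /=; congr (_ + _); apply: eq_bigr => i _; rewrite scalerBl addrC subrK.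
    apply: le_trans (ND _ _) _; rewrite [r]splitr; apply: lerD.
      by apply: le_trans (hx k) _; apply: hK'; rewrite leq_addr.
    apply: le_trans (seminorm_sum _ _ _) _.
    apply: (@le_trans _ _ (\sum_(i <- s) r / (2 * (B + 1)) * N (e i))).
      rewrite big_seq [leRHS]big_seq; apply: ler_sum => i si.
      rewrite ler_wpM2r ?seminorm_ge0// normc_distC; apply: hK => //.
      by rewrite /k (big_rem i)//= addnCA leq_addr.
    rewrite -mulr_sumr -/B.
    have -> : r / (2 * (B + 1)) * B = r / 2 * (B / (B + 1)).
      by field; rewrite gt_eqF// ltr_wpDl.
    by rewrite ler_piMr ?(ltW r2)// ler_pdivrMr ?ltr_wpDl// mul1r lerDl.
  have y0 : \sum_(i <- j :: s) (if i == j then 1 else y i) *: e i = 0.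
    rewrite big_cons eqxx scale1r; transitivity (w y); last exact: N_eq0.
    congr (_ + _).
    by apply: eq_big_seq => i si; rewrite neqj.
  by have /eqP := free _ y0 j (mem_head _ _); rewrite eqxx oner_eq0.
have ej : 0 <= N (e j) by exact: seminorm_ge0.
exists (d^-1 + c' * (1 + d^-1 * N (e j))).
  by rewrite addr_ge0 ?invr_ge0 ?(ltW d0)// mulr_ge0// addr_ge0// mulr_ge0// invr_ge0 (ltW d0).
move=> x i; rewrite inE; set T := N (\sum_(i0 <- j :: s) x i0 *: e i0); have T0 : 0 <= T by exact: seminorm_ge0.
have xj : normc (x j) <= d^-1 * T.
  rewrite ler_pdivlMl// /T; have [->|xj0] := eqVneq (x j) 0.
    by rewrite normc0 mulr0 seminorm_ge0.
  have -> : \sum_(i <- j :: s) x i *: e i = x j *: w (fun i => (x j)^-1 * x i).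
    rewrite big_cons /w scalerDr; congr (_ + _); rewrite scaler_sumr.
    by apply: eq_bigr => k _; rewrite scalerA mulrA divff// mul1r.
  by rewrite NZ mulrC ler_wpM2l ?normc_ge0.
have dT : 0 <= d^-1 * T by rewrite mulr_ge0// invr_ge0 (ltW d0).
have P1 : 0 <= d^-1 * N (e j) * T by rewrite mulr_ge0// mulr_ge0// invr_ge0 (ltW d0).
case/predU1P => [->|si].
  by apply: le_trans xj _; rewrite ler_wpM2r// lerDl mulr_ge0// addr_ge0// mulr_ge0// invr_ge0 (ltW d0).
apply: le_trans (hc' x i si) _.
have h : N (\sum_(i <- s) x i *: e i) <= T + d^-1 * T * N (e j).
  have -> : \sum_(i <- s) x i *: e i = \sum_(i <- j :: s) x i *: e i - x j *: e j.
    by rewrite big_cons addrAC subrr add0r.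
  apply: le_trans (ND _ _) _; rewrite seminormN NZ lerD2l.
  by rewrite ler_wpM2r.
apply: le_trans (ler_wpM2l c'0 h) _; lra.
Qed.

End FiniteDimension.

Section Matrices.
Variables (R : realType) (n : nat).
Local Notation C := R[i].
Implicit Types (A B E : 'M[C]_n).

Variable N : 'M[C]_n -> R.
Hypothesis hN : is_mxnorm N.

Lemma mxnorm_le : exists2 c : R, 0 <= c & forall A (e : R),
  (forall p q, normc (A p q) <= e) -> N A <= c * e.
Proof.
case: hN => hD hZ h0; exists (\sum_p \sum_q N (delta_mx p q)).
  by do 2!(apply: sumr_ge0 => ? _); exact: (seminorm_ge0 hD hZ).
move=> A e he; rewrite {1}(matrix_sum_delta A) pair_bigA [in leRHS]pair_bigA /=.
apply: le_trans (seminorm_sum hD hZ _ _ _) _.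
rewrite mulr_suml; apply: ler_sum => -[p q] _ /=; rewrite mulrC.
by rewrite ler_wpM2l//; exact: (seminorm_ge0 hD hZ).
Qed.

(** The matrix units are a free family. Together with [mxnorm_le], this makes convergence in the
    arbitrary norm [N] the same as convergence of the entries. *)
Lemma le_mxnorm : exists2 c : R, 0 <= c & forall A p q, normc (A p q) <= c * N A.
Proof.
case: hN => hD hZ h0.
have E (x : 'I_n * 'I_n -> C) : \sum_(i <- enum {: 'I_n * 'I_n}) x i *: delta_mx i.1 i.2 =
    \matrix_(p, q) x (p, q) :> 'M[C]_n.
  rewrite big_enum /= [RHS]matrix_sum_delta pair_bigA /=; apply: eq_bigr => -[p q] _ /=.
  by rewrite mxE.
have [||c c0 hc] := @norm_coord_bound R _ N hD hZ h0 _ (enum {: 'I_n * 'I_n}) (fun i => delta_mx i.1 i.2).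
- exact: enum_uniq.
- by move=> x; rewrite E => /matrixP h [p q] _; have := h p q; rewrite !mxE.
exists c => // A p q; have := hc (fun i => A i.1 i.2) (p, q) (mem_enum _ _).
rewrite E /= => h; apply: le_trans h _; rewrite le_eqVlt; apply/orP; left; apply/eqP.
by congr (_ * N _); apply/matrixP => i j; rewrite mxE.
Qed.

(** A left kernel vector satisfies [v = - v E], so the sum of the moduli of its entries would be at
    most [n d < 1] times itself. *)
Lemma mx1_perturb_unit E (d : R) : n%:R * d < 1 ->
  (forall p q, normc (E p q) <= d) -> 1%:M + E \in unitmx.
Proof.
move=> nd hE; rewrite unitmxE unitfE; apply/negP => /eqP/eqP/det0P[v v0].
rewrite mulmxDr mulmx1 => vE.
pose S := \sum_j normc (v 0 j).
have S0 : 0 < S.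
  rewrite lt_neqAle sumr_ge0 ?andbT => [|j _]; last exact: normc_ge0.
  apply: contra v0 => /eqP/esym S0; apply/eqP/matrixP => i j; rewrite ord1 !mxE.
  apply/eqP; rewrite -normc_eq0; apply/eqP.
  by have /psumr_eq0P := S0; apply => // k _; exact: normc_ge0.
have : S <= n%:R * d * S.
  apply: (@le_trans _ _ (\sum_(j < n) d * S)); last first.
    by rewrite sumr_const card_ord -[leLHS]mulr_natl mulrA.
  apply: ler_sum => j _.
  have /matrixP /(_ 0 j) : v = - (v *m E) by apply/eqP; rewrite -addr_eq0 vE.
  rewrite !mxE => {1}->; rewrite normcN.
  apply: le_trans (normc_sum _ _ _) _; rewrite /S mulr_sumr; apply: ler_sum => k _.
  by rewrite normcM mulrC ler_wpM2r ?normc_ge0.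
by rewrite leNgt -[ltRHS]mul1r ltr_pM2r// nd.
Qed.

Lemma exp_diagN (d : 'rV[C]_n) : exp_diag d *m exp_diag (- d) = 1%:M.
Proof.
rewrite /exp_diag mulmx_diag; apply/matrixP => p q; rewrite !mxE expcNK.
by case: eqP.
Qed.

Lemma exp_diagNK (d : 'rV[C]_n) : exp_diag (- d) *m exp_diag d = 1%:M.
Proof. by have := exp_diagN (- d); rewrite opprK. Qed.

(* The matrix [E] in [Y = (1 + E) exp Q]. *)
Definition twist (q : R * R -> 'rV[C]_n) (Y : R * R -> 'M[C]_n) z : 'M[C]_n :=
  Y z *m exp_diag (- q z) - 1%:M.

(** Since [exp_diag] is invertible, the remainder [E] is forced to be [twist q Y] far out, and the
    condition becomes one on its entries, free of [N]. *)
Lemma exp_behaviourP (q : R * R -> 'rV[C]_n) (Y : R * R -> 'M[C]_n) (S : set (R * R)) :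
  exp_behaviour N q Y S <-> forall e : R, 0 < e -> exists M, forall z, S z -> M < z.1 ->
    forall p p', normc (twist q Y z p p') <= e.
Proof.
have [c c0 hc] := le_mxnorm; have [c' c'0 hc'] := mxnorm_le.
split.
  move=> [E [[M HM]]] /cvgrPdist_le hE e e0.
  have ec : 0 < e / (c + 1) by rewrite divr_gt0// ltr_wpDl.
  have [M' HM'] := hE _ ec; exists (Num.max M M') => z Sz; rewrite gt_max => /andP[zM zM'].
  move=> p p'; have -> : twist q Y z = E z.
    by rewrite /twist HM// -mulmxA exp_diagN mulmx1 addrC addKr.
  apply: le_trans (hc _ _ _) _.
  have := HM' z Sz zM'; rewrite sub0r normrN => /(le_trans (ler_norm _)).
  rewrite ler_pdivlMr ?ltr_wpDl// => h; apply: le_trans h; rewrite mulrC ler_wpM2l ?lerDl//.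
  by case: hN => hD hZ _; exact: (seminorm_ge0 hD hZ).
move=> H; exists (twist q Y); split.
  exists 0 => z _ _; rewrite /twist addrC subrK -mulmxA exp_diagNK mulmx1//.
apply/cvgrPdist_le => e e0; have ec : 0 < e / (c' + 1) by rewrite divr_gt0// ltr_wpDl.
have [M HM] := H _ ec; exists M => z Sz zM; rewrite sub0r normrN ger0_norm; last first.
  by case: hN => hD hZ _; exact: (seminorm_ge0 hD hZ).
apply: le_trans (hc' _ _ (HM z Sz zM)) _.
have -> : c' * (e / (c' + 1)) = e * (c' / (c' + 1)) by field; rewrite gt_eqF// ltr_wpDl.
by rewrite ler_piMr ?(ltW e0)// ler_pdivrMr ?ltr_wpDl// mul1r lerDl.
Qed.

End Matrices.

(** * Fundamental matrices and their inverses *)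

Section Fundamental.
Variables (R : realType) (n : nat).
Local Notation C := R[i].
Implicit Types (A : C -> 'M[C]_n).

Definition mxder (F : C -> 'M[C]_n) z (L : 'M[C]_n) :=
  forall p q, cder (fun w => F w p q) z (L p q).

Lemma mxderM (F G : C -> 'M[C]_n) z L M : mxder F z L -> mxder G z M ->
  mxder (fun w => F w *m G w) z (L *m G z + F z *m M).
Proof.
move=> hF hG p q.
have := @der_sum _ _ id z _ (enum 'I_n) (fun k w => F w p k * G w k q) _
  (fun k => derM (hF p k) (hG k q)).
apply: der_eq => [w|]; first by rewrite mxE big_enum.
by rewrite !mxE big_enum /= -big_split.
Qed.

Lemma mxder_cst z (B : 'M[C]_n) : mxder (fun=> B) z 0.
Proof. by move=> p q; rewrite mxE; exact: der_cst. Qed.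

Lemma mxder_const (F : C -> 'M[C]_n) z w :
  (forall s, 0 <= s <= 1 -> mxder F (seg z w s) 0) -> F w = F z.
Proof.
move=> h; apply/matrixP => p q.
by apply: (@cder_const R (fun z => F z p q)) => s /h /(_ p q); rewrite mxE.
Qed.

(** [Z] solves the adjoint equation, so [Z W] is constant and equal to 1. Thus [W] comes with an
    explicit inverse, and any other solution [Y] makes [Z Y] constant. *)
Lemma fundamental_system (a : R) A z1 : hp a z1 ->
  (forall z, hp a z -> exists L, mxder A z L) ->
  exists W Z, [/\ W z1 = 1%:M, forall z, hp a z -> mxder W z (A z *m W z),
    forall z, hp a z -> mxder Z z (- (Z z *m A z)) &
    forall z, hp a z -> Z z *m W z = 1%:M].
Proof.
move=> hz1 dA.
have dA1 p q z : hp a z -> exists l, cder (fun w => A w p q) z l.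
  by move=> /dA[L hL]; exists (L p q); exact: hL.
have dA2 p q z : hp a z -> exists l, cder (fun w => - A w q p) z l.
  move=> /dA[L hL]; exists (- 1 * L q p); apply: der_eq (derMc (-1) (hL q p)) => // y.
  by rewrite mulN1r.
have /choice[W hW] : forall j, exists y : 'I_n -> C -> C, (forall p, y p z1 = (p == j)%:R) /\
    forall p z, hp a z -> cder (y p) z (\sum_q A z p q * y q z).
  by move=> j; exact: (linear_ode (fun p => (p == j)%:R) hz1 dA1).
have /choice[Z hZ] : forall j, exists y : 'I_n -> C -> C, (forall p, y p z1 = (p == j)%:R) /\
    forall p z, hp a z -> cder (y p) z (\sum_q (- A z q p) * y q z).
  by move=> j; exact: (linear_ode (fun p => (p == j)%:R) hz1 dA2).
pose Wm z : 'M[C]_n := \matrix_(p, j) W j p z.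
pose Zm z : 'M[C]_n := \matrix_(j, p) Z j p z.
have dW z : hp a z -> mxder Wm z (A z *m Wm z).
  move=> hz p j; apply: der_eq ((hW j).2 p z hz) => [w|]; first by rewrite mxE.
  by rewrite mxE; apply: eq_bigr => k _; rewrite mxE.
have dZ z : hp a z -> mxder Zm z (- (Zm z *m A z)).
  move=> hz j p; apply: der_eq ((hZ j).2 p z hz) => [w|]; first by rewrite mxE.
  by rewrite !mxE -sumrN; apply: eq_bigr => k _; rewrite mxE mulrC mulrN.
exists Wm, Zm; split => //.
  by apply/matrixP => p q; rewrite !mxE (hW q).1.
move=> z hz.
have -> : Zm z *m Wm z = Zm z1 *m Wm z1.
  apply: (@mxder_const (fun z => Zm z *m Wm z)) => s s01.
  have hs := hp_seg hz1 hz s01.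
  have := mxderM (dZ _ hs) (dW _ hs).
  by rewrite mulmxA mulNmx addNr.
have -> : Wm z1 = 1%:M by apply/matrixP => p q; rewrite !mxE (hW q).1.
rewrite mulmx1; apply/matrixP => p q; rewrite !mxE (hZ p).1 eq_sym//.
Qed.

End Fundamental.

(** * Arc-length integrals along lines *)

Lemma continuous_bigsum (R : realType) (I : Type) (s : seq I) (g : I -> R -> R) :
  (forall i, continuous (g i)) -> continuous (fun t => \sum_(i <- s) g i t).
Proof.
move=> h; elim: s => [|i s IH].
  rewrite (_ : (fun _ => _) = fun=> 0); first exact: cst_continuous.
  by apply/funext => t; rewrite big_nil.
rewrite (_ : (fun _ => _) = fun t => g i t + \sum_(j <- s) g j t); last first.
  by apply/funext => t; rewrite big_cons.
by move=> t; apply: cvgD; [exact: h|exact: IH].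
Qed.

Lemma integral_rho (R : realType) (r : R -> R) : continuous r -> (forall t, 0 <= r t) ->
  lebesgue_measure.-integrable setT (EFin \o r) ->
  exists rho : R -> R, forall t, rderR rho t (r t) /\
    0 <= rho t <= fine (\int[lebesgue_measure]_t (r t)%:E)%E.
Proof.
move=> cr r0 ir; exists (fun t => (\int[lebesgue_measure]_(u in `]-oo, t]) r u)%R) => t.
have iS x : lebesgue_measure.-integrable `]-oo, x] (EFin \o r).
  exact: integrableS ir.
split.
  have [||||d1 d2] := @continuous_FTC1 R r -oo%O t (t + 1).
  - by rewrite ltrDl.
  - exact: iS.
  - by rewrite ltNyr.
  - exact: cr.
  rewrite derive1E in d2; apply: is_derive_rder; exact: (DeriveDef d1 d2).
have pos A : (0 <= \int[lebesgue_measure]_(u in A) (r u)%:E)%E.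
  by apply: integral_ge0 => x _; rewrite lee_fin.
apply/andP; split; first by rewrite /Rintegral fine_ge0.
rewrite /Rintegral; apply: fine_le.
- exact: integrable_fin_num (iS t).
- exact: integrable_fin_num ir.
apply: ge0_subset_integral => //.
- exact: (measurable_int _ ir).
- by move=> x _; rewrite lee_fin.
Qed.

Section Lines.
Variables (R : realType) (n : nat).
Local Notation C := R[i].
Variables (N : 'M[C]_n -> R) (a : R) (Rp : R * R -> 'M[C]_n).
Hypothesis hN : is_mxnorm N.
Hypothesis a_gt0 : 0 < a.
Hypothesis Rp_holo : mx_holomorphic (outer a) Rp.
Hypothesis Rp_decay : forall I : set R, open I -> is_interval I -> good_decay N a Rp I.

Lemma outer_chart phi z : hp a z -> outer a (chart phi z).
Proof.
move=> hz; have h0 : hp 0 z by exact: lt_trans hz.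
split; first exact: ucover_chart.
by rewrite chart1; apply: lt_le_trans hz _; apply: le_trans (ler_norm _) (normc_Re _).
Qed.

Lemma cder_perturbation phi p q z : hp a z ->
  exists l, cder (fun y => Rp (chart phi y) p q) z l.
Proof.
move=> hz; have [L hL] := Rp_holo (outer_chart phi hz).
eexists; apply: (cder_chart (F := fun w => Rp w p q) _ (hL p q)).
exact: lt_trans hz.
Qed.

(** The entries are summed because the result is continuous in [t], hence the derivative of its
    integral at every point, dominates each row sum, and is bounded by a multiple of [N]. *)
Definition line_norm phi b t : R :=
  \sum_p \sum_q normc (Rp (chart phi (b +i* t)) p q).

Lemma continuous_line_norm phi b : a < b -> continuous (line_norm phi b).
Proof.
move=> ab; apply: continuous_bigsum => p; apply: continuous_bigsum => q.
apply: eps_continuous => s e e0.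
have [l hl] := cder_perturbation phi p q (ab : hp a (b +i* s)).
have [d d0 H] := der_cont (der_comp (rder_vert b s) hl) e0.
exists d => // y ys; apply: le_trans (ler_normc_sub _ _) _; apply: H.
by rewrite -rmorphB normc_real.
Qed.

(** The decay condition is invoked for the whole line and the closed interval [[c, d]]; the supremum
    over its directions makes the threshold [B] independent of [phi]. Here [eps phi b] is the
    integral of [line_norm], and [rho phi b] its primitive from the lower end. *)
Lemma line_decay (c d : R) : c <= d -> exists rho (eps : R -> R -> R),
  (forall phi b, c <= phi <= d -> a < b -> forall t,
     rderR (rho phi b) t (line_norm phi b t) /\ 0 <= rho phi b t <= eps phi b) /\
  forall e : R, 0 < e -> exists2 B, a <= B & forall phi b, c <= phi <= d -> B < b ->
    eps phi b <= e.
Proof.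
move=> cd.
have iT : is_interval (setT : set R) by [].
have Jcd : is_closed_interval `[c, d]%classic by exists c, d.
have [intN supN] := Rp_decay openT iT Jcd (@subsetT _ _).
have [k k0 hk] := le_mxnorm hN.
have N0 A : 0 <= N A by case: hN => hD hZ _; exact: (seminorm_ge0 hD hZ).
pose K := n%:R * (n%:R * k).
have K0 : 0 <= K by rewrite !mulr_ge0.
have rN phi b t : line_norm phi b t <= K * N (Rp (ell phi b t)).
  rewrite /line_norm; apply: (@le_trans _ _ (\sum_(p < n) \sum_(q < n) k * N (Rp (ell phi b t)))).
    by apply: ler_sum => p _; apply: ler_sum => q _; exact: hk.
  set v := k * _; rewrite !sumr_const !card_ord -(mulr_natl (v *+ n)) -(mulr_natl v).
  by rewrite /K /v !mulrA.
have r0 phi b t : 0 <= line_norm phi b t.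
  by do 2!(apply: sumr_ge0 => ? _); exact: normc_ge0.
have mr phi b : a < b -> measurable_fun (setT : set (measurableTypeR R)) (line_norm phi b : R -> R).
  by move=> ab; apply: continuous_measurable_fun; exact: continuous_line_norm.
have iK phi b : c <= phi <= d -> a < b ->
    lebesgue_measure.-integrable setT (fun t => (K%:E * (N (Rp (ell phi b t)))%:E)%E).
  by move=> hphi ab; apply: integrableZl => //; apply: intN => //; rewrite /= in_itv.
have ir phi b : c <= phi <= d -> a < b ->
    lebesgue_measure.-integrable setT (EFin \o line_norm phi b).
  move=> hphi ab; apply: le_integrable (iK phi b hphi ab) => //; first by apply/measurable_EFinP; exact: mr.
  by move=> t _ /=; rewrite lee_fin normrM !ger0_norm.
have /choice[rho hrho] : forall pb : R * R, exists rho : R -> R, c <= pb.1 <= d -> a < pb.2 ->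
    forall t, rderR rho t (line_norm pb.1 pb.2 t) /\
    0 <= rho t <= fine (\int[lebesgue_measure]_t (line_norm pb.1 pb.2 t)%:E)%E.
  move=> [phi b] /=; have [/andP[hphi ab]|h] := boolP ((c <= phi <= d) && (a < b)).
    have [rho hrho] := integral_rho (continuous_line_norm (phi := phi) ab) (r0 phi b) (ir phi b hphi ab).
    by exists rho.
  by exists (fun=> 0) => h1 h2; rewrite h1 h2 in h.
exists (fun phi b => rho (phi, b)),
  (fun phi b => fine (\int[lebesgue_measure]_t (line_norm phi b t)%:E)%E); split.
  by move=> phi b hphi ab t; exact: (hrho (phi, b)).
move=> e e0; have eK : 0 < e / (K + 1) by rewrite divr_gt0// ltr_wpDl.
have [|B [_ HB]] := supN [set y | (y < (e / (K + 1))%:E)%E].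
  by apply: open_nbhs_nbhs; split; [exact: open_ereal_lt_ereal|rewrite /= lte_fin].
exists (Num.max a B); first by rewrite le_max lexx.
move=> phi b hphi; rewrite gt_max => /andP[ab /HB hb].
have iN := intN phi b.
have h1 : (\int[lebesgue_measure]_t (N (Rp (ell phi b t)))%:E <= (e / (K + 1))%:E)%E.
  apply: le_trans (ltW hb); apply: ereal_sup_ubound.
  by exists phi; [rewrite /= in_itv|].
have h2 : (\int[lebesgue_measure]_t (line_norm phi b t)%:E <=
    K%:E * \int[lebesgue_measure]_t (N (Rp (ell phi b t)))%:E)%E.
  rewrite -integralZl//; last by apply: intN => //; rewrite /= in_itv.
  apply: ge0_le_integral => //.
  - by move=> t _; rewrite lee_fin.
  - by apply/measurable_EFinP; exact: mr.
  - exact: (measurable_int _ (iK phi b hphi ab)).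
  - by move=> t _; rewrite lee_fin.
rewrite -lee_fin fineK; last exact: integrable_fin_num (ir phi b hphi ab).
apply: le_trans h2 _; apply: le_trans (lee_wpmul2l _ h1) _; first by rewrite lee_fin.
rewrite lee_fin (_ : K * _ = e * (K / (K + 1))); last by field; rewrite gt_eqF// ltr_wpDl.
by rewrite ler_piMr ?(ltW e0)// ler_pdivrMr ?ltr_wpDl// mul1r lerDl.
Qed.

End Lines.

(** * Stokes directions *)

Section Arguments.
Variable R : realType.
Local Notation C := R[i].
Implicit Types (w : C) (t eta : R).

Lemma polar_scale (s r t : R) : polar (s * r) t = s%:C * polar r t.
Proof. by rewrite /polar; apply/eqP; rewrite eq_complex /=; apply/andP; split; apply/eqP; ring. Qed.

Lemma polarDpi (r t : R) : polar r (t + pi) = polar (- r) t.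
Proof. by rewrite /polar cosDpi sinDpi !mulrN !mulNr. Qed.

Lemma polar_shift (m : int) : exists2 s : R, s = 1 \/ s = -1 &
  forall r t, polar r (t + m%:~R * pi) = polar (s * r) t.
Proof.
have H (k : nat) : exists2 s : R, s = 1 \/ s = -1 &
    forall r t, polar r (t + k%:R * pi) = polar (s * r) t.
  elim: k => [|k [s s1 IH]]; first by exists 1; [left|move=> r t; rewrite mul0r addr0 mul1r].
  exists (- s); first by case: s1 => ->; [right|left]; rewrite ?opprK.
  by move=> r t; rewrite -natr1 mulrDl mul1r addrA polarDpi IH mulrN mulNr.
case: m => k; first exact: H.
have [s s1 Hs] := H k.+1; exists s => // r t; rewrite NegzE mulrNz mulNr.
have ss : s * s = 1 by case: s1 => ->; ring.
rewrite -[in RHS](subrK (k.+1%:R * pi) t) Hs mulrA ss mul1r.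
by [].
Qed.

Lemma arg_exists w : w != 0 -> exists t, is_arg w t.
Proof.
have pos (x : C) : hp 0 x -> is_arg x (chart 0 x).2.
  move=> hx; rewrite /is_arg -(chart1 0 x); have := proj_chart 0 hx.
  by rewrite /Defs.proj => ->; rewrite /polar cos0 sin0 mulr1 mulr0 mul1r.
case: w => x y w0; have [x0|x0|x0] := ltgtP 0 x.
- by eexists; apply: pos; rewrite /hp.
- have x1 : hp 0 (- (x +i* y)) by rewrite /hp /= oppr_gt0.
  have := pos _ x1; rewrite /is_arg normcN; set t := (chart _ _).2 => H.
  exists (t + pi); rewrite polarDpi -mulN1r polar_scale -H rmorphN1 mulN1r.
  by rewrite opprK.
rewrite -x0 in w0 *.
have [y0|y0] := leP 0 y.
  exists (pi / 2); rewrite /is_arg /polar cos_pihalf sin_pihalf /normc expr0n add0r sqrtr_sqr ger0_norm//.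
  by rewrite mulr0 mulr1.
exists (- (pi / 2)); rewrite /is_arg /polar cosN sinN cos_pihalf sin_pihalf /normc expr0n add0r sqrtr_sqr ltr0_norm//.
by rewrite mulr0 mulrN mulr1 opprK.
Qed.

(** The integer part gives a half-open interval, and the hypothesis excludes its closed end. *)
Lemma reduce_mod_pi t eta : (forall m : int, eta <> t + m%:~R * pi) ->
  exists m : int, eta - pi < t + m%:~R * pi < eta.
Proof.
move=> h; have p0 : 0 < pi :> R by exact: pi_gt0.
pose x := (eta - t) / pi; have /andP[h1 h2] := Num.Theory.floor_itv x.
have xE : x * pi = eta - t by rewrite /x divfK// gt_eqF.
exists (Num.floor x); rewrite rmorphD /= in h2.
have h3 : (Num.floor x)%:~R != x.
  by apply/eqP => E; apply: (h (Num.floor x)); rewrite E xE addrC subrK.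
have {}h3 : (Num.floor x)%:~R < x by rewrite lt_neqAle h3.
have A : (Num.floor x)%:~R * pi < x * pi by rewrite ltr_pM2r.
have B : x * pi < ((Num.floor x)%:~R + 1) * pi by rewrite ltr_pM2r.
by rewrite mulrDl mul1r in B; apply/andP; split; lra.
Qed.

Lemma cos_lower (x d : R) : 0 < d -> `|x| <= pi / 2 - d -> sin d <= cos x.
Proof.
move=> d0 hx; have p0 : 0 < pi :> R by exact: pi_gt0.
have -> : cos x = cos `|x| by case: (ler0P x) => _ //; rewrite cosN.
have -> : sin d = cos (pi / 2 - d).
  by rewrite -cosN opprB -[d in LHS](subrK (pi / 2)) sinDpihalf.
rewrite leNgt ltr_cos ?in_itv/=; first by rewrite -leNgt.
  by have := normr_ge0 x; move=> ?; apply/andP; split; lra.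
by have := normr_ge0 x; move=> ?; apply/andP; split; lra.
Qed.

Lemma powr_small (p d : R) : p < 0 -> 0 < d ->
  exists2 B : R, 0 < B & forall r, B <= r -> r `^ p <= d.
Proof.
move=> p0 d0; exists (expR (ln d / p)); first exact: expR_gt0.
move=> r Br; have r0 : 0 < r by exact: lt_le_trans (expR_gt0 _) Br.
rewrite /powR gt_eqF// -[leRHS](@lnK R d) ?posrE// ler_expR.
by rewrite mulrC -ler_ndivrMr// -[leLHS]expRK ler_ln ?posrE ?expR_gt0.
Qed.

Lemma fin_bound (I : finType) (P : I -> R -> Prop) :
  (forall i, exists B, forall r, B <= r -> P i r) ->
  exists2 B, 0 < B & forall r, B <= r -> forall i, P i r.
Proof.
move=> /choice[B hB]; exists (1 + \sum_i `|B i|).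
  by rewrite ltr_wpDr// sumr_ge0.
move=> r hr i; apply: hB; apply: le_trans (ler_norm _) _; apply: le_trans hr.
by rewrite (bigD1 i)//= addrA addrAC lerDr addr_ge0// sumr_ge0.
Qed.

End Arguments.

Section Stokes.
Variables (R : realType) (h l mu : nat).
Local Notation C := R[i].
Variables (sigma : 'I_h.+1 -> R) (lam : 'I_l -> 'I_h.+1 -> C) (eta : R).
Variables (sr tau : 'I_mu -> R) (k : 'I_mu -> int).
Hypothesis sigma0 : sigma ord0 = 1.
Hypothesis sigma_decr : forall k k' : 'I_h.+1, (k < k')%N -> sigma k' < sigma k.
Hypothesis sigma_gt0 : forall k, 0 < sigma k.
Hypothesis lam_inj : injective lam.
Hypothesis eta_gen : generic_dir lam eta.
Hypothesis enum_couples : enumerates_couples sigma lam eta sr tau.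

Lemma sigma_le1 j : sigma j <= 1.
Proof.
rewrite -sigma0; have [->//|j0] := eqVneq j ord0.
by apply/ltW/sigma_decr; rewrite lt0n.
Qed.

Lemma kmin_sym i j : kmin lam i j = kmin lam j i.
Proof.
rewrite /kmin; congr odflt; apply: eq_pick => m; rewrite eq_sym; congr (_ && _).
by apply: eq_forallb => m'; rewrite eq_sym.
Qed.

Lemma lamd_neq0 i j : i != j -> lamd lam i j != 0.
Proof.
move=> ij; rewrite subr_eq0; apply: (kminP _).1.
by move=> /lam_inj E; rewrite E eqxx in ij.
Qed.

(** In polar form: with [sg] the leading exponent, the leading term of [q_i - q_j] at modulus [r]
    and argument [th] has real part [S r^sg sin (sg (th - tau'))], which changes sign at [tau']. [S]
    is the modulus of [lamd] with a sign. *)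
Definition stokes_direction i j tau' S :=
  [/\ S != 0, lamd lam i j = S%:C * polar 1 (- (sigma (kmin lam i j) * tau') - pi / 2)
    & forall x, Sigma_set sr tau k x -> tau' - pi < x < tau'].

(** The argument of [lamd lam i j], reduced modulo [pi], falls in []eta - pi; eta[]. If the
    reduction changes the sign, the reduced value is an argument of [lamd lam j i], so the couple
    comes from the pair [(j, i)], and the sign goes into [S]. *)
Lemma stokes_direction_ex i j : i != j -> exists tau' S, stokes_direction i j tau' S.
Proof.
move=> ij; have w0 := lamd_neq0 ij; have [t ht] := arg_exists w0.
have [m] := reduce_mod_pi (fun m => @eta_gen i j t m ij ht).
set t' := t + _ => ht'.
set sg := sigma (kmin lam i j).
have sg0 : 0 < sg by exact: sigma_gt0.
have [s s1 Hs] := polar_shift R (- m).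
have tE : t = t' + (- m)%:~R * pi by rewrite /t' rmorphN /= mulNr addrK.
have wE : lamd lam i j = polar (s * normc (lamd lam i j)) t'.
  by rewrite -Hs -tE.
have [rho [E1 E2]] : exists rho, sr rho = sg /\ tau rho = sg^-1 * (3 * pi / 2 - t').
  have : couples sigma lam eta (sg, sg^-1 * (3 * pi / 2 - t')).
    case: s1 => sE; rewrite sE in wE.
      by exists i, j, t'; split => //; rewrite /is_arg {1}wE mul1r.
    exists j, i, t'; split => //; rewrite 1?eq_sym// ?(kmin_sym j i)//.
    have E : lamd lam j i = - lamd lam i j by rewrite /lamd kmin_sym opprB.
    by rewrite /is_arg E normcN {1}wE mulN1r -[in RHS](mul1r (normc _)) -(opprK (1 * _)) -mulNr -[- _ in RHS]mulN1r polar_scale rmorphN1 mulN1r mulN1r.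
  case: enum_couples => _ <- _ [rho _ [E1 E2]]; by exists rho.
(* With [sg tau' = 3 pi / 2 - t' + k pi], the required argument [- sg tau' - pi / 2] is
   [t' - (2 + k) pi]. *)
have [s' s'1 Hs'] := polar_shift R (- 2 - k rho).
exists (tau rho + (k rho)%:~R * pi / sg), (s' * (s * normc (lamd lam i j))).
have n0 : normc (lamd lam i j) != 0 by rewrite normc_eq0.
split.
- by rewrite !mulf_neq0//; [case: s'1|case: s1] => ->; rewrite ?oppr_eq0 oner_eq0.
- have -> : - (sg * (tau rho + (k rho)%:~R * pi / sg)) - pi / 2 = t' + (- 2 - k rho)%:~R * pi.
    by rewrite E2 rmorphB rmorphN /=; field; rewrite gt_eqF.
  have s2 : s' * s' = 1 by case: s'1 => ->; ring.
  rewrite Hs' -polar_scale {1}wE; congr polar.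
  by transitivity (s' * s' * (s * normc (lamd lam i j))); [rewrite s2 mul1r|ring].
- move=> x /(_ rho I); rewrite /= in_itv /= E1 => /andP[h1 h2]; apply/andP; split; lra.
Qed.

Lemma lam_split i j (G : 'I_h.+1 -> C) : i != j ->
  \sum_m (lam i m - lam j m) * G m = lamd lam i j * G (kmin lam i j) +
  \sum_(m : 'I_h.+1 | (kmin lam i j < m)%N) (lam i m - lam j m) * G m.
Proof.
move=> ij; have nl : lam i <> lam j by move=> /lam_inj E; rewrite E eqxx in ij.
have [_ low] := kminP nl; set k0 := kmin lam i j in low *.
rewrite (bigD1 k0)//=; congr (_ + _).
rewrite (bigID (fun m : 'I_h.+1 => (k0 < m)%N))/= [X in _ + X]big1 ?addr0.
  apply: eq_bigl => m; apply: andb_idl => lt; apply/eqP => E.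
  by rewrite E ltnn in lt.
move=> m /andP[mk]; rewrite -leqNgt leq_eqVlt => /predU1P[E|lt].
  by rewrite (val_inj E) eqxx in mk.
by rewrite low// subrr mul0r.
Qed.

(** Beyond [k0] the exponents are strictly smaller than [sigma k0], so every power in the sum tends
    to 0. *)
Lemma dominance (c : 'I_h.+1 -> R) (k0 : 'I_h.+1) (m : R) : (forall j, 0 <= c j) -> 0 < m ->
  exists2 B : R, 0 < B & forall r, B <= r ->
    \sum_(j : 'I_h.+1 | (k0 < j)%N) c j * r `^ (sigma j - sigma k0) <= m.
Proof.
move=> c0 m0; pose T := \sum_j c j.
have T0 : 0 <= T by exact: sumr_ge0.
have d0 : 0 < m / (T + 1) by rewrite divr_gt0// ltr_wpDl.
have [j|B B0 HB] := @fin_bound R _ (fun (j : 'I_h.+1) r => (k0 < j)%N -> r `^ (sigma j - sigma k0) <= m / (T + 1)).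
  have [kj|] := boolP (k0 < j)%N; last by exists 0.
  have neg : sigma j - sigma k0 < 0 by rewrite subr_lt0 sigma_decr.
  by have [B _ HB] := powr_small neg d0; exists B => r /HB.
exists B => // r /HB{}HB.
apply: (@le_trans _ _ (\sum_(j : 'I_h.+1 | (k0 < j)%N) c j * (m / (T + 1)))).
  by apply: ler_sum => j kj; rewrite ler_wpM2l// HB.
rewrite -mulr_suml.
have : \sum_(j : 'I_h.+1 | (k0 < j)%N) c j <= T.
  by rewrite /T [leRHS](bigID (fun j : 'I_h.+1 => (k0 < j)%N)) /= lerDl sumr_ge0.
move=> hT; apply: le_trans (ler_wpM2r (ltW d0) hT) _.
rewrite (_ : T * _ = m * (T / (T + 1))); last by field; rewrite gt_eqF// ltr_wpDl.
by rewrite ler_piMr ?(ltW m0)// ler_pdivrMr ?ltr_wpDl// mul1r lerDl.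
Qed.

Lemma normc_zpow (z : R * R) s : normc (zpow z s) = z.1 `^ s.
Proof. by rewrite normc_polar ger0_norm// powR_ge0. Qed.

(** After division by the leading power the lower terms amount to at most [m], and the leading term
    provides at least that much in the direction of the sign of [S]. The shift [al] is 1 for a
    derivative. *)
Lemma leading_dominates i j (S m : R) (G : 'I_h.+1 -> C) (r al : R) : i != j ->
  \sum_(j0 : 'I_h.+1 | (kmin lam i j < j0)%N) normc (lam i j0 - lam j j0) * sigma j0 *
     r `^ (sigma j0 - sigma (kmin lam i j)) <= m -> 0 < r ->
  (forall j0, normc (G j0) <= sigma j0 * r `^ (sigma j0 - al)) ->
  `|S| * m * r `^ (sigma (kmin lam i j) - al) <=
     S * complex.Re (lamd lam i j * G (kmin lam i j)) ->
  0 <= S * complex.Re (\sum_j0 (lam i j0 - lam j j0) * G j0).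
Proof.
move=> ij hm r0 hG hlead; rewrite lam_split// cReD mulrDr.
set k0 := kmin lam i j in hm hlead *.
set low := \sum_(_ | _) _.
have hlow : normc low <= m * r `^ (sigma k0 - al).
  apply: le_trans (normc_sum _ _ _) _.
  apply: le_trans (_ : \sum_(j0 : 'I_h.+1 | (k0 < j0)%N) normc (lam i j0 - lam j j0) * sigma j0 *
     r `^ (sigma j0 - sigma k0) * r `^ (sigma k0 - al) <= _).
    apply: ler_sum => j0 _; rewrite normcM -!mulrA -powRD; last by rewrite (gt_eqF r0) implybT.
    by rewrite ler_wpM2l ?normc_ge0// addrA subrK.
  by rewrite -mulr_suml ler_wpM2r ?powR_ge0.
have : `|S * complex.Re low| <= `|S| * m * r `^ (sigma k0 - al).
  rewrite normrM -mulrA ler_wpM2l//; exact: le_trans (normc_Re _) hlow.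
rewrite ler_norml => /andP[]; lra.
Qed.

(** At argument [th] the leading term of the derivative along the line has real part
    [S sg r^(sg - 1)] times the cosine of [sg (phi - tau') - (1 - sg) (th - phi)]. As [sg <= 1],
    this angle is at most [sg (pi / 2 - eps) + (1 - sg) pi / 2 = pi / 2 - sg eps] in modulus on the
    whole line, so the cosine is at least [sin (sg eps)] and the sign never changes. *)
Lemma line_sign i j tau' S (eps : R) : i != j -> stokes_direction i j tau' S ->
  0 < eps -> exists2 B : R, 0 < B & forall phi z, B <= complex.Re z ->
    phi - pi / 2 + eps <= tau' <= phi + pi / 2 - eps ->
    0 <= S * complex.Re (\sum_m (lam i m - lam j m) *
      ('i%C * ((sigma m)%:C * zpow (chart phi z) (sigma m - 1) * polar 1 phi))).
Proof.
move=> ij [S0 lE _] e0; set k0 := kmin lam i j in lE; set sg := sigma k0 in lE.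
have sg0 : 0 < sg by exact: sigma_gt0. have sg1 : sg <= 1 by exact: sigma_le1.
have p0 : 0 < pi :> R by exact: pi_gt0.
(* For [eps] beyond [pi / 2] no [phi] satisfies the condition on [tau']. *)
have [ep|ep] := ltP (pi / 2) eps.
  by exists 1 => // phi z _ /andP[? ?]; exfalso; lra.
have c0 : 0 < sin (sg * eps).
  apply: sin_gt0_pi; rewrite mulr_gt0//=.
  have : sg * eps <= eps by rewrite ler_piMl// ltW.
  lra.
have m0 : 0 < `|S| * sg * sin (sg * eps) by rewrite !mulr_gt0// normr_gt0.
have [|B B0 HB] := @dominance (fun j0 => normc (lam i j0 - lam j j0) * sigma j0) k0 _ _ m0.
  by move=> j0; rewrite mulr_ge0 ?normc_ge0// ltW.
exists B => // phi z Bz /andP[p1 p2].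
have z0 : hp 0 z by exact: lt_le_trans Bz.
have r0 := hp0_gt0 z0.
have Br : B <= normc z by apply: le_trans Bz _; apply: le_trans (ler_norm _) (normc_Re _).
apply: (leading_dominates (r := normc z) (al := 1) ij (HB _ Br) r0).
  move=> j0; rewrite !normcM normc_real normc_zpow chart1 normc_polar normr1 mulr1.
  by rewrite (ger0_norm (ltW (sigma_gt0 j0))) [normc 'i%C]/normc /= expr0n expr1n add0r sqrtr1 mul1r.
rewrite -/k0 -/sg lE; set th := (chart phi z).2.
have /andP[t1 t2] := chart_arg phi z0; rewrite -/th in t1 t2.
have -> : S%:C * polar 1 (- (sg * tau') - pi / 2) *
   ('i%C * (sg%:C * zpow (chart phi z) (sg - 1) * polar 1 phi)) =
   (S * sg)%:C * polar (normc z `^ (sg - 1)) (sg * (th - tau') - (th - phi)).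
  have -> : 'i%C = polar 1 (pi / 2) :> C by rewrite /polar cos_pihalf sin_pihalf mulr0 mulr1.
  rewrite rmorphM /zpow chart1 -/th.
  set x1 := - (sg * tau') - pi / 2.
  have -> : S%:C * polar 1 x1 * (polar 1 (pi / 2) * (sg%:C * polar (normc z `^ (sg - 1)) ((sg - 1) * th) * polar 1 phi))
    = S%:C * sg%:C * (polar 1 x1 * (polar 1 (pi / 2) * (polar (normc z `^ (sg - 1)) ((sg - 1) * th) * polar 1 phi))) by ring.
  by rewrite !polarM !mul1r !mulr1; congr (_ * polar _ _); rewrite /x1; ring.
rewrite -polar_scale /polar /=.
have hc : sin (sg * eps) <= cos (sg * (th - tau') - (th - phi)).
  apply: cos_lower; first exact: mulr_gt0.
  have q1 : sg * (phi - tau') <= sg * (pi / 2 - eps) by rewrite ler_pM2l//; lra.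
  have q2 : sg * (tau' - phi) <= sg * (pi / 2 - eps) by rewrite ler_pM2l//; lra.
  have q3 : (1 - sg) * (th - phi) <= (1 - sg) * (pi / 2) by rewrite ler_wpM2l//; lra.
  have q4 : (1 - sg) * (phi - th) <= (1 - sg) * (pi / 2) by rewrite ler_wpM2l//; lra.
  rewrite ler_norml; apply/andP; split; lra.
have rp : 0 <= S ^+ 2 * sg * normc z `^ (sg - 1) by rewrite mulr_ge0 ?powR_ge0// mulr_ge0 ?sqr_ge0// ltW.
have := ler_wpM2l rp hc.
have S2 : `|S| * `|S| = S ^+ 2 by rewrite -expr2 real_normK// num_real.
move=> H; rewrite (_ : `|S| * _ * _ = (`|S| * `|S|) * sg * normc z `^ (sg - 1) * sin (sg * eps)); last by ring.
by rewrite S2; apply: le_trans H _; rewrite le_eqVlt; apply/orP; left; apply/eqP; ring.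
Qed.

(** A small step [d] away from [tau'], on the side given by the sign of [S], makes the real part of
    the leading term [|S| r^sg sin (sg d)], which is positive and dominates the lower terms far
    out. *)
Lemma ray_sign i j tau' S (u v : R) : i != j -> stokes_direction i j tau' S ->
  u < tau' -> tau' < v -> exists2 th, u < th < v & exists2 B : R, 0 < B &
    forall r, B <= r -> 0 <= complex.Re (\sum_m (lam i m - lam j m) * zpow (r, th) (sigma m)).
Proof.
move=> ij [S0 lE _] ut tv; set k0 := kmin lam i j in lE; set sg := sigma k0 in lE.
have sg0 : 0 < sg by exact: sigma_gt0. have sg1 : sg <= 1 by exact: sigma_le1.
(* The bound [d <= 1] keeps [sg d] in []0; 2[], where the sine is positive. *)
have [d [d0 d1 du dv]] : exists d : R, [/\ 0 < d, d <= 1, u < tau' - d & tau' + d < v].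
  exists (Num.min 1 (Num.min ((tau' - u) / 2) ((v - tau') / 2))); split.
  - by rewrite !lt_min; apply/and3P; split; lra.
  - by rewrite ge_min lexx.
  - suff : Num.min 1 (Num.min ((tau' - u) / 2) ((v - tau') / 2)) <= (tau' - u) / 2 by lra.
    by rewrite !ge_min lexx orbT.
  - suff : Num.min 1 (Num.min ((tau' - u) / 2) ((v - tau') / 2)) <= (v - tau') / 2 by lra.
    by rewrite !ge_min lexx !orbT.
have c0 : 0 < sin (sg * d).
  apply: sin2_gt0; rewrite mulr_gt0//=.
  have : sg * d <= d by rewrite ler_piMl// ltW.
  lra.
exists (tau' + Num.sg S * d).
  by case: (sgrP S) => ?; rewrite ?mul1r ?mulN1r ?mul0r ?addr0; apply/andP; split; lra.
have m0 : 0 < `|S| * sin (sg * d) by rewrite mulr_gt0// normr_gt0.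
have [|B B0 HB] := @dominance (fun j0 => normc (lam i j0 - lam j j0)) k0 _ _ m0.
  by move=> j0; exact: normc_ge0.
exists B => // r /[dup] Br /HB {}HB; have r0 : 0 < r by exact: lt_le_trans Br.
rewrite lam_split// cReD -/k0.
set low := \sum_(_ | _) _.
have hlow : normc low <= `|S| * sin (sg * d) * r `^ sg.
  apply: le_trans (normc_sum _ _ _) _.
  apply: le_trans (_ : \sum_(j0 : 'I_h.+1 | (k0 < j0)%N) normc (lam i j0 - lam j j0) *
     r `^ (sigma j0 - sg) * r `^ sg <= _).
    apply: ler_sum => j0 _; rewrite normcM -!mulrA -powRD; last by rewrite (gt_eqF r0) implybT.
    by rewrite normc_zpow subrK.
  by rewrite -mulr_suml ler_wpM2r ?powR_ge0.
have := le_trans (normc_Re _) hlow; rewrite ler_norml => /andP[hl _].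
suff : complex.Re (lamd lam i j * zpow (r, tau' + Num.sg S * d) sg) = `|S| * sin (sg * d) * r `^ sg by lra.
rewrite lE /zpow -mulrA polarM mul1r -polar_scale /polar /=.
have -> : - (sg * tau') - pi / 2 + sg * (tau' + Num.sg S * d) = sg * (Num.sg S * d) - pi / 2 by ring.
rewrite -cosN opprB addrC -[X in cos X](_ : - (sg * (Num.sg S * d)) + pi / 2 = _)//.
rewrite cosDpihalf sinN opprK.
case: (sgrP S) => [S1|S1|S1]; first by rewrite S1 eqxx in S0.
  by rewrite mul1r; ring.
by rewrite mulN1r mulrN sinN; ring.
Qed.

End Stokes.

(** * Solutions on half-planes *)

Section HalfPlanes.
Variables (R : realType) (n h l mu : nat).
Local Notation C := R[i].
Local Notation proj := Defs.proj.
Variables (a : R) (sigma : 'I_h.+1 -> R) (Lam : 'I_h.+1 -> 'M[C]_n).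
Variables (blk : 'I_n -> 'I_l) (lam : 'I_l -> 'I_h.+1 -> C) (Rp : R * R -> 'M[C]_n).
Hypothesis a_gt0 : 0 < a.
Hypothesis Lam_diag : forall k, is_diag_mx (Lam k).
Hypothesis LamE : forall k p, Lam k p p = (sigma k)%:C * lam (blk p) k.
Hypothesis Rp_holo : mx_holomorphic (outer a) Rp.

Let q := qdiag sigma lam blk.

(** The factor [polar 1 phi] is the derivative of [proj] along the chart: in the coordinate the
    equation reads [dY/dx = system_mx phi x Y]. *)
Definition system_mx phi (z : C) : 'M[C]_n :=
  polar 1 phi *: (Lambda_of sigma Lam (chart phi z) + Rp (chart phi z)).

Definition qd phi p (z : C) : C := \sum_k lam (blk p) k * zpow (chart phi z) (sigma k).

Definition qd' phi p (z : C) : C :=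
  \sum_k lam (blk p) k * ((sigma k)%:C * zpow (chart phi z) (sigma k - 1) * polar 1 phi).

Lemma hp_hp0 z : hp a z -> hp 0 z.
Proof. exact: lt_trans. Qed.

Lemma qdE phi p z : q (chart phi z) 0 p = qd phi p z.
Proof. by rewrite mxE. Qed.

Lemma cder_qd phi p z : hp 0 z -> cder (qd phi p) z (qd' phi p z).
Proof. by move=> hz; apply: der_sum => k; apply: derMc; exact: cder_zpow. Qed.

Lemma cder_qd' phi p z : hp 0 z -> exists l, cder (qd' phi p) z l.
Proof.
move=> hz; eexists; apply: der_sum => k; apply: derMc.
apply: der_eq (derMc (polar 1 phi) (derMc (sigma k)%:C (cder_zpow phi (sigma k - 1) hz))) => [y|].
  by rewrite mulrC.
by [].
Qed.

Lemma system_mxE phi z p j : system_mx phi z p j =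
  (p == j)%:R * qd' phi p z + polar 1 phi * Rp (chart phi z) p j.
Proof.
rewrite !mxE mulrDr; congr (_ + _); rewrite /Lambda_of summxE.
have [<-|pj] := eqVneq p j.
  rewrite mul1r mulr_sumr; apply: eq_bigr => k _; rewrite mxE LamE; ring.
rewrite mul0r big1 ?mulr0// => k _; rewrite mxE.
by have /is_diag_mxP /(_ p j) -> := Lam_diag k; rewrite ?mulr0.
Qed.

Lemma cder_system_mx phi z : hp a z -> exists L, mxder (system_mx phi) z L.
Proof.
move=> hz; have hz0 := hp_hp0 hz.
have H p j : exists l, cder (fun w => system_mx phi w p j) z l.
  have [l1 h1] := cder_qd' phi p hz0; have [l2 h2] := cder_perturbation a_gt0 Rp_holo phi p j hz.
  eexists; apply: der_eq (derD (derMc (p == j)%:R h1) (derMc (polar 1 phi) h2)) => [y|].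
    by rewrite system_mxE.
  by [].
have /choice[L hL] : forall pj : 'I_n * 'I_n, exists l, cder (fun w => system_mx phi w pj.1 pj.2) z l by case.
by exists (\matrix_(p, j) L (p, j)) => p j; rewrite mxE; exact: (hL (p, j)).
Qed.

(* The interior of [HH phi a], that is the image of the half-plane [hp a] under
   [chart phi]. *)
Definition HHo phi : set (R * R) := [set z | [/\ ucover z,
  phi - pi / 2 < z.2 < phi + pi / 2 & a < z.1 * cos (z.2 - phi)]].

Lemma HHo_unchart phi z : HHo phi z -> hp a (unchart phi z) /\ chart phi (unchart phi z) = z.
Proof. by case=> z0 z2 z1; split; [|exact: unchartK]. Qed.

Lemma HHo_chart phi z : hp a z -> HHo phi (chart phi z).
Proof.
move=> hz; have hz0 := hp_hp0 hz; split; [exact: ucover_chart|exact: chart_arg|].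
by rewrite -Re_unchart chartK.
Qed.

Definition half_plane_system phi (Y : R * R -> 'M[C]_n) : Prop := forall z, HHo phi z ->
  Y z \in unitmx /\ is_mxderiv Y z ((Lambda_of sigma Lam z + Rp z) *m Y z).

Lemma mxder_chart phi Y z : hp 0 z ->
  is_mxderiv Y (chart phi z) ((Lambda_of sigma Lam (chart phi z) + Rp (chart phi z)) *m Y (chart phi z)) ->
  mxder (fun w => Y (chart phi w)) z (system_mx phi z *m Y (chart phi z)).
Proof.
move=> hz hY p j; have := cder_chart (F := fun w => Y w p j) hz (hY p j).
by apply: der_eq => //; rewrite /system_mx -scalemxAl [RHS]mxE mulrC.
Qed.

Lemma chart_mxder phi Y z : hp 0 z ->
  mxder (fun w => Y (chart phi w)) z (system_mx phi z *m Y (chart phi z)) ->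
  is_mxderiv Y (chart phi z) ((Lambda_of sigma Lam (chart phi z) + Rp (chart phi z)) *m Y (chart phi z)).
Proof.
move=> hz hY p j; apply: (chart_cder (F := fun w => Y w p j) hz).
by apply: der_eq (hY p j) => //; rewrite /system_mx -scalemxAl [LHS]mxE mulrC.
Qed.

(** [integral_system] gives the columns on [hp B] only, where the sign conditions and the smallness
    hold. There [Y0] solves the system, hence is [W] times a constant for a fundamental matrix [W]
    on all of [hp a], and this product is the extension. Invertibility has to be checked at a single
    point [z1], taken on a line [b1] where [eps] is small enough. *)
Lemma half_plane_solution phi B (rho : R -> R -> R) (eps : R -> R) : a <= B ->
  (forall p j, (forall z, hp B z -> complex.Re ('i%C * (qd' phi p z - qd' phi j z)) <= 0) \/
     (forall z, hp B z -> 0 <= complex.Re ('i%C * (qd' phi p z - qd' phi j z)))) ->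
  (forall b t, B < b -> rderR (rho b) t (line_norm Rp phi b t)) ->
  (forall b t, B < b -> 0 <= rho b t <= eps b) ->
  (forall b, B < b -> eps b <= 2^-1) ->
  (exists2 b, B < b & n%:R * (2 * eps b) < 1) ->
  exists Y, half_plane_system phi Y /\ forall z, hp B z -> forall p j,
    normc (twist q Y (chart phi z) p j) <= 2 * eps (complex.Re z).
Proof.
move=> aB sg drho brho heps [b1 Bb1 nb1].
have hB z : hp B z -> hp a z by exact: le_lt_trans.
have p1 : normc (polar 1 phi : C) = 1 by rewrite normc_polar normr1.
have /choice[f hf] : forall j, exists f : 'I_n -> C -> C, forall p,
    (forall z, hp B z -> cder (f p) z
       ((qd' phi p z - qd' phi j z) * f p z +
        \sum_k (polar 1 phi * Rp (chart phi z) p k) * ((k == j)%:R + f k z))) /\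
    (forall b t, B < b -> normc (f p (b +i* t)) <= 2 * eps b).
  move=> j; apply: (@integral_system R n B (fun p k z => polar 1 phi * Rp (chart phi z) p k)
    (fun p z => qd phi p z - qd phi j z) (fun p z => qd' phi p z - qd' phi j z)
    (line_norm Rp phi) rho eps j) => //.
  - by move=> p z /hB/hp_hp0 hz; apply: derB; exact: cder_qd.
  - move=> p z /hB/hp_hp0 hz; have [l1 h1] := cder_qd' phi p hz.
    by have [l2 h2] := cder_qd' phi j hz; eexists; exact: derB h1 h2.
  - move=> p k z /hB hz; have [l1 h1] := cder_perturbation a_gt0 Rp_holo phi p k hz.
    by eexists; exact: derMc h1.
  - move=> b t p Bb; rewrite /line_norm [leRHS](bigD1 p)//=.
    apply: ler_wpDr.
      by do 2!(apply: sumr_ge0 => ? _); exact: normc_ge0.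
    by apply: ler_sum => k _; rewrite normcM p1 mul1r.
pose Y0 z : 'M[C]_n := \matrix_(p, j) (((p == j)%:R + f j p z) * expc (qd phi j z)).
have dY0 z : hp B z -> mxder Y0 z (system_mx phi z *m Y0 z).
  move=> hz p j; have hz0 := hp_hp0 (hB z hz).
  have d1 := derD (der_cst id z (p == j)%:R) ((hf j p).1 z hz).
  have d2 := der_comp (cder_qd phi j hz0) (cder_expc (qd phi j z)).
  apply: der_eq (derM d1 d2) => [y|]; first by rewrite mxE.
  rewrite mxE; under [RHS]eq_bigr do rewrite system_mxE mxE mulrA mulrDl.
  rewrite -mulr_suml big_split /= add0r [X in _ = (X + _) * _](bigD1 p)//= eqxx mul1r.
  rewrite [X in _ = (_ + X + _) * _]big1 ?addr0; last first.
    by move=> k kp; rewrite eq_sym (negbTE kp) !mul0r.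
  set e := expc _; set s := \sum_k _.
  by have [->|_] := eqVneq p j; rewrite /=; ring.
pose z1 : C := b1 +i* 0.
have hz1 : hp B z1 by [].
have [W [Z [W1 dW dZ ZW]]] := fundamental_system (hB _ hz1) (@cder_system_mx phi).
have Y0E z : hp B z -> Y0 z = W z *m Y0 z1.
  move=> hz; have WZ := mulmx1C (ZW z (hB z hz)).
  rewrite -[LHS]mul1mx -WZ -mulmxA; congr (_ *m _).
  have <- : Z z1 *m Y0 z1 = Y0 z1.
    by have := ZW z1 (hB z1 hz1); rewrite W1 mulmx1 => ->; rewrite mul1mx.
  apply: (@mxder_const R n (fun z => Z z *m Y0 z)) => s s01.
  have hs := hp_seg hz1 hz s01.
  have := mxderM (dZ _ (hB _ hs)) (dY0 _ hs).
  by rewrite mulmxA mulNmx addNr.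
have Y0F z : Y0 z = (1%:M + \matrix_(p, j) f j p z) *m exp_diag (q (chart phi z)).
  by apply/matrixP => p j; rewrite /exp_diag mul_mx_diag !mxE -qdE mxE.
have Y0u : Y0 z1 \in unitmx.
  rewrite Y0F unitmx_mul; apply/andP; split.
    by apply: mx1_perturb_unit nb1 _ => p j; rewrite mxE; exact: (hf j p).2.
  by have [] := mulmx1_unit (exp_diagN (q (chart phi z1))).
pose Y z := W (unchart phi z) *m Y0 z1.
have YE z : hp 0 z -> Y (chart phi z) = W z *m Y0 z1 by move=> hz; rewrite /Y chartK.
exists Y; split.
  move=> z /HHo_unchart[]; set x := unchart phi z => hx <-.
  have hx0 := hp_hp0 hx; split.
    by rewrite YE// unitmx_mul Y0u andbT; have [] := mulmx1_unit (ZW x hx).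
  apply: chart_mxder => // p j; have [d d0 H] := hp_open hx0.
  apply: (der_local d0 (F := fun w => (W w *m Y0 z1) p j)) => [y hy|].
    by rewrite YE//; exact: H.
  have := mxderM (dW x hx) (mxder_cst x (Y0 z1)).
  by rewrite mulmx0 addr0 YE// mulmxA => /(_ p j).
move=> z hz p j; have hz0 := hp_hp0 (hB z hz).
rewrite /twist YE// -Y0E// Y0F -mulmxA exp_diagN mulmx1 addrC addKr mxE.
by case: z hz {hz0} => b t; exact: (hf j p).2.
Qed.

(** [D = X - 1] satisfies [D = E2 - E1 - E1 D]. Summing the moduli of all entries gives
    [x <= 2 n^2 e + n e x], and [n e <= 1/2] absorbs the last term. *)
Lemma perturb_mul (e : R) (E1 E2 X : 'M[C]_n) : n%:R * e <= 2^-1 ->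
  (forall p j, normc (E1 p j) <= e) -> (forall p j, normc (E2 p j) <= e) ->
  (1%:M + E1) *m X = 1%:M + E2 ->
  forall p j, normc ((X - 1%:M) p j) <= 4 * (n%:R * (n%:R * e)).
Proof.
move=> ne h1 h2 EX; set D := X - 1%:M.
have DE : D = E2 - E1 - E1 *m D.
  rewrite /D mulmxBr mulmx1; move: EX; rewrite mulmxDl mul1mx => /eqP.
  by rewrite -(subr_eq) => /eqP <-; rewrite opprD opprK !addrA; apply/matrixP => p j; rewrite !mxE; ring.
pose x := \sum_p \sum_j normc (D p j).
have x0 : 0 <= x by do 2!(apply: sumr_ge0 => ? _); exact: normc_ge0.
have hx : x <= n%:R * (n%:R * (2 * e)) + n%:R * e * x.
  apply: (@le_trans _ _ (\sum_(p < n) \sum_(j < n) (2 * e + e * \sum_k normc (D k j)))).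
    apply: ler_sum => p _; apply: ler_sum => j _; rewrite {1}DE !mxE.
    apply: le_trans (le_normcB _ _) _; apply: lerD.
      apply: le_trans (le_normcB _ _) _; have := h1 p j; have := h2 p j; lra.
    apply: le_trans (normc_sum _ _ _) _; rewrite mulr_sumr; apply: ler_sum => k _.
    by rewrite normcM ler_wpM2r ?normc_ge0.
  rewrite sumr_const card_ord big_split /= sumr_const card_ord -mulr_sumr.
  rewrite exchange_big /= -/x.
  have -> : (2 * e *+ n + e * x) *+ n = n%:R * (n%:R * (2 * e)) + n%:R * e * x.
    by rewrite -[LHS]mulr_natl -[2 * e *+ n]mulr_natl; ring.
  by [].
have : n%:R * e * x <= 2^-1 * x by rewrite ler_wpM2r.
move=> hx2 p j; apply: (@le_trans _ _ x); last by lra.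
rewrite /x (bigD1 p)//= (bigD1 j)//= -addrA lerDl addr_ge0// ?sumr_ge0// => k _.
  exact: normc_ge0.
by apply: sumr_ge0 => ? _; exact: normc_ge0.
Qed.

(** Among angles of modulus below [3 pi / 2], a positive cosine selects the central arc: this
    singles out the right sheet of the cover over an overlap of half-planes. *)
Lemma cos_pos_pihalf (x : R) : 0 < cos x -> `|x| < 3 * pi / 2 -> `|x| < pi / 2.
Proof.
have p0 : 0 < pi :> R by exact: pi_gt0.
have -> : cos x = cos `|x| by case: (ler0P x) => _ //; rewrite cosN.
move=> c0 h3; rewrite ltNge; apply/negP => h1.
have : 0 <= cos (`|x| - pi) by apply: cos_ge0_pihalf; apply/andP; split; lra.
have E : cos `|x| = - cos (`|x| - pi) by rewrite -cosDpi subrK.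
rewrite E in c0; lra.
Qed.

(** Pointwise in the argument, without uniformity: a weak form of the behaviour that suffices for
    uniqueness. *)
Definition ray_behaviour phi (Y : R * R -> 'M[C]_n) : Prop :=
  forall th, phi - pi / 2 < th < phi + pi / 2 -> forall e : R, 0 < e ->
  exists M, forall r, M < r -> forall p j, normc (twist q Y (r, th) p j) <= e.

Lemma HHo_ray phi th : phi - pi / 2 < th < phi + pi / 2 ->
  exists2 B : R, 0 < B & forall r, B < r -> HHo phi (r, th).
Proof.
move=> /andP[t1 t2]; have c0 : 0 < cos (th - phi) by apply: cos_gt0_pihalf; apply/andP; split; lra.
exists (a / cos (th - phi)); first by rewrite divr_gt0.
move=> r; rewrite ltr_pdivrMr// => hr; split => //=; last by rewrite t1.
rewrite /ucover /=; have := lt_trans a_gt0 hr.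
by rewrite pmulr_lgt0.
Qed.

(** In [chart phi1] the overlap is the intersection of two half-planes, hence convex, and there
    [Y2 = Y1 Cm] with [Cm] constant. Each entry of [Cm] is tested on its own ray: multiplied by
    [e^(q_p - q_j)], of modulus at least 1 there, it tends to the entry of the identity. *)
Lemma overlap_unique phi1 phi2 Y1 Y2 : `|phi1 - phi2| < pi ->
  (forall p j, blk p != blk j -> exists2 th, Num.max phi1 phi2 - pi / 2 < th < Num.min phi1 phi2 + pi / 2 &
     exists2 B : R, 0 < B & forall r, B <= r ->
       0 <= complex.Re (\sum_m (lam (blk p) m - lam (blk j) m) * zpow (r, th) (sigma m))) ->
  half_plane_system phi1 Y1 -> half_plane_system phi2 Y2 ->
  ray_behaviour phi1 Y1 -> ray_behaviour phi2 Y2 ->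
  forall z, HHo phi1 z -> HHo phi2 z -> Y2 z = Y1 z.
Proof.
move=> dphi hray s1 s2 r1 r2 z hz1 hz2.
have p0 : 0 < pi :> R by exact: pi_gt0.
pose V x := hp a x /\ HHo phi2 (chart phi1 x).
have VE x : V x <-> hp a x /\ hp a (polar 1 (phi1 - phi2) * x).
  suff H : hp a x -> HHo phi2 (chart phi1 x) <-> hp a (polar 1 (phi1 - phi2) * x).
    by split => -[h1 h2]; split => //; exact/H.
  move=> hx; have hx0 := hp_hp0 hx.
  have E : polar 1 (phi1 - phi2) * x = unchart phi2 (chart phi1 x).
    have := proj_chart phi1 hx0; rewrite /proj /unchart => Ep.
    have -> : polar (chart phi1 x).1 ((chart phi1 x).2 - phi2) =
       polar 1 (- phi2) * polar (chart phi1 x).1 (chart phi1 x).2 by rewrite polarM mul1r addrC.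
    by rewrite Ep mulrA polarM mulr1 addrC.
  rewrite E; split; first by move=> /HHo_unchart[].
  rewrite /hp Re_unchart => hy; split => //; first exact: ucover_chart.
  have r0 := ucover_chart phi1 hx0; rewrite /ucover /mkset in r0.
  have c0 : 0 < cos ((chart phi1 x).2 - phi2) by rewrite -(pmulr_rgt0 _ r0) (lt_trans a_gt0).
  have /andP[t1 t2] := chart_arg phi1 hx0.
  have : `|(chart phi1 x).2 - phi2| < pi / 2.
    apply: cos_pos_pihalf => //; move: dphi; rewrite !ltr_norml => /andP[d1 d2].
    by apply/andP; split; lra.
  by rewrite ltr_norml => /andP[? ?]; apply/andP; split; lra.
have Vseg x y s : V x -> V y -> 0 <= s <= 1 -> V (seg x y s).
  move=> /VE[hx1 hx2] /VE[hy1 hy2] s01; apply/VE; split; first exact: hp_seg.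
  have -> : polar 1 (phi1 - phi2) * seg x y s =
    seg (polar 1 (phi1 - phi2) * x) (polar 1 (phi1 - phi2) * y) s by rewrite /seg; ring.
  exact: hp_seg.
have ha1 : hp a ((a + 1) +i* 0) by rewrite /hp /= ltrDl.
have [W [Z [_ dW dZ ZW]]] := fundamental_system ha1 (@cder_system_mx phi1).
have d1 x : V x -> mxder (fun w => Y1 (chart phi1 w)) x (system_mx phi1 x *m Y1 (chart phi1 x)).
  by move=> [hx _]; apply: mxder_chart; [exact: hp_hp0|exact: (s1 _ (HHo_chart phi1 hx)).2].
have d2 x : V x -> mxder (fun w => Y2 (chart phi1 w)) x (system_mx phi1 x *m Y2 (chart phi1 x)).
  by move=> [hx hx2]; apply: mxder_chart; [exact: hp_hp0|exact: (s2 _ hx2).2].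
have cst Y : (forall x, V x -> mxder (fun w => Y (chart phi1 w)) x (system_mx phi1 x *m Y (chart phi1 x))) ->
    forall x y, V x -> V y -> Z y *m Y (chart phi1 y) = Z x *m Y (chart phi1 x).
  move=> dY x y Vx Vy; apply: (@mxder_const R n (fun w => Z w *m Y (chart phi1 w))) => s s01.
  have Vs := Vseg x y s Vx Vy s01.
  by have := mxderM (dZ _ Vs.1) (dY _ Vs); rewrite mulmxA mulNmx addNr.
have [hz zE] := HHo_unchart hz1; set x0 := unchart phi1 z in hz zE.
have Vx0 : V x0 by split; rewrite ?zE.
pose C1 := Z x0 *m Y1 z; pose C2 := Z x0 *m Y2 z.
have WZ x : hp a x -> W x *m Z x = 1%:M by move=> hx; exact: mulmx1C (ZW x hx).
have C1u : C1 \in unitmx.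
  rewrite unitmx_mul (s1 z hz1).1 andbT; by have [] := mulmx1_unit (ZW x0 hz).
have [Cm Y12] : exists Cm, forall x, V x -> Y2 (chart phi1 x) = Y1 (chart phi1 x) *m Cm.
  exists (invmx C1 *m C2) => x Vx; have e1 : Y1 (chart phi1 x) = W x *m C1.
    by rewrite /C1 -zE -(cst _ d1 _ _ Vx0 Vx) mulmxA WZ ?mul1mx//; exact: Vx.1.
  have e2 : Y2 (chart phi1 x) = W x *m C2.
    by rewrite /C2 -zE -(cst _ d2 _ _ Vx0 Vx) mulmxA WZ ?mul1mx//; exact: Vx.1.
  by rewrite e1 e2 -mulmxA (mulmxA C1) mulmxV// mul1mx.
suff Cm1 : Cm = 1%:M by rewrite -zE Y12// Cm1 mulmx1.
apply/matrixP => p j.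
have [th /andP[t1 t2] [B B0 hB]] : exists2 th, Num.max phi1 phi2 - pi / 2 < th < Num.min phi1 phi2 + pi / 2 &
    exists2 B : R, 0 < B & forall r, B <= r -> 0 <= complex.Re (q (r, th) 0 p - q (r, th) 0 j).
  have qE z' : q z' 0 p - q z' 0 j = \sum_m (lam (blk p) m - lam (blk j) m) * zpow z' (sigma m).
    by rewrite !mxE -sumrB; apply: eq_bigr => m _; rewrite mulrBl.
  have [bE|/hray[th hth [B B0 hB]]] := eqVneq (blk p) (blk j); last first.
    by exists th => //; exists B => // r /hB; rewrite qE.
  (* Within a block [q_p - q_j] is 0, and any common direction will do. *)
  exists ((phi1 + phi2) / 2).
    move: dphi; rewrite ltr_norml => /andP[b1 b2].
    by case: (leP phi1 phi2) => ?; apply/andP; split; lra.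
  by exists 1 => // r _; rewrite qE bE big1 // => m _; rewrite subrr mul0r.
have th1 : phi1 - pi / 2 < th < phi1 + pi / 2.
  have : phi1 <= Num.max phi1 phi2 by rewrite le_max lexx.
  have : Num.min phi1 phi2 <= phi1 by rewrite ge_min lexx.
  by move=> ? ?; apply/andP; split; lra.
have th2 : phi2 - pi / 2 < th < phi2 + pi / 2.
  have : phi2 <= Num.max phi1 phi2 by rewrite le_max lexx orbT.
  have : Num.min phi1 phi2 <= phi2 by rewrite ge_min lexx orbT.
  by move=> ? ?; apply/andP; split; lra.
have key e : 0 < e -> n%:R * e <= 2^-1 ->
    normc (Cm p j - (p == j)%:R) <= 4 * (n%:R * (n%:R * e)).
  move=> e0 ne.
  have [M1 H1] := r1 th th1 e e0; have [M2 H2] := r2 th th2 e e0.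
  have [B1 B10 H3] := HHo_ray th1; have [B2 B20 H4] := HHo_ray th2.
  pose r := `|M1| + `|M2| + B1 + B2 + B.
  have [m1 m2 m3 m4] := And4 (ler_norm M1) (ler_norm M2) (normr_ge0 M1) (normr_ge0 M2).
  have {}H1 := H1 r; have {}H2 := H2 r.
  have {}H3 : HHo phi1 (r, th) by apply: H3; rewrite /r; lra.
  have {}H4 : HHo phi2 (r, th) by apply: H4; rewrite /r; lra.
  have {}hB : 0 <= complex.Re (q (r, th) 0 p - q (r, th) 0 j) by apply: hB; rewrite /r; lra.
  have {}H1 : forall p j, normc (twist q Y1 (r, th) p j) <= e by apply: H1; rewrite /r; lra.
  have {}H2 : forall p j, normc (twist q Y2 (r, th) p j) <= e by apply: H2; rewrite /r; lra.
  have [hx xE] := HHo_unchart H3.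
  have Vx : V (unchart phi1 (r, th)) by split; rewrite ?xE.
  have := Y12 _ Vx; rewrite xE => YY.
  set w := (r, th) in H1 H2 H3 H4 hB hx xE Vx YY.
  pose X := exp_diag (q w) *m Cm *m exp_diag (- q w).
  have EX : (1%:M + twist q Y1 w) *m X = 1%:M + twist q Y2 w.
    rewrite /twist ![1%:M + _]addrC !subrK /X !mulmxA -(mulmxA (Y1 w)) exp_diagNK mulmx1.
    by rewrite YY.
  have := perturb_mul ne H1 H2 EX p j.
  have -> : (X - 1%:M) p j = Cm p j * expc (q w 0 p - q w 0 j) - (p == j)%:R.
    rewrite /X /exp_diag mul_mx_diag mul_diag_mx !mxE expcD; ring.
  have [<-|pj] := eqVneq p j; first by rewrite subrr expc0 mulr1.
  rewrite !subr0 normcM normc_expc => hC; apply: le_trans hC.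
  by rewrite ler_peMr ?normc_ge0// -expR0 ler_expR.
rewrite [RHS]mxE; apply/eqP; rewrite -subr_eq0 -normc_eq0 eq_le normc_ge0 andbT.
apply/ler_addgt0Pr => e e0; rewrite add0r.
have n0 : 0 <= n%:R :> R by [].
(* Large enough for [n / T <= 1/2] and for [4 n^2 / T <= e]. *)
pose T : R := 2 * n%:R + 1 + 4 * (n%:R * n%:R) / e.
have nn0 : 0 <= n%:R * n%:R :> R by rewrite mulr_ge0.
have T1 : 0 <= 4 * (n%:R * n%:R) / e by rewrite divr_ge0 ?(ltW e0)// mulr_ge0.
have T0 : 0 < T by rewrite /T; lra.
have Tne : n%:R * T^-1 <= 2^-1 by rewrite ler_pdivrMr// /T; lra.
have Ti : 0 < T^-1 by rewrite invr_gt0.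
apply: le_trans (key _ Ti Tne) _.
rewrite !mulrA ler_pdivrMr//.
have : e * (4 * (n%:R * n%:R) / e) <= e * T by rewrite ler_pM2l// /T; lra.
by rewrite mulrC divfK ?gt_eqF// !mulrA.
Qed.

End HalfPlanes.

(** * Gluing *)

Section Assembly.
Variables (R : realType) (n h l mu : nat).
Local Notation C := R[i].
Variables (N : 'M[C]_n -> R) (a : R) (sigma : 'I_h.+1 -> R) (Lam : 'I_h.+1 -> 'M[C]_n).
Variables (blk : 'I_n -> 'I_l) (lam : 'I_l -> 'I_h.+1 -> C) (Rp : R * R -> 'M[C]_n).
Variables (eta : R) (sr tau : 'I_mu -> R) (k : 'I_mu -> int).
Hypothesis hN : is_mxnorm N.
Hypothesis a_gt0 : 0 < a.
Hypothesis sigma0 : sigma ord0 = 1.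
Hypothesis sigma_decr : forall k k' : 'I_h.+1, (k < k')%N -> sigma k' < sigma k.
Hypothesis sigma_gt0 : forall k, 0 < sigma k.
Hypothesis Lam_diag : forall k, is_diag_mx (Lam k).
Hypothesis l_ge2 : (2 <= l)%N.
Hypothesis lam_inj : injective lam.
Hypothesis LamE : forall k p, Lam k p p = (sigma k)%:C * lam (blk p) k.
Hypothesis Rp_holo : mx_holomorphic (outer a) Rp.
Hypothesis Rp_decay : forall I : set R, open I -> is_interval I -> good_decay N a Rp I.
Hypothesis eta_gen : generic_dir lam eta.
Hypothesis enum_couples : enumerates_couples sigma lam eta sr tau.
Hypothesis k_adequate : Sigma_set sr tau k !=set0.

Local Notation Sigma := (Sigma_set sr tau k).
Local Notation q := (qdiag sigma lam blk).
Local Notation hps := (half_plane_system a sigma Lam Rp).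
Local Notation rayb := (ray_behaviour sigma blk lam).

Let dir i j : i != j -> exists tau' S, stokes_direction sigma lam sr tau k i j tau' S.
Proof. exact: (stokes_direction_ex k sigma_gt0 lam_inj eta_gen enum_couples). Qed.

Lemma Sigma_convex x y z : Sigma x -> Sigma y -> x <= z <= y -> Sigma z.
Proof.
move=> Sx Sy /andP[xz zy] rho _; move: (Sx rho I) (Sy rho I); rewrite /= !in_itv /=.
by move=> /andP[h1 h2] /andP[h3 h4]; apply/andP; split; lra.
Qed.

Lemma Sigma_open x : Sigma x -> exists2 e : R, 0 < e & forall y, `|y - x| <= e -> Sigma y.
Proof.
move=> Sx.
(* [r] is the inverse of a radius, which turns the finitely many conditions into lower bounds on
   [r]. *)
have [rho|B B0 HB] := @fin_bound R _ (fun (rho : 'I_mu) r => forall y, `|y - x| <= r^-1 ->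
    `]tau rho + (k rho)%:~R * pi / sr rho - pi, tau rho + (k rho)%:~R * pi / sr rho[%classic y).
  have := Sx rho I; rewrite /= in_itv /=; set u := tau rho + _ => /andP[h1 h2].
  pose g := Num.min (x - (u - pi)) (u - x).
  have g0 : 0 < g by rewrite lt_min; apply/andP; split; lra.
  exists (2 / g) => r hr y hy; rewrite in_itv /=.
  have r0 : 0 < r by apply: lt_le_trans hr; rewrite divr_gt0.
  have rg : r^-1 <= g / 2.
    by rewrite -(invrK (g / 2)) lef_pV2 ?posrE ?invr_gt0 ?divr_gt0// invf_div.
  have g1 : g <= x - (u - pi) by rewrite ge_min lexx.
  have g2 : g <= u - x by rewrite ge_min lexx orbT.
  move: hy; rewrite ler_norml => /andP[? ?]; apply/andP; split; lra.
exists B^-1; first by rewrite invr_gt0.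
by move=> y hy rho _; apply: HB.
Qed.

(** Two distinct blocks provide a Stokes direction, and with it the bounds on [Sigma]. *)
Let two_blocks : exists i j : 'I_l, i != j.
Proof. by exists (Ordinal (ltnW l_ge2)), (Ordinal l_ge2). Qed.

Lemma Sigma_diam x y : Sigma x -> Sigma y -> `|x - y| < pi.
Proof.
have [i [j /dir[t [S [_ _ H]]]]] := two_blocks.
move=> /H/andP[? ?] /H/andP[? ?]; rewrite ltr_norml; apply/andP; split; lra.
Qed.

Lemma Sigma_has_inf : has_inf Sigma.
Proof.
have [i [j /dir[t [S [_ _ H]]]]] := two_blocks.
by split => //; exists (t - pi) => x /H/andP[/ltW].
Qed.

Lemma Sigma_has_sup : has_sup Sigma.
Proof.
have [i [j /dir[t [S [_ _ H]]]]] := two_blocks.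
by split => //; exists t => x /H/andP[_ /ltW].
Qed.

Lemma Sigma_bounds x : Sigma x -> inf Sigma < x < sup Sigma.
Proof.
move=> /Sigma_open[e e0 H]; apply/andP; split.
  have : inf Sigma <= x - e.
    apply: ge_inf; first exact: Sigma_has_inf.2.
    by apply: H; rewrite addrAC subrr add0r normrN ger0_norm ?(ltW e0).
  lra.
have : x + e <= sup Sigma.
  apply: ub_le_sup; first exact: Sigma_has_sup.2.
  by apply: H; rewrite addrAC subrr add0r ger0_norm ?(ltW e0).
lra.
Qed.

Lemma Sigma_margin x y : Sigma x -> Sigma y -> x <= y ->
  exists e : R, [/\ 0 < e, e <= pi / 2 & forall z, x - e <= z <= y + e -> Sigma z].
Proof.
move=> Sx Sy xy; have p0 : 0 < pi :> R by exact: pi_gt0.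
have [e1 e10 H1] := Sigma_open Sx; have [e2 e20 H2] := Sigma_open Sy.
have [e [e0 ep ee1 ee2]] : exists e : R, [/\ 0 < e, e <= pi / 2, e <= e1 & e <= e2].
  exists (Num.min (pi / 2) (Num.min e1 e2)); rewrite !lt_min e10 e20 !ge_min !lexx !orbT.
  by split => //; rewrite !andbT divr_gt0.
exists e; split => // z; apply: Sigma_convex.
  by apply: H1; rewrite addrAC subrr add0r normrN ger0_norm ?(ltW e0).
by apply: H2; rewrite addrAC subrr add0r ger0_norm ?(ltW e0).
Qed.

(** When [th] lies outside [[c, d]], the nearest direction is an endpoint and the margin [e] is
    measured from there; inside, the distance is 0. *)
Lemma clamp_angle (c d e th : R) : c <= d -> e <= pi / 2 ->
  c - pi / 2 + e <= th <= d + pi / 2 - e -> `|th - clamp c d th| <= pi / 2 - e.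
Proof.
move=> cd ep /andP[h1 h2]; rewrite /clamp ler_norml.
by case: (leP th d) => h3; case: (leP c _) => h4; apply/andP; split; lra.
Qed.

(** The directions [phi - pi / 2] keep a common margin [e] inside [Sigma]. So the sign condition on
    the lines holds with the same [e] for all [phi] in [[c, d]], and with one threshold over the
    finitely many pairs of blocks. *)
Lemma uniform_solutions (c d : R) : c <= d -> Sigma (c - pi / 2) -> Sigma (d - pi / 2) ->
  exists B (eps : R -> R -> R), [/\ a <= B,
    forall e : R, 0 < e -> exists B', forall phi b, c <= phi <= d -> B' < b -> eps phi b <= e &
    forall phi, c <= phi <= d -> exists Y, hps phi Y /\ forall z, hp B z -> forall p j,
      normc (twist q Y (chart phi z) p j) <= 2 * eps phi (complex.Re z)].
Proof.
move=> cd Sc Sd.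
have [e [e0 ep He]] := Sigma_margin Sc Sd (lerB cd (lexx _)).
have [rho [eps [hrho heps]]] := line_decay hN a_gt0 Rp_holo Rp_decay cd.
have /choice[dd hdd] : forall ij : 'I_l * 'I_l, exists tS : R * R, ij.1 != ij.2 ->
    stokes_direction sigma lam sr tau k ij.1 ij.2 tS.1 tS.2.
  move=> [i j] /=; have [_|/dir[t [S H]]] := eqVneq i j; first by exists (0, 0).
  by exists (t, S).
have [ij|B1 B10 HB1] := @fin_bound R _ (fun (ij : 'I_l * 'I_l) r => ij.1 != ij.2 ->
    forall phi z, c <= phi <= d -> r <= complex.Re z ->
    0 <= (dd ij).2 * complex.Re (\sum_m (lam ij.1 m - lam ij.2 m) *
      ('i%C * ((sigma m)%:C * zpow (chart phi z) (sigma m - 1) * polar 1 phi)))).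
  have [E|ne] := eqVneq ij.1 ij.2; first by exists 0.
  have [B B0 HB] := line_sign sigma0 sigma_decr sigma_gt0 lam_inj ne (hdd ij ne) e0.
  exists B => r Br _ phi z /andP[p1 p2] rz; apply: HB; first exact: le_trans rz.
  have [_ _ H] := hdd ij ne.
  (* Membership of the two extreme points in [Sigma] places [tau'] at distance more than [e] inside
     the strip of every [phi]. *)
  have /andP[h1 _] : (dd ij).1 - pi < c - pi / 2 - e < (dd ij).1.
    by apply: H; apply: He; apply/andP; split; lra.
  have /andP[_ h2] : (dd ij).1 - pi < d - pi / 2 + e < (dd ij).1.
    by apply: H; apply: He; apply/andP; split; lra.
  by apply/andP; split; lra.
have [B2 aB2 HB2] := heps 2^-1 (ltac:(lra)).
exists (Num.max B2 B1), eps; split; first by rewrite le_max aB2.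
  by move=> r /heps[B' _ HB']; exists B'.
move=> phi hphi.
(* The bound [1 / (4 (n + 1))] on [eps] makes [1 + F] invertible on the line [b1]. *)
have [b1 Bb1 nb1] : exists2 b, Num.max B2 B1 < b & n%:R * (2 * eps phi b) < 1.
  have n0 : 0 < 4 * (n%:R + 1) :> R by rewrite mulr_gt0// ltr_wpDl.
  have [B3 _ HB3] := heps (4 * (n%:R + 1))^-1 (ltac:(by rewrite invr_gt0)).
  have ltp (x : R) : x < x + 1 by rewrite ltrDl.
  exists (Num.max (Num.max B2 B1) B3 + 1).
    by apply: le_lt_trans (ltp _); rewrite le_max lexx.
  set b := _ + 1; have Bb : B3 < b.
    by apply: le_lt_trans (ltp _); rewrite le_max lexx orbT.
  have := HB3 phi b hphi Bb => hb.
  apply: le_lt_trans (_ : n%:R * (2 * (4 * (n%:R + 1))^-1) < 1).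
    by rewrite ler_wpM2l// ler_pM2l.
  rewrite mulrA ltr_pdivrMr// mul1r; have : 0 <= n%:R :> R by []. lra.
have mB b : Num.max B2 B1 < b -> a < b /\ B2 < b.
  by rewrite gt_max => /andP[h1 _]; split => //; exact: le_lt_trans h1.
apply: (half_plane_solution (rho := rho phi) (eps := eps phi) a_gt0 Lam_diag LamE Rp_holo).
- by rewrite le_max aB2.
- move=> p j.
  have E z : 'i%C * (qd' sigma blk lam phi p z - qd' sigma blk lam phi j z) =
     \sum_m (lam (blk p) m - lam (blk j) m) *
      ('i%C * ((sigma m)%:C * zpow (chart phi z) (sigma m - 1) * polar 1 phi)).
    rewrite /qd' -sumrB mulr_sumr; apply: eq_bigr => m _; ring.
  have [bE|ne] := eqVneq (blk p) (blk j).
    by left => z _; rewrite E bE big1 // => m _; rewrite subrr mul0r.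
  have HS z : hp (Num.max B2 B1) z -> 0 <= (dd (blk p, blk j)).2 *
      complex.Re ('i%C * (qd' sigma blk lam phi p z - qd' sigma blk lam phi j z)).
    move=> hz; rewrite E; apply: (HB1 B1 (lexx _) (blk p, blk j) ne phi z hphi).
    by apply: ltW; apply: le_lt_trans hz; rewrite le_max lexx orbT.
  have [S0 _ _] := hdd (blk p, blk j) ne.
  case: (ltgtP 0 (dd (blk p, blk j)).2) HS => [Sp|Sn|S00] HS.
  + by right => z /HS; rewrite pmulr_rge0.
  + by left => z /HS; rewrite nmulr_rge0.
  + by rewrite /= -S00 eqxx in S0.
- by move=> b t /mB[ab _]; exact: (hrho phi b hphi ab t).1.
- by move=> b t /mB[ab _]; exact: (hrho phi b hphi ab t).2.
- by move=> b /mB[_ Bb]; exact: HB2.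
- by exists b1.
Qed.

(** Along a ray the abscissa in the chart is [r cos (th - phi)], which tends to infinity. *)
Lemma estimate_ray phi B (ep : R -> R) Y : a <= B ->
  (forall e : R, 0 < e -> exists B', forall b, B' < b -> ep b <= e) ->
  (forall z, hp B z -> forall p j, normc (twist q Y (chart phi z) p j) <= 2 * ep (complex.Re z)) ->
  rayb phi Y.
Proof.
move=> aB hep hY th /andP[t1 t2] e e0.
have c0 : 0 < cos (th - phi) by apply: cos_gt0_pihalf; apply/andP; split; lra.
have e2 : 0 < e / 2 by lra.
have [B' HB'] := hep _ e2.
exists (Num.max B B' / cos (th - phi)) => r; rewrite ltr_pdivrMr// => hr p j.
have r0 : 0 < r.
  rewrite -(pmulr_lgt0 _ c0); apply: lt_trans hr; apply: lt_le_trans a_gt0 _.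
  by rewrite le_max aB.
have ht : phi - pi / 2 < (r, th).2 < phi + pi / 2 by rewrite /= t1.
have E := unchartK (r0 : ucover (r, th)) ht; rewrite -E.
move: hr; rewrite gt_max => /andP[h1 h2].
have := hY (unchart phi (r, th)) h1 p j; rewrite Re_unchart /= => /le_trans; apply.
have := HB' _ h2; lra.
Qed.

Lemma half_plane_unique phi1 phi2 Y1 Y2 : Sigma (phi1 - pi / 2) -> Sigma (phi2 - pi / 2) ->
  hps phi1 Y1 -> hps phi2 Y2 -> rayb phi1 Y1 -> rayb phi2 Y2 ->
  forall z, HHo a phi1 z -> HHo a phi2 z -> Y2 z = Y1 z.
Proof.
move=> S1 S2; apply: overlap_unique => //.
  by have := Sigma_diam S1 S2; rewrite opprB addrA subrK.
move=> p j ne; have [t [S H]] := dir ne; have [_ _ hS] := H.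
have /andP[a1 a2] := hS _ S1; have /andP[b1 b2] := hS _ S2.
apply: (ray_sign sigma0 sigma_decr sigma_gt0 lam_inj ne H).
  by case: (leP phi1 phi2) => _; lra.
by case: (leP phi1 phi2) => _; lra.
Qed.

Lemma HHI_ray phi th : phi - pi / 2 < th < phi + pi / 2 ->
  exists M, forall r, M < r -> HHI [set phi] a (r, th).
Proof.
move=> ht; have [B B0 HB] := HHo_ray a_gt0 ht.
exists B => r /HB[r0 _ hr]; exists phi => //; split => //=.
have /andP[t1 t2] := ht.
have c0 : 0 < cos (th - phi) by apply: cos_gt0_pihalf; apply/andP; split; lra.
by rewrite -cosN opprB ler_pdivrMr// ltW.
Qed.

(** The sets [HH phi a] are closed while [HHo a phi] is open. A boundary point of [HH phi a] with
    argument other than [phi] becomes interior when [phi] is turned slightly towards that argument,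
    which the openness of [Sigma] permits; the one with argument [phi] has modulus [a] and is not in
    [outer a]. *)
Lemma domain_HHo z : (HHI [set x + pi / 2 | x in Sigma] a `&` outer a) z <->
  exists2 phi, Sigma (phi - pi / 2) & HHo a phi z.
Proof.
split; last first.
  move=> [phi Sphi [z0 z2 hz]]; have /andP[t1 t2] := z2.
  have c0 : 0 < cos (z.2 - phi) by apply: cos_gt0_pihalf; apply/andP; split; lra.
  split.
    exists phi; first by exists (phi - pi / 2) => //; rewrite subrK.
    by split => //; rewrite -cosN opprB ler_pdivrMr// ltW.
  split => //; apply: lt_le_trans hz _; rewrite ler_piMr ?cos_le1// ltW//.
move=> [[_ [x Sx <-] [z0 /andP[t1 t2] hz]] [_ az]].
set phi := x + pi / 2 in t1 t2 hz.
have c0 : 0 < cos (phi - z.2) by apply: cos_gt0_pihalf; apply/andP; split; lra.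
rewrite ler_pdivrMr// in hz.
have [zp|zp] := eqVneq z.2 phi.
  exists phi; first by rewrite /phi addrK.
  by split => //; [rewrite t1|rewrite zp subrr cos0 mulr1].
have [e e0 He] := Sigma_open Sx.
have p0 : 0 < pi :> R by exact: pi_gt0.
have D0 : 0 < `|z.2 - phi| by rewrite normr_gt0 subr_eq0.
have D1 : `|z.2 - phi| < pi / 2 by rewrite ltr_norml; apply/andP; split; lra.
(* The fraction of the way from [phi] to [z.2]: at most 1, and short enough to remain in [Sigma]. *)
pose d := Num.min 1 (e / `|z.2 - phi|).
have d0 : 0 < d by rewrite lt_min ltr01 divr_gt0.
have d1 : d <= 1 by rewrite ge_min lexx.
have de : d * `|z.2 - phi| <= e by rewrite -ler_pdivlMr// ge_min lexx orbT.
pose phi' := phi + d * (z.2 - phi).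
have Ez : z.2 - phi' = (1 - d) * (z.2 - phi) by rewrite /phi'; ring.
have N1 : `|z.2 - phi'| = (1 - d) * `|z.2 - phi|.
  by rewrite Ez normrM ger0_norm ?subr_ge0.
have N2 : `|z.2 - phi'| < `|z.2 - phi|.
  by rewrite N1 mulrBl mul1r ltrBlDr ltrDl mulr_gt0.
have N0 := normr_ge0 (z.2 - phi').
have cosabs (y : R) : cos y = cos `|y| by case: (ler0P y) => _ //; rewrite cosN.
exists phi'.
  by apply: He; rewrite /phi' /phi (_ : _ - x = d * (z.2 - phi)) ?normrM ?(ger0_norm (ltW d0))//; rewrite /phi; ring.
have : `|z.2 - phi'| < pi / 2 by exact: lt_trans D1.
rewrite ltr_norml => /andP[? ?]; split => //; first by apply/andP; split; lra.
apply: le_lt_trans hz _; rewrite ltr_pM2l// -cosN opprB cosabs [ltRHS]cosabs.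
rewrite ltr_cos// in_itv /=; apply/andP; split; lra.
Qed.

Lemma is_mxderiv_local phi z (Y1 Y2 : R * R -> 'M[C]_n) : HHo a phi z ->
  (forall w, HHo a phi w -> Y1 w = Y2 w) ->
  is_mxderiv Y1 z ((Lambda_of sigma Lam z + Rp z) *m Y1 z) ->
  is_mxderiv Y2 z ((Lambda_of sigma Lam z + Rp z) *m Y2 z).
Proof.
move=> hz E; have [] := HHo_unchart hz; set x := unchart phi z => hx zE.
have hx0 := hp_hp0 a_gt0 hx.
rewrite -zE => /(mxder_chart hx0) hY; apply: chart_mxder => // p j.
have [d d0 H] := hp_open hx.
apply: (der_local d0 (F := fun w => Y1 (chart phi w) p j)) => [y hy|].
  by rewrite E//; apply: HHo_chart => //; exact: H.
by rewrite -E; [exact: hY|rewrite zE].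
Qed.

Local Notation I := [set x + pi / 2 | x in Sigma].
Local Notation D := (HHI I a `&` outer a).
Local Notation sol := (fundamental_solution (fun z => Lambda_of sigma Lam z + Rp z) D).
Local Notation behaviour Y := (forall J, is_closed_interval J -> J `<=` I ->
  exp_behaviour N q Y (HHI J a)).

Lemma I_shift phi : I phi <-> Sigma (phi - pi / 2).
Proof.
split; first by move=> [x Sx <-]; rewrite addrK.
by move=> Sx; exists (phi - pi / 2) => //; rewrite subrK.
Qed.

Lemma sol_half_plane Y phi : sol Y -> Sigma (phi - pi / 2) -> hps phi Y.
Proof. by move=> hY Sphi z hz; apply: hY; apply/domain_HHo; exists phi. Qed.

Lemma behaviour_ray Y phi : behaviour Y -> Sigma (phi - pi / 2) -> rayb phi Y.
Proof.
move=> hY Sphi th ht e e0.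
have J1 : is_closed_interval [set phi] by exists phi, phi; split => //; rewrite set_itv1.
have JI : [set phi] `<=` I by move=> _ ->; exact/I_shift.
have /(exp_behaviourP hN) /(_ e e0)[M HM] := hY _ J1 JI.
have [M' HM'] := HHI_ray ht; exists (Num.max M M') => r; rewrite gt_max => /andP[rM rM'].
by apply: HM => //; exact: HM'.
Qed.

(** A solution is chosen for each direction and a direction for each point; by uniqueness on
    overlaps the value does not depend on the latter choice. *)
Lemma solution_exists : exists Y, sol Y /\ behaviour Y.
Proof.
have /choice[YY hYY] : forall phi, exists Y, Sigma (phi - pi / 2) -> hps phi Y /\ rayb phi Y.
  move=> phi; have [S|?] := pselect (Sigma (phi - pi / 2)); last by exists (fun=> 0).
  have [B [eps [aB he /(_ phi)]]] := uniform_solutions (lexx phi) S S.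
  rewrite lexx => /(_ isT)[Y [Y1 Y2]]; exists Y => _; split => //.
  apply: (estimate_ray aB _ Y2) => e /he[B' HB']; exists B' => b Bb.
  by apply: HB'; rewrite ?lexx.
have /choice[ph hph] : forall z, exists phi, D z -> Sigma (phi - pi / 2) /\ HHo a phi z.
  move=> z; have [/domain_HHo[phi S hz]|?] := pselect (D z); last by exists 0.
  by exists phi.
pose Y z := YY (ph z) z.
have YE phi z : Sigma (phi - pi / 2) -> HHo a phi z -> Y z = YY phi z.
  move=> S hz; have [|S' hz'] := hph z; first by apply/domain_HHo; exists phi.
  have [h1 r1] := hYY _ S; have [h2 r2] := hYY _ S'.
  exact: (half_plane_unique S S' h1 h2 r1 r2).
exists Y; split.
  move=> z /domain_HHo[phi S hz]; have [hY _] := hYY _ S; have [u d] := hY z hz.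
  split; first by rewrite (YE phi).
  apply: (is_mxderiv_local hz _ d) => w hw; by rewrite (YE phi).
move=> J [c [d [cd ->]]] JI; apply/(exp_behaviourP hN) => e e0.
have Sc : Sigma (c - pi / 2) by apply/I_shift; apply: JI; rewrite /= in_itv /= lexx.
have Sd : Sigma (d - pi / 2) by apply/I_shift; apply: JI; rewrite /= in_itv /= lexx andbT.
(* [m] is the margin by which [[c, d]] is enlarged inside [I]. *)
have [m [m0 mp Hm]] := Sigma_margin Sc Sd (lerB cd (lexx _)).
have Sc' : Sigma (c - m - pi / 2) by apply: Hm; apply/andP; split; lra.
have Sd' : Sigma (d + m - pi / 2) by apply: Hm; apply/andP; split; lra.
have cd' : c - m <= d + m by lra.
have [B [eps [aB he hsol]]] := uniform_solutions cd' Sc' Sd'.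
have [B' HB'] := he (e / 2) (ltac:(lra)).
have p0 : 0 < pi :> R by exact: pi_gt0.
have s0 : 0 < sin m by apply: sin_gt0_pi; apply/andP; split; lra.
exists (Num.max B B' / sin m) => z [phi /=]; rewrite in_itv /= => /andP[p1 p2] [z0 /andP[t1 t2] _].
rewrite ltr_pdivrMr// => hz1.
(* The nearest direction in the enlarged interval: the argument of [z] is within [pi / 2 - m] of it,
   so the abscissa of [z] in that chart is at least [|z| sin m]. *)
pose psi := clamp (c - m) (d + m) z.2.
have hpsi : c - m <= psi <= d + m by exact: clamp_itv.
have hang : `|z.2 - psi| <= pi / 2 - m by apply: clamp_angle => //; apply/andP; split; lra.
have cz := cos_lower m0 hang.
have z1 : Num.max B B' < z.1 * cos (z.2 - psi).
  by apply: lt_le_trans hz1 _; rewrite ler_pM2l.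
move: (z1); rewrite gt_max => /andP[zB zB'].
have hz : HHo a psi z.
  split => //; last exact: le_lt_trans zB.
  by move: hang; rewrite ler_norml => /andP[? ?]; apply/andP; split; lra.
have [hx zE] := HHo_unchart hz.
have [Y1 [h1 e1]] := hsol psi hpsi.
have Spsi : Sigma (psi - pi / 2).
  by move: hpsi => /andP[? ?]; apply: Hm; apply/andP; split; lra.
have [h2 r2] := hYY _ Spsi.
(* The solutions chosen in [YY] are controlled on rays only. The uniform estimate belongs to [Y1],
   and uniqueness on a single half-plane identifies the two. *)
have r1 : rayb psi Y1.
  apply: (estimate_ray aB _ e1) => r /he[B2 HB2]; exists B2 => b; exact: HB2.
have YY1 : Y z = Y1 z.
  by rewrite (YE psi)//; exact: (half_plane_unique Spsi Spsi h1 h2 r1 r2).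
move=> p j; have -> : twist q Y z = twist q Y1 z by rewrite /twist YY1.
rewrite -zE; apply: le_trans (e1 _ _ p j) _; first by rewrite /hp Re_unchart.
have := HB' psi (z.1 * cos (z.2 - psi)) hpsi zB'; rewrite Re_unchart; lra.
Qed.

Lemma solution_unique Y Y' : sol Y -> behaviour Y -> sol Y' -> behaviour Y' ->
  forall z, D z -> Y' z = Y z.
Proof.
move=> s b s' b' z /domain_HHo[phi S hz].
exact: (half_plane_unique S S (sol_half_plane s S) (sol_half_plane s' S)
  (behaviour_ray b S) (behaviour_ray b' S)).
Qed.

(** Far out, a closed subsector is contained in [HHI J a] for an interval [J] whose ends come from
    suitable points of [Sigma], because its arguments stay within [pi / 2 - m] of [J]. Conversely
    [HHI J a] is contained in the closed sector obtained by widening [J] by [pi / 2] on each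
    side. *)
Lemma behaviour_sectorP Y : behaviour Y <->
  forall S, is_closed_subsector (sector (inf Sigma) (sup Sigma + pi)) S -> exp_behaviour N q Y S.
Proof.
have p0 : 0 < pi :> R by exact: pi_gt0.
split => [bY _ [c [d [cd -> sub]]]|bY J [c [d [cd ->]]] JI].
  have [_ /andP[c1 _]] : sector (inf Sigma) (sup Sigma + pi) (1, c).
    by apply: sub; split; rewrite /ucover /= ?ltr01// lexx.
  have [_ /andP[_ d1]] : sector (inf Sigma) (sup Sigma + pi) (1, d).
    by apply: sub; split; rewrite /ucover /= ?ltr01// lexx andbT.
  rewrite /= in c1 d1.
  have [x1 Sx1 x1c] : exists2 x, Sigma x & x < c.
    have e0 : 0 < c - inf Sigma by rewrite subr_gt0.
    have [x Sx hx] := inf_adherent e0 Sigma_has_inf; exists x => //; lra.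
  have [x2 Sx2 x2d] : exists2 x, Sigma x & d < x + pi.
    have e0 : 0 < sup Sigma + pi - d by rewrite subr_gt0.
    have [x Sx hx] := sup_adherent e0 Sigma_has_sup; exists x => //; lra.
  have [y1 [y2 [Sy1 Sy2 y12 y1c y2d]]] : exists y1 y2,
      [/\ Sigma y1, Sigma y2, y1 <= y2, y1 < c & d < y2 + pi].
    (* When [x2 < x1], the point [x1] serves at both ends, since [d < x2 + pi < x1 + pi]. *)
    have [x12|x21] := leP x1 x2; first by exists x1, x2.
    exists x1, x1; split => //; lra.
  have [m [m0 mp m1 m2]] : exists m : R, [/\ 0 < m, m <= pi / 2, m <= c - y1 & m <= y2 + pi - d].
    exists (Num.min (pi / 2) (Num.min (c - y1) (y2 + pi - d))).
    rewrite !lt_min !ge_min !lexx !orbT; split => //.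
    by apply/and3P; split; lra.
  have s0 : 0 < sin m by apply: sin_gt0_pi; apply/andP; split; lra.
  have Jc : is_closed_interval `[y1 + pi / 2, y2 + pi / 2]%classic.
    by exists (y1 + pi / 2), (y2 + pi / 2); split => //; rewrite lerD2r.
  have JI : `[y1 + pi / 2, y2 + pi / 2]%classic `<=` I.
    move=> y /=; rewrite in_itv /= => /andP[h1 h2]; apply/I_shift.
    by apply: (Sigma_convex Sy1 Sy2); apply/andP; split; lra.
  apply/(exp_behaviourP hN) => e e0.
  have /(exp_behaviourP hN) /(_ e e0)[M HM] := bY _ Jc JI.
  exists (Num.max M (a / sin m)) => z [z0 /andP[cz zd]].
  rewrite gt_max => /andP[zM]; rewrite ltr_pdivrMr// => hz; apply: HM => //.
  have cd' : y1 + pi / 2 <= y2 + pi / 2 by rewrite lerD2r.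
  exists (clamp (y1 + pi / 2) (y2 + pi / 2) z.2); first by rewrite /= in_itv /=; exact: clamp_itv.
  have hang : `|z.2 - clamp (y1 + pi / 2) (y2 + pi / 2) z.2| <= pi / 2 - m.
    by apply: clamp_angle => //; apply/andP; split; lra.
  have cz' := cos_lower m0 hang.
  have c0 := lt_le_trans s0 cz'.
  split => //.
    by move: hang; rewrite ler_norml => /andP[? ?]; apply/andP; split; lra.
  rewrite -cosN opprB ler_pdivrMr// ltW//; apply: lt_le_trans hz _.
  by rewrite ler_pM2l.
have Sc : Sigma (c - pi / 2) by apply/I_shift; apply: JI; rewrite /= in_itv /= lexx.
have Sd : Sigma (d - pi / 2) by apply/I_shift; apply: JI; rewrite /= in_itv /= lexx andbT.
have /andP[h1 _] := Sigma_bounds Sc; have /andP[_ h2] := Sigma_bounds Sd.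
have sub : is_closed_subsector (sector (inf Sigma) (sup Sigma + pi))
    [set z | ucover z /\ c - pi / 2 <= z.2 <= d + pi / 2].
  exists (c - pi / 2), (d + pi / 2); split => //; first by lra.
  by move=> z [z0 /andP[q1 q2]]; split => //; apply/andP; split; lra.
apply/(exp_behaviourP hN) => e e0.
have /(exp_behaviourP hN) /(_ e e0)[M HM] := bY _ sub.
exists M => z [phi /=]; rewrite in_itv /= => /andP[p1 p2] [z0 /andP[t1 t2] _] zM.
by apply: HM => //; split => //; apply/andP; split; lra.
Qed.

End Assembly.

Theorem theorem3p10 (R : realType) (n h l : nat)
  (N : 'M[R[i]]_n -> R) (hN : is_mxnorm N)
  (a : R) (a_gt0 : 0 < a)
  (sigma : 'I_h.+1 -> R)
  (sigma0 : sigma ord0 = 1)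
  (sigma_decr : forall k k' : 'I_h.+1, (k < k')%N -> sigma k' < sigma k)
  (sigma_gt0 : forall k, 0 < sigma k)
  (Lam : 'I_h.+1 -> 'M[R[i]]_n)
  (Lam_diag : forall k, is_diag_mx (Lam k))
  (* block structure, up to a permutation of the coordinates *)
  (l_ge2 : (2 <= l)%N)
  (blk : 'I_n -> 'I_l) (blk_surj : forall i, exists p, blk p = i)
  (lam : 'I_l -> 'I_h.+1 -> R[i]) (lam_inj : injective lam)
  (LamE : forall k p, Lam k p p = (sigma k)%:C * lam (blk p) k)
  (Rp : R * R -> 'M[R[i]]_n)
  (Rp_holo : mx_holomorphic (outer a) Rp)
  (Rp_decay : forall I : set R, open I -> is_interval I -> good_decay N a Rp I)
  (eta : R) (eta_gen : generic_dir lam eta)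
  (mu : nat) (sr tau : 'I_mu -> R)
  (enum_couples : enumerates_couples sigma lam eta sr tau)
  (k : 'I_mu -> int)
  (k_adequate : Sigma_set sr tau k !=set0) :
  let Sigma := Sigma_set sr tau k in
  let I := [set x + pi / 2 | x in Sigma] in
  let D := HHI I a `&` outer a in
  let q := qdiag sigma lam blk in
  let solution :=
    fundamental_solution (fun z => Lambda_of sigma Lam z + Rp z) D in
  let behaviour Y := forall J, is_closed_interval J -> J `<=` I ->
    exp_behaviour N q Y (HHI J a) in
  let behaviour_sector Y := forall S,
    is_closed_subsector (sector (inf Sigma) (sup Sigma + pi)) S ->
    exp_behaviour N q Y S in
  (exists Y : R * R -> 'M[R[i]]_n,
     [/\ solution Y, behaviour Y
       & forall Y' : R * R -> 'M[R[i]]_n, solution Y' -> behaviour Y' ->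
         forall z, D z -> Y' z = Y z]) /\
  (forall Y : R * R -> 'M[R[i]]_n, solution Y ->
     (behaviour Y <-> behaviour_sector Y)).
Proof.
move=> Sigma I D q solution behaviour behaviour_sector; split.
  have [Y [sY bY]] := solution_exists k hN a_gt0 sigma0 sigma_decr sigma_gt0 Lam_diag
    l_ge2 lam_inj LamE Rp_holo Rp_decay eta_gen enum_couples.
  exists Y; split=> // Y' sY' bY'.
  exact: (solution_unique hN a_gt0 sigma0 sigma_decr sigma_gt0 Lam_diag l_ge2
    lam_inj LamE Rp_holo eta_gen enum_couples sY bY sY' bY').
by move=> Y _; apply: behaviour_sectorP; eassumption.
Qed.
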